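(* Let $p$ be a prime, let $(S,\mathcal{F},\mathcal{L})$ be a $p$-local finite group, and let $\mathcal{L}^q$ be a quasicentric linking system associated to $\mathcal{F}$ which extends $\mathcal{L}$. Let $\mathcal{L}'\subseteq\mathcal{L}^q$ be any full subcategory which contains (as objects) all subgroups of $S$ that are both $\mathcal{F}$-radical and $\mathcal{F}$-centric. Then the inclusions of $\mathcal{L}'$ and $\mathcal{L}$ in $\mathcal{L}^q$ induce homotopy equivalences $|\mathcal{L}'|\simeq|\mathcal{L}^q|\simeq|\mathcal{L}|$.
   Context: For subgroups $P,Q$ of a finite $p$-group $S$: $c_x$ denotes conjugation $g\mapsto xgx^{-1}$; $\mathrm{Hom}_S(P,Q)$ is the set of homomorphisms induced by conjugation in $S$; $\mathrm{Aut}_S(P)=\mathrm{Hom}_S(P,P)$; $\mathrm{Inj}(P,Q)$ is the set of injective homomorphisms. $|\mathcal{C}|$ is the (geometric realization of the) nerve of a category $\mathcal{C}$. A fusion system $\mathcal{F}$ over $S$ is a category whose objects are all subgroups of $S$, whose morphisms are group homomorphisms, such that for all $P,Q\le S$: $\mathrm{Hom}_S(P,Q)\subseteq \mathrm{Hom}_{\mathcal{F}}(P,Q)\subseteq \mathrm{Inj}(P,Q)$, and each $\varphi\in\mathrm{Hom}_{\mathcal{F}}(P,Q)$ is the composite of an isomorphism in $\mathcal{F}$ followed by an inclusion. $\mathrm{Aut}_{\mathcal{F}}(P)=\mathrm{Hom}_{\mathcal{F}}(P,P)$, $\mathrm{Out}_{\mathcal{F}}(P)=\mathrm{Aut}_{\mathcal{F}}(P)/\mathrm{Inn}(P)$.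 Subgroups are $\mathcal{F}$-conjugate if isomorphic in $\mathcal{F}$. $P$ is $\mathcal{F}$-centric if $C_S(P')=Z(P')$ for all $P'$ $\mathcal{F}$-conjugate to $P$; $\mathcal{F}$-radical if $O_p(\mathrm{Out}_{\mathcal{F}}(P))=1$ ($O_p$ = maximal normal $p$-subgroup); fully centralized (fully normalized) if $|C_S(P)|\ge|C_S(P')|$ ($|N_S(P)|\ge|N_S(P')|$) for all $P'$ $\mathcal{F}$-conjugate to $P$. $\mathcal{F}$ is saturated if for all $P\le S$: (I) if $P$ is fully normalized then $P$ is fully centralized and $\mathrm{Aut}_S(P)\in\mathrm{Syl}_p(\mathrm{Aut}_{\mathcal{F}}(P))$; (II) if $\varphi\in\mathrm{Hom}_{\mathcal{F}}(P,S)$ and $\varphi(P)$ is fully centralized, then $\varphi$ extends to some $\overline\varphi\in\mathrm{Hom}_{\mathcal{F}}(N_\varphi,S)$, where $N_\varphi=\{g\in N_S(P)\mid \varphi c_g\varphi^{-1}\in\mathrm{Aut}_S(\varphi(P))\}$. Let $\mathcal{F}^c\subseteq\mathcal{F}$ be the full subcategory on the $\mathcal{F}$-centric subgroups. A centric linking system associated to $\mathcal{F}$ is a category $\mathcal{L}$ whose objects are the $\mathcal{F}$-centric subgroups of $S$, with a functor $\pi:\mathcal{L}\to\mathcal{F}^c$ and monomorphisms $\delta_P:P\to\mathrm{Aut}_{\mathcal{L}}(P)$, such that: (A) $\pi$ is the identity on objects, and for all $P,Q$, $Z(P)$ acts freely on $\mathrm{Mor}_{\mathcal{L}}(P,Q)$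 by composition (via $\delta_P$) and $\pi$ induces a bijection $\mathrm{Mor}_{\mathcal{L}}(P,Q)/Z(P)\cong\mathrm{Hom}_{\mathcal{F}}(P,Q)$; (B) $\pi(\delta_P(x))=c_x$ for $x\in P$; (C) $f\circ\delta_P(x)=\delta_Q(\pi(f)(x))\circ f$ for $f\in\mathrm{Mor}_{\mathcal{L}}(P,Q)$, $x\in P$. A $p$-local finite group is a triple $(S,\mathcal{F},\mathcal{L})$ with $S$ a finite $p$-group, $\mathcal{F}$ a saturated fusion system over $S$, $\mathcal{L}$ a centric linking system associated to $\mathcal{F}$. $C_{\mathcal{F}}(P)$ is the fusion system over $C_S(P)$ with $\mathrm{Hom}_{C_{\mathcal{F}}(P)}(Q,Q')=\{\varphi\in\mathrm{Hom}_{\mathcal{F}}(Q,Q')\mid \exists\,\psi\in\mathrm{Hom}_{\mathcal{F}}(QP,Q'P),\ \psi|_Q=\varphi,\ \psi|_P=\mathrm{Id}_P\}$. $P\le S$ is $\mathcal{F}$-quasicentric if for each fully centralized $P'$ $\mathcal{F}$-conjugate to $P$, $C_{\mathcal{F}}(P')$ is the fusion system of the $p$-group $C_S(P')$ (all its morphisms are conjugations by elements of $C_S(P')$). $\mathcal{F}^q\subseteq\mathcal{F}$ is the full subcategory on the $\mathcal{F}$-quasicentric subgroups. A quasicentric linking system associated to a saturated $\mathcal{F}$ is a category $\mathcal{L}^q$ whose objects are the $\mathcal{F}$-quasicentric subgroups of $S$, with a functor $\pi:\mathcal{L}^q\to\mathcal{F}^q$ and monomorphisms $\delta_P:P\cdot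 C_S(P)\to\mathrm{Aut}_{\mathcal{L}^q}(P)$, such that: (A)$_q$ $\pi$ is the identity on objects and surjective on morphisms, and for $P,Q$ with $P$ fully centralized, $C_S(P)$ acts freely on $\mathrm{Mor}_{\mathcal{L}^q}(P,Q)$ by composition (via $\delta_P$) and $\pi$ induces a bijection $\mathrm{Mor}_{\mathcal{L}^q}(P,Q)/C_S(P)\cong\mathrm{Hom}_{\mathcal{F}}(P,Q)$; (B)$_q$ $\pi(\delta_P(g))=c_g\in\mathrm{Aut}_{\mathcal{F}}(P)$ for $g\in P$; (C)$_q$ $f\circ\delta_P(g)=\delta_Q(\pi(f)(g))\circ f$ for $f\in\mathrm{Mor}_{\mathcal{L}^q}(P,Q)$, $g\in P$; (D)$_q$ for each $P$ there is $\iota_P\in\mathrm{Mor}_{\mathcal{L}^q}(P,S)$ with $\pi(\iota_P)$ the inclusion of $P$ in $S$ and $\delta_S(g)\circ\iota_P=\iota_P\circ\delta_P(g)$ for all $g\in P\cdot C_S(P)$. $\mathcal{L}^q$ extends $\mathcal{L}$ if $\mathcal{L}$ is isomorphic to a full subcategory of $\mathcal{L}^q$ in a way consistent with the projection functors and distinguished monomorphisms $\delta_P$ (and $\mathcal{L}$ is then regarded as this full subcategory). *)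

(* Defs.v *)
From Stdlib Require Import Relation_Operators.
From HB Require Import structures.
From mathcomp Require Import all_classical all_reals topology normedtype.
From mathcomp Require Import all_boot all_order all_fingroup all_algebra all_solvable.

Set Implicit Arguments.
Unset Strict Implicit.
Unset Printing Implicit Defensive.

Import Order.TTheory GRing.Theory Num.Theory.
Import numFieldNormedType.Exports.

(** * Categories *)

Record category (Ob : Type) := Category {
  Mor : Ob -> Ob -> Type;
  idm : forall X, Mor X X;
  comp : forall X Y Z, Mor Y Z -> Mor X Y -> Mor X Z;
  comp_idl : forall X Y (f : Mor X Y), comp (idm Y) f = f;
  comp_idr : forall X Y (f : Mor X Y), comp f (idm X) = f;
  comp_assoc : forall X Y Z T (h : Mor Z T) (g : Mor Y Z) (f : Mor X Y),
    comp h (comp g f) = comp (comp h g) f }.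

Arguments idm {Ob} c X.
Arguments comp {Ob c X Y Z} g f.

Definition is_iso (Ob : Type) (C : category Ob) (X Y : Ob) (f : Mor C X Y) :=
  exists g : Mor C Y X, comp g f = idm C X /\ comp f g = idm C Y.

(* A functor with prescribed action h on objects. *)
Record functor (O1 O2 : Type) (C : category O1) (D : category O2)
    (h : O1 -> O2) := Functor {
  fmap :> forall X Y, Mor C X Y -> Mor D (h X) (h Y);
  fmap_id : forall X, fmap (idm C X) = idm D (h X);
  fmap_comp : forall X Y Z (g : Mor C Y Z) (f : Mor C X Y),
    fmap (comp g f) = comp (fmap g) (fmap f) }.

Arguments fmap {O1 O2 C D h} _ {X Y} _.

Definition functor_comp (O1 O2 O3 : Type) (C : category O1) (D : category O2)
    (E : category O3) (k : O2 -> O3) (h : O1 -> O2)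
    (G : functor D E k) (F : functor C D h) : functor C E (k \o h).
Proof.
refine (@Functor _ _ C E (k \o h) (fun X Y f => fmap G (fmap F f)) _ _).
- by move=> X; rewrite !fmap_id.
- by move=> X Y Z g f; rewrite !fmap_comp.
Defined.

Definition fullsub (Ob : Type) (C : category Ob) (D : Ob -> Prop) :
  category {X : Ob | D X}.
Proof.
refine (@Category _ (fun X Y => Mor C (sval X) (sval Y))
  (fun X => idm C (sval X)) (fun X Y Z g f => comp g f) _ _ _).
- by move=> X Y f; apply: comp_idl.
- by move=> X Y f; apply: comp_idr.
- by move=> X Y Z T h g f; apply: comp_assoc.
Defined.

Definition incl_functor (Ob : Type) (C : category Ob) (D : Ob -> Prop) :
  functor (fullsub C D) C sval.
Proof. by refine (@Functor _ _ (fullsub C D) C sval (fun X Y f => f) _ _). Defined.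

Definition ordcat (n : nat) : category 'I_n.+1.
Proof.
refine (@Category 'I_n.+1 (fun i j => i <= j)%N (fun i => leqnn i)
  (fun i j k jk ij => leq_trans ij jk) _ _ _); move=> *; exact: bool_irrelevance.
Defined.

(** * Simplicial sets and the nerve *)

Definition monotone (m n : nat) (th : 'I_m.+1 -> 'I_n.+1) :=
  {homo th : i j / (i <= j)%N}.

Lemma monotone_id (n : nat) : monotone (@id 'I_n.+1).
Proof. by []. Qed.

Lemma monotone_comp (m n k : nat) (th : 'I_n.+1 -> 'I_k.+1)
  (ph : 'I_m.+1 -> 'I_n.+1) : monotone th -> monotone ph -> monotone (th \o ph).
Proof. by move=> tm pm i j ij; apply/tm/pm. Qed.

Record sset := SSet {
  simplices :> nat -> Type;
  face : forall m n (th : 'I_m.+1 -> 'I_n.+1),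
    monotone th -> simplices n -> simplices m;
  face_id : forall n (x : simplices n), face (@monotone_id n) x = x;
  face_comp : forall m n k (th : 'I_n.+1 -> 'I_k.+1) (ph : 'I_m.+1 -> 'I_n.+1)
    (tm : monotone th) (pm : monotone ph) (x : simplices k),
    face (monotone_comp tm pm) x = face pm (face tm x) }.

Record smap (X Y : sset) := SMap {
  smap_fun :> forall n, X n -> Y n;
  smap_nat : forall m n (th : 'I_m.+1 -> 'I_n.+1) (tm : monotone th) (x : X n),
    smap_fun (face tm x) = face tm (smap_fun x) }.

Definition ordfunctor (m n : nat) (th : 'I_m.+1 -> 'I_n.+1) (tm : monotone th) :
  functor (ordcat m) (ordcat n) th.
Proof.
by refine (@Functor _ _ (ordcat m) (ordcat n) th tm _ _) => *;
  exact: bool_irrelevance.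
Defined.

Lemma functor_eq (O1 O2 : Type) (C : category O1) (D : category O2)
    (h : O1 -> O2) (F G : functor C D h) :
  (forall X Y (f : Mor C X Y), fmap F f = fmap G f) -> F = G.
Proof.
case: F G => F F1 F2 [G G1 G2] /= FG.
have E : F = G.
  by apply: functional_extensionality_dep => X;
     apply: functional_extensionality_dep => Y;
     apply: functional_extensionality_dep => f; apply: FG.
by case: _ / E in G1 G2 *; congr Functor; apply: Prop_irrelevance.
Qed.

Section Nerve.
Variables (Ob : Type) (C : category Ob).

(* An n-simplex is a functor from the poset [0 < 1 < ... < n] to C. *)
Definition nerve_simplices (n : nat) :=
  {h : 'I_n.+1 -> Ob & functor (ordcat n) C h}.

Definition nerve : sset.
Proof.
refine (@SSet nerve_simplices
  (fun m n th tm x => existT _ (projT1 x \o th)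
                             (functor_comp (projT2 x) (ordfunctor tm))) _ _).
- move=> n [h F] /=; congr existT; apply: functor_eq => i j ij /=.
  by congr fmap; apply: bool_irrelevance.
- move=> m n k th ph tm pm [h F] /=; congr existT.
  apply: functor_eq => i j ij /=.
  by congr fmap; apply: bool_irrelevance.
Defined.
End Nerve.

Definition nerve_map (O1 O2 : Type) (C : category O1) (D : category O2)
    (h : O1 -> O2) (F : functor C D h) : smap (nerve C) (nerve D).
Proof.
refine (@SMap (nerve C) (nerve D)
  (fun n x => existT _ (h \o projT1 x) (functor_comp F (projT2 x))) _).
by move=> m n th tm [k G] /=; congr existT; apply: functor_eq.
Defined.

(** * Geometric realization *)

Section Simplex.
Variable R : realType.
Local Open Scope ring_scope.
Local Open Scope classical_set_scope.

Definition simplex_set (n : nat) : set 'rV[R]_n.+1 :=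
  [set t | (forall i, 0 <= t ord0 i) /\ \sum_i t ord0 i = 1].
Arguments simplex_set : clear implicits.

Definition simplex (n : nat) := classical_sets.set_type (simplex_set n).
HB.instance Definition _ n := Topological.on (simplex n).

Definition push_row m n (th : 'I_m.+1 -> 'I_n.+1) (t : 'rV[R]_m.+1) :
  'rV[R]_n.+1 := \row_j \sum_(i | th i == j) t ord0 i.

Lemma push_rowP m n (th : 'I_m.+1 -> 'I_n.+1) (t : simplex m) :
  push_row th (\val t) \in simplex_set n.
Proof.
case: t => t /= /set_mem [t0 t1]; apply/mem_set; split=> [j|].
  by rewrite mxE; apply: sumr_ge0 => i _.
under eq_bigr do rewrite mxE.
by rewrite -[RHS]t1 [RHS](partition_big th xpredT).
Qed.

Definition push m n (th : 'I_m.+1 -> 'I_n.+1) (t : simplex m) : simplex n :=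
  exist _ (push_row th (\val t)) (push_rowP th t).
End Simplex.

Definition cells (X : sset) := {n : nat & X n}.
HB.instance Definition _ (X : sset) := gen_eqMixin (cells X).
HB.instance Definition _ (X : sset) := gen_choiceMixin (cells X).

Section Realization.
Variables (R : realType).
Local Open Scope classical_set_scope.
Local Open Scope quotient_scope.

(* The disjoint union of one copy of the standard simplex for each simplex of
   X, with the disjoint union topology. *)
Definition cell_sum (X : sset) := {c : cells X & simplex R (projT1 c)}.
HB.instance Definition _ (X : sset) := Topological.on (cell_sum X).

Definition cell_pt (X : sset) n (x : X n) (t : simplex R n) : cell_sum X :=
  existT (fun c : cells X => simplex R (projT1 c)) (existT _ n x) t.

Inductive glue (X : sset) : cell_sum X -> cell_sum X -> Prop :=
  Glue m n (th : 'I_m.+1 -> 'I_n.+1) (tm : monotone th) (x : X n)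
    (t : simplex R m) : glue (cell_pt (face tm x) t) (cell_pt x (push th t)).

Section Quotient.
Variable X : sset.

Let glue_eq (a b : cell_sum X) : bool :=
  `[< clos_refl_sym_trans _ (@glue X) a b >].

Lemma glue_eq_refl : reflexive glue_eq.
Proof. by move=> a; apply/asboolP; apply: rst_refl. Qed.

Lemma glue_eq_sym : symmetric glue_eq.
Proof. by move=> a b; apply/asboolP/asboolP => ab; apply: rst_sym. Qed.

Lemma glue_eq_trans : transitive glue_eq.
Proof.
move=> b a c /asboolP ab /asboolP bc; apply/asboolP; exact: rst_trans ab bc.
Qed.

Definition glue_rel := EquivRel _ glue_eq_refl glue_eq_sym glue_eq_trans.

Definition realization := {eq_quot glue_rel}.
HB.instance Definition _ :=
  Topological.copy realization (quotient_topology realization).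
HB.instance Definition _ := Quotient.on realization.

Lemma realization_openE (U : set realization) :
  open U = open (\pi_realization @^-1` U).
Proof. by []. Qed.

Lemma realization_eqP (a b : cell_sum X) :
  \pi_realization a = \pi_realization b <->
  clos_refl_sym_trans _ (@glue X) a b.
Proof. by split=> [/eqmodP/asboolP|ab]//; apply/eqmodP/asboolP. Qed.
End Quotient.

Definition cell_map (X Y : sset) (f : smap X Y) (a : cell_sum X) : cell_sum Y :=
  let: existT c t := a in cell_pt (f _ (projT2 c)) t.

Definition realization_map (X Y : sset) (f : smap X Y) :
    realization X -> realization Y :=
  fun u => \pi_(realization Y) (cell_map f (generic_quotient.repr u)).

Lemma cell_map_glue (X Y : sset) (f : smap X Y) (a b : cell_sum X) :
  clos_refl_sym_trans _ (@glue X) a b ->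
  clos_refl_sym_trans _ (@glue Y) (cell_map f a) (cell_map f b).
Proof.
elim=> {a b} [_ _ [m n th tm x t]|a|a b _|a b c _ ab _].
- have -> : cell_map f (cell_pt (face tm x) t) = cell_pt (face tm (f _ x)) t.
    by rewrite -smap_nat.
  exact/rst_step/Glue.
- exact: rst_refl.
- exact: rst_sym.
- exact: rst_trans ab.
Qed.

Lemma realization_mapE (X Y : sset) (f : smap X Y) (a : cell_sum X) :
  realization_map f (\pi_(realization X) a) =
  \pi_(realization Y) (cell_map f a).
Proof.
by apply/realization_eqP/cell_map_glue/realization_eqP; rewrite reprK.
Qed.

Lemma realization_map_continuous (X Y : sset) (f : smap X Y) :
  continuous (realization_map f).
Proof.
have pi_cont Z : continuous (\pi_(realization Z)).
  by apply/continuousP => U; rewrite realization_openE.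
apply/continuousP => U oU; rewrite realization_openE.
have -> : \pi_(realization X) @^-1` (realization_map f @^-1` U) =
          cell_map f @^-1` (\pi_(realization Y) @^-1` U).
  by apply/funext => a; rewrite /preimage /= realization_mapE.
apply: open_comp => [a _|]; last by rewrite -realization_openE.
case: a => -[n x] t V; exact.
Qed.
End Realization.

Section HomotopyEquivalence.
Variable R : realType.
Local Open Scope ring_scope.
Local Open Scope classical_set_scope.

Definition homotopic (X Y : topologicalType) (f g : X -> Y) :=
  exists H : X * R -> Y,
    [/\ {within [set xt : X * R | 0 <= xt.2 <= 1], continuous H},
        forall x, H (x, 0) = f x & forall x, H (x, 1) = g x].

Definition homotopy_equivalence (X Y : topologicalType) (f : X -> Y) :=
  continuous f /\
  exists g : Y -> X,
    [/\ continuous g, homotopic (g \o f) id & homotopic (f \o g) id].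
End HomotopyEquivalence.

Definition nerve_realization (R : realType) (Ob : Type) (C : category Ob) :
  topologicalType := realization R (nerve C).

Definition nerve_realization_map (R : realType) (O1 O2 : Type)
    (C : category O1) (D : category O2) (h : O1 -> O2) (F : functor C D h) :
    nerve_realization R C -> nerve_realization R D :=
  realization_map (nerve_map F).

Arguments nerve_realization_map R {O1 O2 C D h} F _.

(** * Fusion systems *)

Local Open Scope group_scope.

Definition subgrp (gT : finGroupType) (S : {group gT}) :=
  {P : {group gT} | P \subset S}.

Coercion subgrp_group (gT : finGroupType) (S : {group gT}) (P : subgrp S) :
  {group gT} := sval P.

Definition top_subgrp (gT : finGroupType) (S : {group gT}) : subgrp S :=
  exist _ S (subxx S).

(* Hom_H(P, Q): maps from P to Q induced by g |-> x g x^-1 with x in H. *)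
Definition conj_hom (gT : finGroupType) (H : {set gT}) (P Q : {group gT}) :
    {set {ffun [subg P] -> [subg Q]}} :=
  [set f : {ffun [subg P] -> [subg Q]} | [exists x in H,
     [forall g : [subg P], sgval (f g) == x * sgval g * x^-1]]].

Record fusion_system (gT : finGroupType) (S : {group gT}) := FusionSystem {
  fhom : forall P Q : subgrp S, {set {ffun [subg P] -> [subg Q]}};
  fhom_comp : forall (P Q T : subgrp S) (g : {ffun [subg Q] -> [subg T]})
    (f : {ffun [subg P] -> [subg Q]}),
    g \in fhom Q T -> f \in fhom P Q -> [ffun x => g (f x)] \in fhom P T;
  fhom_conj : forall P Q : subgrp S, conj_hom S P Q \subset fhom P Q;
  fhom_inj : forall (P Q : subgrp S) (f : {ffun [subg P] -> [subg Q]}),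
    f \in fhom P Q -> {morph f : x y / x * y} /\ injective f;
  fhom_factor : forall (P Q : subgrp S) (f : {ffun [subg P] -> [subg Q]}),
    f \in fhom P Q ->
    exists (T : subgrp S) (a : {ffun [subg P] -> [subg T]})
           (b : {ffun [subg T] -> [subg P]}),
      [/\ T \subset Q, a \in fhom P T, b \in fhom T P,
          cancel a b /\ cancel b a
        & forall x, sgval (f x) = sgval (a x)] }.

Section Fusion.
Variables (gT : finGroupType) (S : {group gT}) (F : fusion_system S).
Implicit Types P Q T : subgrp S.

Lemma conj_hom_id P : [ffun x => x] \in conj_hom S P P.
Proof.
rewrite inE; apply/existsP; exists 1; rewrite group1 /=.
by apply/forallP => x; rewrite ffunE mul1g invg1 mulg1.
Qed.

Lemma fhom_id P : [ffun x => x] \in fhom F P P.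
Proof. exact: subsetP (fhom_conj F P P) _ (conj_hom_id P). Qed.

Definition fusion_cat : category (subgrp S).
Proof.
refine (@Category (subgrp S)
  (fun P Q => {f : {ffun [subg P] -> [subg Q]} | f \in fhom F P Q})
  (fun P => exist (fun f => f \in fhom F P P) _ (fhom_id P))
  (fun P Q T g f => exist (fun h => h \in fhom F P T) _
                      (fhom_comp (svalP g) (svalP f))) _ _ _).
- by move=> P Q f; apply/val_inj/ffunP => x; rewrite /= !ffunE.
- by move=> P Q f; apply/val_inj/ffunP => x; rewrite /= !ffunE.
- by move=> P Q T U h g f; apply/val_inj/ffunP => x; rewrite /= !ffunE.
Defined.

(* A morphism of F as a map gT -> gT; subg P x is only meaningful for x \in P. *)
Definition fapp P Q (f : Mor fusion_cat P Q) (x : gT) : gT :=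
  sgval (sval f (subg P x)).

Definition Fconj P Q := exists f : Mor fusion_cat P Q, is_iso f.

Definition centric P := forall Q, Fconj P Q -> 'C_S(Q) = 'Z(Q).

Definition fully_centralized P :=
  forall Q, Fconj P Q -> (#|'C_S(Q)| <= #|'C_S(P)|)%N.

Definition fully_normalized P :=
  forall Q, Fconj P Q -> (#|'N_S(Q)| <= #|'N_S(P)|)%N.

(* The product of {perm _} is the opposite of composition; Sylow subgroups and
   O_p are insensitive to this. *)
Definition perms_of P (A : {set {ffun [subg P] -> [subg P]}}) :
    {set {perm [subg P]}} :=
  [set a : {perm [subg P]} | [ffun x => a x] \in A].

Definition AutF P := perms_of (fhom F P P).
Definition AutS P := perms_of (conj_hom S P P).
Definition Inn P := perms_of (conj_hom P P P).

Lemma AutF_group_set P : group_set (AutF P).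
Proof.
apply/group_setP; split=> [|a b]; rewrite !inE.
  have <- : [ffun x => x] = [ffun x => (1 : {perm [subg P]}) x].
    by apply/ffunP => x; rewrite !ffunE perm1.
  exact: fhom_id.
move=> Fa Fb; have := fhom_comp Fb Fa.
have -> // : [ffun x => [ffun x => b x] ([ffun x => a x] x)] =
             [ffun x => (a * b) x].
by apply/ffunP => x; rewrite !ffunE permM.
Qed.

Definition radical (p : nat) P := 'O_p(AutF P / Inn P) = 1.

Definition Nphi P (f : Mor fusion_cat P (top_subgrp S)) : {set gT} :=
  [set g in 'N_S(P) | [exists h in 'N_S(fapp f @: P),
     [forall x in P, fapp f (g * x * g^-1) == h * fapp f x * h^-1]]].

Definition saturated (p : nat) :=
  (forall P, fully_normalized P ->
     fully_centralized P /\ p.-Sylow(AutF P) (AutS P)) /\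
  (forall P (f : Mor fusion_cat P (top_subgrp S)) Q,
     Q = fapp f @: P :> {set gT} -> fully_centralized Q ->
     exists (N : subgrp S) (g : Mor fusion_cat N (top_subgrp S)),
       N = Nphi f :> {set gT} /\ {in P, fapp g =1 fapp f}).

(* Morphisms from Q to T in C_F(P), for Q and T contained in C_S(P); the
   products Q P and T P are then subgroups. *)
Definition centralizer_hom P Q T : {set {ffun [subg Q] -> [subg T]}} :=
  [set f in fhom F Q T |
    `[< exists (QP TP : subgrp S) (g : Mor fusion_cat QP TP),
        [/\ QP = Q * P :> {set gT}, TP = T * P :> {set gT},
            forall x : [subg Q], fapp g (sgval x) = sgval (f x)
          & {in P, fapp g =1 id}] >]].

Definition quasicentric P :=
  forall P', Fconj P P' -> fully_centralized P' ->
  forall Q T, Q \subset 'C_S(P') -> T \subset 'C_S(P') ->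
    centralizer_hom P' Q T = conj_hom 'C_S(P') Q T.

Lemma fappE P Q (f : Mor fusion_cat P Q) (x : [subg P]) :
  fapp f (sgval x) = sgval (sval f x).
Proof. by rewrite /fapp sgvalK. Qed.

Lemma fapp_id P x : x \in P -> fapp (idm fusion_cat P) x = x.
Proof. by move=> Px; rewrite /fapp /= ffunE subgK. Qed.

Lemma fapp_comp P Q T (g : Mor fusion_cat Q T) (f : Mor fusion_cat P Q) x :
  fapp (comp g f) x = fapp g (fapp f x).
Proof. by rewrite /fapp /= ffunE sgvalK. Qed.

Lemma fapp_in P Q (f : Mor fusion_cat P Q) x : fapp f x \in Q.
Proof. exact: subgP. Qed.

Lemma Fconj_card P Q : Fconj P Q -> #|P| = #|Q|.
Proof.
case=> f [g [gf fg]]; apply/eqP; rewrite eqn_leq; apply/andP; split.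
  have inj_f : {in P &, injective (fapp f)}.
    move=> x y Px Py /(congr1 (fapp g)).
    by rewrite -!fapp_comp gf !fapp_id.
  rewrite -(card_in_imset inj_f); apply/subset_leq_card/subsetP.
  by move=> _ /imsetP[x _ ->]; apply: fapp_in.
have inj_g : {in Q &, injective (fapp g)}.
  move=> x y Qx Qy /(congr1 (fapp f)).
  by rewrite -!fapp_comp fg !fapp_id.
rewrite -(card_in_imset inj_g); apply/subset_leq_card/subsetP.
by move=> _ /imsetP[x _ ->]; apply: fapp_in.
Qed.

Lemma centric_quasicentric P : centric P -> quasicentric P.
Proof.
move=> cP P' PP' _ Q T sQ sT.
have CZ : 'C_S(P') = 'Z(P') by apply: cP.
rewrite CZ in sQ sT *.
have sZ : 'Z(P') \subset P' by apply: subsetIl.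
apply/setP => f; rewrite [RHS]inE [LHS]inE; apply/andP/existsP.
  case=> _ /asboolP[QP [TP [g [eQP _ gf gid]]]].
  exists 1; rewrite group1; apply/forallP => x.
  rewrite mul1g invg1 mulg1 -gf gid //.
  exact: subsetP (subset_trans sQ sZ) _ (subgP x).
case=> z /andP[Zz /forallP fz].
have {}fz x : sgval (f x) = sgval x.
  have Px := subsetP (subset_trans sQ sZ) _ (subgP x).
  rewrite (eqP (fz x)); apply: (mulIg z); rewrite mulgKV.
  by have /centerP[_ ->] := Zz.
have SS : f \in conj_hom S Q T.
  rewrite inE; apply/existsP; exists 1; rewrite group1; apply/forallP => x.
  by rewrite mul1g invg1 mulg1 fz.
split; first exact: subsetP (fhom_conj F Q T) _ SS.
apply/asboolP; exists P', P', (idm fusion_cat P').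
have mulE (A : {group gT}) : A \subset 'Z(P') -> P' = A * P' :> {set gT}.
  by move=> sA; rewrite mulSGid // (subset_trans sA).
split; [exact: mulE|exact: mulE| |by move=> x /fapp_id].
move=> x; rewrite fz fapp_id //.
exact: subsetP (subset_trans sQ sZ) _ (subgP x).
Qed.

Lemma centric_top : centric (top_subgrp S).
Proof.
move=> Q /Fconj_card eS; rewrite /center.
suff -> : Q = S :> {set gT} by [].
by apply/eqP; rewrite eqEcard (svalP Q) eS /=.
Qed.

Definition centric_obj := {P : subgrp S | centric P}.
Definition quasicentric_obj := {P : subgrp S | quasicentric P}.

Definition centric_quasi (P : centric_obj) : quasicentric_obj :=
  exist _ (sval P) (centric_quasicentric (svalP P)).

Definition quasi_top : quasicentric_obj :=
  exist _ (top_subgrp S) (centric_quasicentric centric_top).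

(* In the two records below the projection functor is the identity on objects,
   and delta P is a function on gT of which only the values on P (on the group
   P C_S(P) in the quasicentric case) matter. *)
Record centric_linking_system := CentricLinkingSystem {
  clink :> category centric_obj;
  cproj : functor clink (fullsub fusion_cat centric) id;
  cdelta : forall P : centric_obj, gT -> Mor clink P P;
  cdelta_aut : forall (P : centric_obj) x, x \in sval P -> is_iso (cdelta P x);
  cdelta_mul : forall (P : centric_obj),
    {in sval P &, forall x y, cdelta P (x * y) = comp (cdelta P x) (cdelta P y)};
  cdelta_inj : forall (P : centric_obj), {in sval P &, injective (cdelta P)};
  cfree : forall (P Q : centric_obj) (f : Mor clink P Q) z,
    z \in 'Z(sval P) -> comp f (cdelta P z) = f -> z = 1;
  cproj_surj : forall (P Q : centric_obj)
    (u : Mor fusion_cat (sval P) (sval Q)),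
    exists f : Mor clink P Q, fmap cproj f = u;
  cproj_orbit : forall (P Q : centric_obj) (f g : Mor clink P Q),
    fmap cproj f = fmap cproj g <->
    exists2 z, z \in 'Z(sval P) & g = comp f (cdelta P z);
  cproj_delta : forall (P : centric_obj) x g, x \in sval P -> g \in sval P ->
    fapp (fmap cproj (cdelta P x)) g = x * g * x^-1;
  cdelta_nat : forall (P Q : centric_obj) (f : Mor clink P Q) x,
    x \in sval P ->
    comp f (cdelta P x) = comp (cdelta Q (fapp (fmap cproj f) x)) f }.

Record quasicentric_linking_system := QuasicentricLinkingSystem {
  qlink :> category quasicentric_obj;
  qproj : functor qlink (fullsub fusion_cat quasicentric) id;
  qdelta : forall P : quasicentric_obj, gT -> Mor qlink P P;
  qdelta_aut : forall (P : quasicentric_obj) x,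
    x \in sval P * 'C_S(sval P) -> is_iso (qdelta P x);
  qdelta_mul : forall (P : quasicentric_obj),
    {in sval P * 'C_S(sval P) &,
      forall x y, qdelta P (x * y) = comp (qdelta P x) (qdelta P y)};
  qdelta_inj : forall (P : quasicentric_obj),
    {in sval P * 'C_S(sval P) &, injective (qdelta P)};
  qproj_surj : forall (P Q : quasicentric_obj)
    (u : Mor fusion_cat (sval P) (sval Q)),
    exists f : Mor qlink P Q, fmap qproj f = u;
  qfree : forall (P Q : quasicentric_obj) (f : Mor qlink P Q) z,
    fully_centralized (sval P) ->
    z \in 'C_S(sval P) -> comp f (qdelta P z) = f -> z = 1;
  qproj_orbit : forall (P Q : quasicentric_obj) (f g : Mor qlink P Q),
    fully_centralized (sval P) ->
    (fmap qproj f = fmap qproj g <->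
     exists2 z, z \in 'C_S(sval P) & g = comp f (qdelta P z));
  qproj_delta : forall (P : quasicentric_obj) x g,
    x \in sval P -> g \in sval P ->
    fapp (fmap qproj (qdelta P x)) g = x * g * x^-1;
  qdelta_nat : forall (P Q : quasicentric_obj) (f : Mor qlink P Q) x,
    x \in sval P ->
    comp f (qdelta P x) = comp (qdelta Q (fapp (fmap qproj f) x)) f;
  qiota : forall P : quasicentric_obj,
    exists i : Mor qlink P quasi_top,
      {in sval P, fapp (fmap qproj i) =1 id} /\
      {in sval P * 'C_S(sval P),
        forall g, comp (qdelta quasi_top g) i = comp i (qdelta P g)} }.

(* An isomorphism of L with the full subcategory of Lq on the centric
   subgroups. Consistency with the projections, which are the identity on
   objects, forces the identity on underlying subgroups. *)
Record extends (L : centric_linking_system) (Lq : quasicentric_linking_system) :=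
  Extends {
  emb :> functor L Lq centric_quasi;
  emb_bij : forall P Q : centric_obj,
    bijective (fun f : Mor L P Q => fmap emb f);
  emb_proj : forall (P Q : centric_obj) (f : Mor L P Q),
    fmap (qproj Lq) (fmap emb f) = fmap (cproj L) f;
  emb_delta : forall (P : centric_obj) x, x \in sval P ->
    fmap emb (cdelta L P x) = qdelta Lq (centric_quasi P) x }.
End Fusion.

(* Main.v *)
Require Import Defs.
From Stdlib Require Import Relation_Operators.
From mathcomp Require Import all_boot all_order all_fingroup all_algebra all_solvable.
From mathcomp Require Import all_classical all_reals topology function_spaces normedtype.
From mathcomp Require Import unstable ring lra zify.
Import Defs.

(** If all comma categories X|F of a functor F : C -> D have contractible nerves,
    then |F| is a homotopy equivalence (Quillen's Theorem A): the spaces |X|F| are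
    carriers for maps out of |D|, and carried maps, built simplex by simplex along
    the nondegenerate simplices, exist and are unique up to homotopy.

    In L^q, passing from an object to a fully normalized representative of its
    conjugacy class is a coreflection, so only such representatives matter. They
    are removed one order at a time, smallest first. If P is a representative that
    is not both radical and centric, the group H of all elements of N_S(P) that act
    on P through O_p(Aut_F(P)) properly contains P. An arrow out of P with normal
    image is an epimorphism, so the zigzag
      Y <- N_Y(P) -> N_Y(P) H <- H
    is natural in the arrow P -> Y and contracts the category of arrows from P to
    larger objects. These groups are objects because overgroups of quasicentric
    subgroups are quasicentric. *)

Set Implicit Arguments.
Unset Strict Implicit.
Unset Printing Implicit Defensive.

Import Order.TTheory GRing.Theory Num.Theory.
Import numFieldNormedType.Exports.

Local Open Scope classical_set_scope.
Local Open Scope ring_scope.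

(** * Homotopies *)

(** The group H is cut out by O_p because O_p is normal in Aut_F(P) and, for P fully normalized,
    contained in Aut_S(P). Normality makes H independent of how P is embedded in S, so the leg from
    H exists for every arrow out of P; Aut_S(P) is not normal in general. Since C_S(P) acts
    trivially, it lies in H, and H = P would force P to be both radical and centric. Smallest orders
    go first because the zigzag passes only through groups larger than P, which must still be
    objects.

    The axioms of L^q control only the morphisms out of fully centralized objects. Hence the work is
    done on representatives, isomorphisms are weakened to retractions, and the given class of
    objects, which need not be closed under isomorphism, is first enlarged by the representatives of
    its members.

    Maps into contractible carriers yield an explicit homotopy inverse, with no appeal to cell
    complexes or Whitehead's theorem, and also the homotopy attached to a natural transformation,
    with no triangulated prism. *)

Lemma continuous_paste (T U : topologicalType) (I : finType) (C : I -> set T)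
    (f : T -> U) (g : I -> T -> U) :
  (forall i, closed (C i)) -> (forall i, continuous (g i)) ->
  (forall x, exists i, C i x) -> (forall i x, C i x -> f x = g i x) ->
  continuous f.
Proof.
move=> cC cg cov fg; apply/continuous_closedP => A cA.
have -> : f @^-1` A = \big[setU/set0]_(i : I) (C i `&` g i @^-1` A).
  rewrite -bigcup_seq; apply/seteqP; split=> [x Ax|x [i _ [Cx]]].
    have [i Cx] := cov x; exists i; first by rewrite /= mem_index_enum.
    by split=> //; rewrite /preimage /= -fg.
  by rewrite /preimage /= -fg.
apply: closed_bigsetU => i _; apply: closedI => //.
by have /continuous_closedP := cg i; apply.
Qed.

Lemma continuous_pair (T U V : topologicalType) (f : T -> U) (g : T -> V) :
  continuous f -> continuous g -> continuous (fun x => (f x, g x)).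
Proof. by move=> cf cg x; apply: cvg_pair; [apply: cf|apply: cg]. Qed.

Lemma continuous_compT (T U V : topologicalType) (f : T -> U) (g : U -> V) :
  continuous f -> continuous g -> continuous (fun x => g (f x)).
Proof. by move=> cf cg x; apply: (continuous_comp (f := f)); [apply: cf|apply: cg]. Qed.

Lemma continuous_idT (T : topologicalType) : continuous (@id T).
Proof. by move=> x; exact: cvg_id. Qed.

Section Homot.
Variable R : realType.

Lemma closed_le_fun (T : topologicalType) (f g : T -> R) :
  continuous f -> continuous g -> closed [set x | f x <= g x].
Proof.
move=> cf cg.
have -> : [set x | f x <= g x] = (g \- f) @^-1` [set y : R | 0 <= y].
  by apply/seteqP; split=> x /=; rewrite subr_ge0.
apply: preimage_closed => [x _|]; last exact: closed_ge.
by apply: cvgB; [apply: cg|apply: cf].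
Qed.

Lemma closed_eq_fun (T : topologicalType) (f g : T -> R) :
  continuous f -> continuous g -> closed [set x | f x = g x].
Proof.
move=> cf cg.
have -> : [set x | f x = g x] = [set x | f x <= g x] `&` [set x | g x <= f x].
  apply/seteqP; split=> x /=; first by move=> ->.
  by move=> [fg gf]; apply/eqP; rewrite eq_le fg.
by apply: closedI; apply: closed_le_fun.
Qed.

Section Arith.
Variable T : topologicalType.
Implicit Types f g : T -> R.

Lemma continuous_cstT (U : topologicalType) (y : U) : continuous (fun _ : T => y).
Proof. by move=> x; exact: cvg_cst. Qed.

Lemma continuousDT f g :
  continuous f -> continuous g -> continuous (fun x => f x + g x).
Proof. by move=> cf cg x; apply: cvgD; [apply: cf|apply: cg]. Qed.

Lemma continuousBT f g :
  continuous f -> continuous g -> continuous (fun x => f x - g x).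
Proof. by move=> cf cg x; apply: cvgB; [apply: cf|apply: cg]. Qed.

Lemma continuousMT f g :
  continuous f -> continuous g -> continuous (fun x => f x * g x).
Proof. by move=> cf cg x; apply: cvgM; [apply: cf|apply: cg]. Qed.

Lemma continuousVT f :
  (forall x, f x != 0) -> continuous f -> continuous (fun x => (f x)^-1).
Proof. by move=> f0 cf x; apply: cvgV; [apply: f0|apply: cf]. Qed.

Lemma continuous_minT f g :
  continuous f -> continuous g -> continuous (fun x => Num.min (f x) (g x)).
Proof.
move=> cf cg x.
by apply: (@continuous_min R _ (f : _ -> R^o) (g : _ -> R^o) x); [apply: cf|apply: cg].
Qed.

Lemma continuous_maxT f g :
  continuous f -> continuous g -> continuous (fun x => Num.max (f x) (g x)).
Proof.
move=> cf cg x.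
by apply: (@continuous_max R _ (f : _ -> R^o) (g : _ -> R^o) x); [apply: cf|apply: cg].
Qed.

End Arith.

Lemma continuous_fstT (T U : topologicalType) : continuous (@fst T U).
Proof. by move=> x; exact: cvg_fst. Qed.

Lemma continuous_sndT (T U : topologicalType) : continuous (@snd T U).
Proof. by move=> x; exact: cvg_snd. Qed.

Lemma continuous_fst_comp (T U V : topologicalType) (f : T -> V) :
  continuous f -> continuous (fun z : T * U => f z.1).
Proof. exact: continuous_compT (@continuous_fstT T U). Qed.

Lemma continuous_snd_comp (T U V : topologicalType) (f : U -> V) :
  continuous f -> continuous (fun z : T * U => f z.2).
Proof. exact: continuous_compT (@continuous_sndT T U). Qed.

(* Stationary outside [0, 1], so that homotopies are continuous on all of X * R
   and can be glued without subspace topologies. *)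
Definition homot (X Y : topologicalType) (f g : X -> Y) :=
  exists2 H : X * R -> Y, continuous H &
    (forall x u, u <= 0 -> H (x, u) = f x) /\
    (forall x u, 1 <= u -> H (x, u) = g x).

Lemma homotopicP (X Y : topologicalType) (f g : X -> Y) :
  homotopic R f g <-> homot f g.
Proof.
split=> [[H [cH H0 H1]]|[H cH [H0 H1]]]; last first.
  exists H; split=> [|x|x]; [exact: continuous_subspaceT|exact: H0|exact: H1].
(* Clamping the time to [0, 1] keeps every argument in the region where [H] is known to be
   continuous. *)
pose c (u : R) : R := Num.max 0 (Num.min u 1).
have c0 u : 0 <= c u <= 1.
  by rewrite /c le_max lexx /= ge_max ler01 ge_min lexx orbT.
have cc : continuous c.
  apply: continuous_maxT; first exact: continuous_cstT.
  by apply: continuous_minT; [exact: continuous_idT|exact: continuous_cstT].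
exists (fun xu => H (xu.1, c xu.2)).
- pose q (xu : X * R) : X * R := (xu.1, c xu.2).
  have cq : continuous q.
    by apply: continuous_pair; [exact: continuous_fstT|exact: continuous_snd_comp].
  move=> xu A nA.
  have /(_ (q xu)) := (iffLR (subspace_continuousP _ _) cH).
  move=> /(_ (c0 _)) /(_ A nA) nA'; have := cq xu _ nA'.
  by apply: (@filterS _ (nbhs xu)) => z /(_ (c0 _)).
- split=> x u hu /=.
    by rewrite -H0 /c; congr (H (_, _)); rewrite max_l // ge_min hu.
  by rewrite -H1 /c; congr (H (_, _)); rewrite min_r // max_r.
Qed.

Variables (X Y : topologicalType).
Implicit Types f g h : X -> Y.

Lemma homot_sym f g : homot f g -> homot g f.
Proof.
case=> H cH [H0 H1]; exists (fun xu => H (xu.1, 1 - xu.2)).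
  apply: (continuous_compT (f := fun xu : X * R => (xu.1, 1 - xu.2))) => //.
  apply: continuous_pair => xu; first exact: cvg_fst.
  by apply: cvgB; [exact: cvg_cst|exact: cvg_snd].
by split=> x u hu /=; [apply: H1|apply: H0]; lra.
Qed.

Lemma homot_trans g f h : homot f g -> homot g h -> homot f h.
Proof.
case=> H cH [H0 H1] [K cK [K0 K1]].
exists (fun xu => if xu.2 <= 2^-1 then H (xu.1, 2 * xu.2)
                  else K (xu.1, 2 * xu.2 - 1)).
  have c2 : continuous (fun xu : X * R => (xu.1, 2 * xu.2)).
    apply: continuous_pair => xu; first exact: cvg_fst.
    by apply: cvgM; [exact: cvg_cst|exact: cvg_snd].
  have c3 : continuous (fun xu : X * R => (xu.1, 2 * xu.2 - 1)).
    apply: continuous_pair => xu; first exact: cvg_fst.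
    apply: cvgB; last exact: cvg_cst.
    by apply: cvgM; [exact: cvg_cst|exact: cvg_snd].
  have c4 : continuous (snd : X * R -> R) by move=> xu; exact: cvg_snd.
  apply: (@continuous_paste _ _ bool
    (fun b => if b then [set xu : X * R | xu.2 <= 2^-1]
                   else [set xu : X * R | 2^-1 <= xu.2]) _
    (fun b xu => if b then H (xu.1, 2 * xu.2) else K (xu.1, 2 * xu.2 - 1))).
  - by case; apply: closed_le_fun => // ?; exact: cvg_cst.
  - case=> xu; first by apply: (continuous_comp (g := H)); [apply: c2|apply: cH].
    by apply: (continuous_comp (g := K)); [apply: c3|apply: cK].
  - by move=> xu; case: (leP xu.2 2^-1) => hu; [exists true|exists false; apply: ltW].
  - case=> -[x u] /=; first by move=> ->.
    by case: ifP => // u1 u2; rewrite H1 ?K0 //; lra.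
split=> x u hu /=.
  by rewrite ifT ?H0 //; lra.
by rewrite ifF ?K1 //; lra.
Qed.

End Homot.

Section Homot2.
Variable R : realType.

Lemma homot_comp (X Y Z W : topologicalType) (f g : Y -> Z) (k : Z -> W)
    (j : X -> Y) : continuous k -> continuous j ->
  homot R f g -> homot R (k \o f \o j) (k \o g \o j).
Proof.
move=> ck cj [H cH [H0 H1]]; exists (fun xu => k (H (j xu.1, xu.2))).
  apply: (continuous_compT (f := fun xu : X * R => H (j xu.1, xu.2))) => //.
  apply: (continuous_compT (f := fun xu : X * R => (j xu.1, xu.2))) => //.
  by apply: continuous_pair; [exact: continuous_fst_comp|exact: continuous_sndT].
by split=> x u hu /=; [rewrite H0|rewrite H1].
Qed.

Lemma homotopy_equivalenceP (X Y : topologicalType) (f : X -> Y) :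
  homotopy_equivalence R f <->
  continuous f /\ exists g : Y -> X,
    [/\ continuous g, homot R (g \o f) id & homot R (f \o g) id].
Proof.
by split=> -[cf [g [cg h1 h2]]]; split=> //; exists g; split=> //; apply/homotopicP.
Qed.

Lemma homotopy_equivalence_comp (X Y Z : topologicalType) (f : X -> Y)
    (g : Y -> Z) : homotopy_equivalence R f -> homotopy_equivalence R g ->
  homotopy_equivalence R (g \o f).
Proof.
move=> /homotopy_equivalenceP[cf [f' [cf' f1 f2]]].
move=> /homotopy_equivalenceP[cg [g' [cg' g1 g2]]]; apply/homotopy_equivalenceP.
split; first by move=> x; apply: continuous_comp; [apply: cf|apply: cg].
exists (f' \o g'); split.
- by move=> x; apply: continuous_comp; [apply: cg'|apply: cf'].
- exact: homot_trans (homot_comp cf' cf g1) f1.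
- exact: homot_trans (homot_comp cg cg' f2) g2.
Qed.

(** With [f'] inverse to [f] and [h] to [g f], the inverse of [g] is [f h]: the composite [f h g] is
    homotopic to [f h g f f'], hence to [f f'], hence to the identity. *)
Lemma homotopy_equivalence_cancel (X Y Z : topologicalType) (f : X -> Y)
    (g : Y -> Z) : continuous g -> homotopy_equivalence R f ->
  homotopy_equivalence R (g \o f) -> homotopy_equivalence R g.
Proof.
move=> cg /homotopy_equivalenceP[cf [f' [cf' f1 f2]]].
move=> /homotopy_equivalenceP[cgf [h [ch h1 h2]]]; apply/homotopy_equivalenceP.
split=> //; exists (f \o h); split=> //.
  by move=> x; apply: continuous_comp; [apply: ch|apply: cf].
have cfhg : continuous (f \o h \o g).
  move=> x; apply: continuous_comp; first exact: cg.
  by apply: continuous_comp; [apply: ch|apply: cf].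
apply: (homot_trans (homot_trans _ (homot_comp cf cf' h1)) f2).
have := homot_comp cfhg (@continuous_idT Y) f2.
exact: homot_sym.
Qed.

Definition contractible (K : topologicalType) :=
  exists b : K, homot R (@id K) (cst b).

End Homot2.

(** * Realizations of simplicial sets *)

Section Realization.
Variable R : realType.
Local Open Scope quotient_scope.

Definition bcoord n (t : simplex R n) (i : 'I_n.+1) : R := \val t ord0 i.

Lemma bcoord_ge0 n (t : simplex R n) i : 0 <= bcoord t i.
Proof. by have [t0 _] := set_mem (valP t); apply: t0. Qed.

Lemma bcoord_sum n (t : simplex R n) : \sum_i bcoord t i = 1.
Proof. by have [_ t1] := set_mem (valP t); apply: t1. Qed.

Lemma simplex_ext n (s t : simplex R n) : bcoord s =1 bcoord t -> s = t.
Proof.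
by move=> st; apply: val_inj; apply/rowP => i; apply: st.
Qed.

Lemma simplexP n (w : 'I_n.+1 -> R) :
  (forall i, 0 <= w i) -> \sum_i w i = 1 -> (\row_i w i) \in @simplex_set R n.
Proof.
move=> w0 w1; apply/mem_set; split=> [i|]; first by rewrite mxE.
by under eq_bigr do rewrite mxE.
Qed.

Definition mk_simplex n (w : 'I_n.+1 -> R) (w0 : forall i, 0 <= w i)
  (w1 : \sum_i w i = 1) : simplex R n := exist _ (\row_i w i) (simplexP w0 w1).

Lemma bcoord_mk n (w : 'I_n.+1 -> R) w0 w1 i : bcoord (@mk_simplex n w w0 w1) i = w i.
Proof. by rewrite /bcoord /= mxE. Qed.

Lemma bcoord_push m n (th : 'I_m.+1 -> 'I_n.+1) (t : simplex R m) j :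
  bcoord (push th t) j = \sum_(i | th i == j) bcoord t i.
Proof. by rewrite /bcoord /= mxE. Qed.

Lemma push_comp m n k (th : 'I_n.+1 -> 'I_k.+1) (ph : 'I_m.+1 -> 'I_n.+1)
  (t : simplex R m) : push (th \o ph) t = push th (push ph t).
Proof.
apply: simplex_ext => j; rewrite !bcoord_push.
rewrite (partition_big ph (fun i => th i == j)) //=.
apply: eq_bigr => i /eqP <-; rewrite bcoord_push; apply: eq_bigl => l.
by apply: andb_idl => /eqP ->.
Qed.

Lemma push_fix n (th : 'I_n.+1 -> 'I_n.+1) (t : simplex R n) :
  (forall i, bcoord t i != 0 -> th i = i) -> push th t = t.
Proof.
move=> fx; apply: simplex_ext => j; rewrite bcoord_push.
have [tj0|tj] := eqVneq (bcoord t j) 0.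
  rewrite tj0; apply: big1 => i /eqP ij; apply/eqP/negPn/negP => ti.
  by move: (ti); rewrite -(fx _ ti) ij tj0 eqxx.
rewrite (bigD1 j) /= ?fx // big1 ?addr0 // => i /andP[/eqP ij nij].
by apply/eqP/negPn/negP => ti; move: nij; rewrite -ij (fx _ ti) eqxx.
Qed.

Lemma push_id n (t : simplex R n) : push id t = t.
Proof. exact: push_fix. Qed.

Lemma bcoord_continuous n (i : 'I_n.+1) : continuous (fun t : simplex R n => bcoord t i).
Proof.
apply: (@continuous_compT _ _ _ (fun t : simplex R n => \val t)
  (fun v : 'rV[R]_n.+1 => v ord0 i)).
  exact: initial_continuous.
exact: coord_continuous.
Qed.

Lemma simplex_continuous (T : topologicalType) n (f : T -> simplex R n) :
  (forall i, continuous (fun x => bcoord (f x) i)) -> continuous f.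
Proof.
move=> cf; apply: continuous_comp_initial => x A [P /= nP sP].
have nQ (i : 'I_n.+1) : nbhs x [set y | P ord0 i (bcoord (f y) i)].
  exact: cf (nP _ _).
have : \forall y \near x, forall i : 'I_n.+1, P ord0 i (bcoord (f y) i).
  exact: filter_forall.
by apply: (@filterS _ (nbhs x)) => y /= Hy; apply: sP => i j; rewrite ord1; apply: Hy.
Qed.

Lemma push_continuous m n (th : 'I_m.+1 -> 'I_n.+1) : continuous (@push R m n th).
Proof.
apply: simplex_continuous => j.
rewrite (_ : (fun x => _) = fun t : simplex R m => \sum_(i | th i == j) bcoord t i).
  by apply: (continuous_big (@add_continuous R)) => i _; apply: bcoord_continuous.
by apply/funext => t; rewrite bcoord_push.
Qed.

Definition rpt (X : sset) n (x : X n) (t : simplex R n) : realization R X :=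
  \pi_(realization R X) (cell_pt x t).

Lemma rpt_face (X : sset) m n (th : 'I_m.+1 -> 'I_n.+1) (tm : monotone th)
  (x : X n) (t : simplex R m) : rpt (face tm x) t = rpt x (push th t).
Proof. by apply/realization_eqP/rst_step/Glue. Qed.

Lemma rpt_surj (X : sset) (z : realization R X) : exists n (x : X n) t, z = rpt x t.
Proof.
rewrite -[z]reprK; case: (generic_quotient.repr z) => -[n x] t.
by exists n, x, t.
Qed.

Lemma rpt_continuous (X : sset) n (x : X n) : continuous (@rpt X n x).
Proof.
apply: (@continuous_compT _ _ _ (fun t => cell_pt x t) (\pi_(realization R X))).
  by move=> t A.
exact: pi_continuous.
Qed.

Lemma realization_mapE (X Y : sset) (f : smap X Y) n (x : X n) t :
  realization_map f (rpt x t) = rpt (f n x) t.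
Proof. by rewrite /rpt Defs.realization_mapE. Qed.

Lemma realization_continuous (X : sset) (Z : topologicalType)
    (f : realization R X -> Z) :
  (forall n (x : X n), continuous (fun t => f (rpt x t))) -> continuous f.
Proof.
move=> cf; apply/quotient_continuous.
rewrite (_ : f \o _ = sigT_fun (fun (c : cells X) t => f (rpt (projT2 c) t))).
  by apply: sigT_continuous => -[n x]; apply: cf.
by apply/funext => -[[n x] t].
Qed.

Lemma realization_rec (X : sset) (Z : Type) (f : forall n, X n -> simplex R n -> Z) :
  (forall m n th (tm : monotone th) (x : X n) (t : simplex R m),
     f m (face tm x) t = f n x (push th t)) ->
  exists G : realization R X -> Z, forall n x t, G (rpt x t) = f n x t.
Proof.
move=> ff; pose g (a : cell_sum R X) := f _ (projT2 (projT1 a)) (projT2 a).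
exists (fun z => g (generic_quotient.repr z)) => n x t.
rewrite -[RHS]/(g (cell_pt x t)).
have : clos_refl_sym_trans _ (@Defs.glue R X)
    (generic_quotient.repr (rpt x t)) (cell_pt x t).
  by apply/realization_eqP; rewrite reprK.
elim=> [_ _ [? ? ? ? ? ?]|//|//|? ? ? _ -> _ ->//].
exact: ff.
Qed.

(** The product of a quotient map with [R] must again be a quotient map, which holds because [R] is
    locally compact: the homotopy is curried into the compact-open topology, where continuity is
    checked cell by cell, and then uncurried. *)
Lemma realization_recH (X : sset) (Z : topologicalType)
    (f : forall n, X n -> simplex R n * R -> Z) :
  (forall n (x : X n), continuous (f n x)) ->
  (forall m n th (tm : monotone th) (x : X n) (t : simplex R m) u,
     f m (face tm x) (t, u) = f n x (push th t, u)) ->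
  exists2 G : realization R X * R -> Z, continuous G &
    forall n x t u, G (rpt x t, u) = f n x (t, u).
Proof.
move=> cf ff.
have [] := @realization_rec X (R -> Z) (fun n x t u => f n x (t, u)).
  by move=> *; apply/funext => u; apply: ff.
move=> G GE; exists (fun zu => G zu.1 zu.2); last first.
  by move=> n x t u /=; rewrite GE.
pose G' : realization R X -> {compact-open, R -> Z} := G.
have -> : (fun zu => G zu.1 zu.2) = uncurry G' by apply/funext => -[].
apply: continuous_uncurry_regular.
- exact: locally_compactR.
- exact: separation_axioms.uniform_regular.
- apply: (@realization_continuous X {compact-open, R -> Z} G') => n x.
  have -> : (fun t => G' (rpt x t)) = curry (f n x).
    by apply/funext => t; apply/funext => u; rewrite /G' GE.
  exact: continuous_curry_fun (cf n x).
- move=> z; have [n [x [t ->]]] := rpt_surj z.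
  rewrite /G' GE; apply: (@continuous_compT _ _ _ (fun u : R => (t, u)) (f n x)).
  by apply: continuous_pair; [exact: cst_continuous|exact: continuous_idT].
exact: cf.
Qed.

End Realization.

(** * Extension from the boundary of a simplex *)

Section Extension.
Variable R : realType.

(* Follow f along the retraction r for 1/2 <= lam, then contract. *)
Lemma extend_contractible (Z K : topologicalType) (lam : Z -> R) (r : Z -> Z)
    (J : finType) (A : J -> set Z) (f : J -> Z -> K) :
  contractible R K -> continuous lam -> continuous r ->
  (forall j, closed (A j)) -> (forall j, continuous (f j)) ->
  (forall j k z, A j z -> A k z -> f j z = f k z) ->
  (forall z, 2^-1 <= lam z -> exists j, A j (r z)) ->
  (forall j z, A j z -> lam z = 1 /\ r z = z) ->
  exists2 g : Z -> K, continuous g & forall j z, A j z -> g z = f j z.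
Proof.
move=> [b [H cH [H0 H1]]] clam cr cA cf ff cov fixA.
pose g z := if lam z <= 2^-1 then b else
  if pselect (exists j, A j (r z)) is left e
  then H (f (projT1 (cid e)) (r z), 2 * (1 - lam z)) else b.
have gE j z : 2^-1 <= lam z -> A j (r z) -> g z = H (f j (r z), 2 * (1 - lam z)).
  rewrite /g => lz Az; case: ifPn => [lz'|_].
    by rewrite H1 //; lra.
  case: pselect => [e|]; last by case; exists j.
  by congr (H (_, _)); apply: ff => //; apply: (projT2 (cid e)).
exists g.
  apply: (@continuous_paste _ _ (option J)
    (fun o => if o is Some j then [set z | 2^-1 <= lam z] `&` r @^-1` A j
              else [set z | lam z <= 2^-1]) _
    (fun o => if o is Some j then fun z => H (f j (r z), 2 * (1 - lam z))
              else cst b)).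
  - case=> [j|].
      apply: closedI; first by apply: closed_le_fun => //; exact: continuous_cstT.
      by apply: preimage_closed => // z _; apply: cr.
    by apply: closed_le_fun => //; exact: continuous_cstT.
  - case=> [j|]; last exact: continuous_cstT.
    apply: (continuous_compT (f := fun z => (f j (r z), 2 * (1 - lam z)))) => //.
    apply: continuous_pair; first exact: continuous_compT.
    apply: continuousMT; first exact: continuous_cstT.
    by apply: continuousBT => //; exact: continuous_cstT.
  - move=> z; case: (leP (lam z) 2^-1) => lz; first by exists None.
    by have [j Aj] := cov z (ltW lz); exists (Some j); split=> //; apply: ltW.
  - case=> [j|] z /=; first by case; apply: gE.
    by rewrite /g => ->.
move=> j z Az; have [l1 rz] := fixA j z Az.
by rewrite (@gE j) ?rz ?l1 //; [rewrite H0 //; lra|lra].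
Qed.

Section Body.
Variables (n : nat) (fl : bool).

Let c : R := n.+1%:R^-1.
Let n1 : (n.+1%:R : R) != 0. Proof. by rewrite pnatr_eq0. Qed.
Let cE : n.+1%:R * c = 1. Proof. by rewrite /c mulfV. Qed.
Let c0 : 0 < c. Proof. by rewrite invr_gt0 ltr0n. Qed.

(* [minc] vanishes exactly on the boundary of the simplex, and [ends] at the ends
   of [0, 1]; [fl] tells whether these ends belong to the boundary. *)
Definition minc (t : simplex R n) : R :=
  \big[Num.min/1]_(i < n.+1) (n.+1%:R * bcoord t i).

Lemma min_continuousR : continuous (fun x : R * R => Num.min x.1 x.2).
Proof. by apply: continuous_minT; [exact: continuous_fstT|exact: continuous_sndT]. Qed.

Lemma minc_continuous : continuous minc.
Proof.
apply: (continuous_big min_continuousR) => i _.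
by apply: continuousMT; [exact: continuous_cstT|exact: bcoord_continuous].
Qed.

Lemma minc_le t i : minc t <= n.+1%:R * bcoord t i.
Proof. by rewrite /minc; apply: bigmin_le_cond. Qed.

Lemma minc_ge0 t : 0 <= minc t.
Proof.
rewrite /minc; elim/big_ind: _ => // [x y x0 y0|i _].
  by rewrite le_min x0.
by rewrite mulr_ge0 ?ler0n ?bcoord_ge0.
Qed.

Lemma minc_att t : minc t = 1 \/ exists i, minc t = n.+1%:R * bcoord t i.
Proof.
rewrite /minc; elim/big_ind: _; first by left.
  by move=> x y Hx Hy; rewrite minElt; case: ifP.
by move=> i _; right; exists i.
Qed.

Definition ends (u : R) : R :=
  if fl then Num.max 0 (Num.min (2 * u) (2 * (1 - u))) else 1.

Lemma ends_continuous : continuous ends.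
Proof.
rewrite /ends; case: fl; last exact: continuous_cstT.
apply: continuous_maxT; first exact: continuous_cstT.
apply: continuous_minT; apply: continuousMT; try exact: continuous_cstT.
  exact: continuous_idT.
by apply: continuousBT; [exact: continuous_cstT|exact: continuous_idT].
Qed.

Let mm (z : simplex R n * R) : R := Num.min (minc z.1) (ends z.2).

(** The radial coordinate about the centre (barycentre, 1/2): on the ray from the centre to a
    boundary point it grows linearly from 0 to 1. *)
Definition body_lam (z : simplex R n * R) : R := 1 - mm z.

Let mmc : continuous mm.
Proof.
apply: continuous_minT; first exact: continuous_fst_comp minc_continuous.
exact: continuous_snd_comp ends_continuous.
Qed.

Lemma body_lam_continuous : continuous body_lam.
Proof. by apply: continuousBT; [exact: continuous_cstT|exact: mmc]. Qed.

(** Cutting the radial coordinate off at 1/2 keeps the division in [body_r] harmless near the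
    centre, where [extend_contractible] is constant and does not consult the retraction. *)
Let l (z : simplex R n * R) : R := Num.max (body_lam z) 2^-1.

Let lc : continuous l.
Proof.
by apply: continuous_maxT; [exact: body_lam_continuous|exact: continuous_cstT].
Qed.

Let l0 z : 0 < l z.
Proof. by rewrite /l lt_max; apply/orP; right; lra. Qed.

Let lge z : body_lam z <= l z.
Proof. by rewrite /l le_max lexx. Qed.

Let w (z : simplex R n * R) (i : 'I_n.+1) : R := c + (bcoord z.1 i - c) / l z.

Let w0 z i : 0 <= w z i.
Proof.
have lz := l0 z; have e : c + (bcoord z.1 i - c) / l z = (c * l z + bcoord z.1 i - c) / l z.
  by field; apply: lt0r_neq0.
rewrite /w e; apply: divr_ge0; last exact: ltW.
have h1 := lge z; rewrite /body_lam in h1.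
have h2 : mm z <= n.+1%:R * bcoord z.1 i.
  by apply: le_trans (minc_le _ _); rewrite /mm ge_min lexx.
have h3 : c * mm z <= bcoord z.1 i.
  by rewrite -[leRHS]mul1r -cE [n.+1%:R * c]mulrC -mulrA ler_pM2l.
have h4 : c * (1 - mm z) <= c * l z by rewrite ler_pM2l.
by lra.
Qed.

Let w1 z : \sum_i w z i = 1.
Proof.
rewrite /w big_split /= -mulr_suml sumrB bcoord_sum sumr_const card_ord -mulr_natl cE.
by rewrite subrr mul0r addr0.
Qed.

Definition body_r (z : simplex R n * R) : simplex R n * R :=
  (mk_simplex (w0 z) (w1 z), 2^-1 + (z.2 - 2^-1) / l z).

Lemma body_r_continuous : continuous body_r.
Proof.
have ilc : continuous (fun z => (l z)^-1).
  by apply: continuousVT lc => z; apply: lt0r_neq0.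
apply: continuous_pair.
  apply: simplex_continuous => i.
  rewrite (_ : (fun x => _) = w^~ i); last by apply/funext => z; rewrite bcoord_mk.
  apply: continuousDT; first exact: continuous_cstT.
  apply: continuousMT ilc; apply: continuousBT; last exact: continuous_cstT.
  exact: continuous_fst_comp (@bcoord_continuous _ _ i).
apply: continuousDT; first exact: continuous_cstT.
apply: continuousMT ilc.
by apply: continuousBT; [exact: continuous_sndT|exact: continuous_cstT].
Qed.

(** The ends are half-lines rather than points, in accordance with homotopies that are stationary
    outside [0, 1]. *)
Definition bdry (j : 'I_n.+1 + bool) : set (simplex R n * R) :=
  match j with
  | inl i => [set z | bcoord z.1 i = 0]
  | inr true => [set z | fl /\ z.2 <= 0]
  | inr false => [set z | fl /\ 1 <= z.2]
  end.

Lemma bdry_closed j : closed (bdry j).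
Proof.
case: j => [i|[]] /=.
- apply: closed_eq_fun; last exact: continuous_cstT.
  exact: continuous_fst_comp (@bcoord_continuous _ _ i).
- case: fl; last first.
    by rewrite (_ : [set z | _] = set0); [exact: closed0|apply/seteqP; split=> z []].
  rewrite (_ : [set z | _] = [set z : simplex R n * R | z.2 <= 0]); last first.
    by apply/seteqP; split=> z /=; [case|split].
  by apply: closed_le_fun; [exact: continuous_sndT|exact: continuous_cstT].
- case: fl; last first.
    by rewrite (_ : [set z | _] = set0); [exact: closed0|apply/seteqP; split=> z []].
  rewrite (_ : [set z | _] = [set z : simplex R n * R | 1 <= z.2]); last first.
    by apply/seteqP; split=> z /=; [case|split].
  by apply: closed_le_fun; [exact: continuous_cstT|exact: continuous_sndT].
Qed.

Let ends_ge0 u : 0 <= ends u.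
Proof. by rewrite /ends; case: fl => //; rewrite le_max lexx. Qed.

Lemma bdry_fix j z : bdry j z -> body_lam z = 1 /\ body_r z = z.
Proof.
move=> bz; have m0 : mm z = 0.
  apply: le_anti; rewrite le_min minc_ge0 ends_ge0 ge_min !andbT.
  case: j bz => [i|[]] /=.
  - by move=> zi; rewrite (le_trans (minc_le _ i)) // zi mulr0.
  - case=> f z0; apply/orP; right; rewrite /ends f ge_max lexx ge_min /=.
    by apply/orP; left; lra.
  - case=> f z0; apply/orP; right; rewrite /ends f ge_max lexx ge_min /=.
    by apply/orP; right; lra.
have lam1 : body_lam z = 1 by rewrite /body_lam m0 subr0.
split=> //; have l1 : l z = 1.
  by rewrite /l lam1 max_l //; lra.
case: z m0 lam1 l1 bz => t u m0 lam1 l1 bz; congr pair; last by rewrite /= l1 divr1; ring.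
by apply: simplex_ext => i; rewrite bcoord_mk /w l1 divr1 /=; ring.
Qed.

Lemma bdry_cover z : 2^-1 <= body_lam z -> exists j, bdry j (body_r z).
Proof.
move=> lz; have lE : l z = body_lam z by rewrite /l max_l.
have m2 : mm z <= 2^-1 by move: lz; rewrite /body_lam; lra.
have [h|h] : mm z = minc z.1 \/ mm z = ends z.2.
  by rewrite /mm minElt; case: ifP; [left|right].
  have [h1|[i hi]] := minc_att z.1; first by move: m2; rewrite h h1; lra.
  exists (inl i) => /=; rewrite bcoord_mk /w lE /body_lam h hi.
  have cz : bcoord z.1 i = c * minc z.1 by rewrite hi mulrA [c * _]mulrC cE mul1r.
  rewrite cz mulrA cE mul1r; have : 1 - minc z.1 != 0.
    by apply: lt0r_neq0; move: m2; rewrite h; lra.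
  by move=> n0; field.
move: (h); rewrite /ends; case f: fl; last by move=> h1; move: m2; rewrite h1; lra.
case: (leP (2 * z.2) (2 * (1 - z.2))) => cmp.
  case: (leP 0 (2 * z.2)) => z0 hm.
    exists (inr true); split=> //=; rewrite lE /body_lam hm.
    have : 1 - 2 * z.2 != 0 by apply: lt0r_neq0; move: m2; rewrite hm; lra.
    by move=> n0; rewrite le_eqVlt; apply/orP; left; apply/eqP; field.
  exists (inr true); split=> //=; rewrite lE /body_lam hm subr0 divr1; lra.
case: (leP 0 (2 * (1 - z.2))) => z0 hm.
  exists (inr false); split=> //=; rewrite lE /body_lam hm.
  have : 1 - 2 * (1 - z.2) != 0 by apply: lt0r_neq0; move: m2; rewrite hm; lra.
  by move=> n0; rewrite le_eqVlt; apply/orP; left; apply/eqP; field.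
exists (inr false); split=> //=; rewrite lE /body_lam hm subr0 divr1; lra.
Qed.

Lemma extend_boundary (K : topologicalType) (f : 'I_n.+1 + bool -> simplex R n * R -> K) :
  contractible R K -> (forall j, continuous (f j)) ->
  (forall j k z, bdry j z -> bdry k z -> f j z = f k z) ->
  exists2 g : simplex R n * R -> K, continuous g &
    forall j z, bdry j z -> g z = f j z.
Proof.
move=> cK cf ff; apply: (extend_contractible cK body_lam_continuous
  body_r_continuous bdry_closed cf ff); first exact: bdry_cover.
exact: bdry_fix.
Qed.

End Body.
End Extension.

Local Open Scope nat_scope.

(** * Nondegenerate simplices *)

Lemma monotone_lift n (j : 'I_n.+2) : monotone (lift j).
Proof. by move=> a b ab; rewrite /= leq_bump2. Qed.

(** A degeneracy for every face index, such that [lift j \o squeeze j] fixes all vertices except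
    [j]. The second disjunct serves [j = n.+1], where the last vertex is merged with its
    predecessor. *)
Definition squeeze n (j : 'I_n.+2) (i : 'I_n.+2) : 'I_n.+1 :=
  inord (if (j < i) || (i == n.+1 :> nat) then i.-1 else i).

Arguments squeeze : simpl never.

Lemma squeezeE n (j i : 'I_n.+2) :
  squeeze j i = (if (j < i) || (i == n.+1 :> nat) then i.-1 else i) :> nat.
Proof. by rewrite inordK //; have := ltn_ord i; case: ifP; lia. Qed.

Lemma monotone_squeeze n (j : 'I_n.+2) : monotone (squeeze j).
Proof.
move=> a b ab; rewrite !squeezeE; have := ltn_ord a; have := ltn_ord b.
by case: ifP; case: ifP; lia.
Qed.

Lemma lift_squeeze n (j i : 'I_n.+2) : i != j -> lift j (squeeze j i) = i.
Proof.
rewrite -val_eqE /= => ij; apply: ord_inj; rewrite /= /bump squeezeE.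
by have := ltn_ord i; have := ltn_ord j; case: ifP; lia.
Qed.

Lemma squeeze_onto n (j : 'I_n.+2) k : exists i, squeeze j i = k.
Proof.
exists (lift j k); apply: ord_inj; rewrite squeezeE /= /bump.
by have := ltn_ord k; have := ltn_ord j; case: (leqP j k); case: ifP; lia.
Qed.

(** Equality of the values at [j] and at a neighbour, in the form that makes [th] factor through
    [squeeze j]. *)
Definition stutters n m (th : 'I_n.+2 -> 'I_m.+1) :=
  exists j : 'I_n.+2, forall i, th (lift j (squeeze j i)) = th i.

Lemma stutters_or n m (th : 'I_n.+2 -> 'I_m.+1) : monotone th ->
  ~ stutters th -> forall i : nat, (i < n.+1)%N -> th (inord i) < th (inord i.+1).
Proof.
move=> mth ns i ilt; rewrite ltn_neqAle mth ?andbT; last first.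
  by rewrite !inordK //; lia.
apply/negP => /eqP/ord_inj e; apply: ns; exists (inord i) => k.
have [->|] := eqVneq k (inord i); last by move=> ki; rewrite lift_squeeze.
rewrite e; congr th; apply: ord_inj; rewrite /= /bump squeezeE !inordK; [|lia..].
by rewrite ltnn /=; case: ifP; lia.
Qed.

Lemma stutters_lt n m (th : 'I_n.+2 -> 'I_m.+1) : monotone th -> m < n.+1 ->
  stutters th.
Proof.
move=> mth mn; apply: contrapT => /(stutters_or mth) inc.
have h : forall i, i < n.+2 -> i <= th (inord i).
  by elim=> // i IH ilt; apply: leq_ltn_trans (IH _) (inc _ _); lia.
by have := h n.+1 (ltnSn _); have := ltn_ord (th (inord n.+1)); lia.
Qed.

(** Without repetition [th] is strictly increasing, and counting up from 0 and down from [n.+1]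
    gives [i <= th i <= i]. *)
Lemma stutters_endo n (th : 'I_n.+2 -> 'I_n.+2) : monotone th ->
  stutters th \/ th =1 id.
Proof.
move=> mth; case: (pselect (stutters th)) => ns; [by left|right].
have inc := stutters_or mth ns.
have h : forall i, i < n.+2 -> i <= th (inord i).
  by elim=> // i IH ilt; apply: leq_ltn_trans (IH _) (inc _ _); lia.
have h' : forall k, k < n.+2 -> th (inord (n.+1 - k)) <= n.+1 - k.
  elim=> [_|k IH klt]; first by have := ltn_ord (th (inord (n.+1 - 0))); lia.
  have : th (inord (n.+1 - k.+1)) < th (inord (n.+1 - k.+1).+1) by apply: inc; lia.
  rewrite (_ : (n.+1 - k.+1).+1 = n.+1 - k); last lia.
  by have := IH ltac:(lia); lia.
move=> i; apply/ord_inj/eqP; rewrite eqn_leq.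
have := h i (ltn_ord i); have := h' (n.+1 - i) ltac:(lia).
rewrite (_ : n.+1 - (n.+1 - i) = i); last by have := ltn_ord i; lia.
by rewrite inord_val => -> ->.
Qed.

Lemma stutters_noninj n m (th : 'I_n.+2 -> 'I_m.+1) : stutters th ->
  ~ injective th.
Proof.
case=> j h /(_ _ _ (h j)) /eqP; rewrite -val_eqE /= /bump.
by rewrite eq_sym; case: leqP; lia.
Qed.

(* A monotone retraction onto the set I of vertices. *)
Lemma support_retract n (I : pred 'I_n.+1) (l : 'I_n.+1) : I l ->
  exists r : 'I_n.+1 -> 'I_n.+1,
    [/\ monotone r, forall i, I (r i) & forall i, I i -> r i = i].
Proof.
move=> Il.
pose lo (i : 'I_n.+1) := [arg min_(a < l | I a && (i <= a)) (a : nat)].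
pose hi (i : 'I_n.+1) := [arg max_(a > l | I a && (a <= i)) (a : nat)].
have loP (i : 'I_n.+1) : i <= l -> [/\ I (lo i), i <= lo i <= l & forall a : 'I_n.+1, I a -> i <= a -> lo i <= a].
  move=> il; rewrite /lo; case: arg_minnP; first by rewrite Il.
  move=> a /andP[Ia ia] am; split=> //; first by rewrite ia am ?Il.
  by move=> b Ib ib; apply: am; rewrite Ib.
have hiP (i : 'I_n.+1) : l <= i -> [/\ I (hi i), l <= hi i <= i & forall a : 'I_n.+1, I a -> a <= i -> a <= hi i].
  move=> il; rewrite /hi; case: arg_maxnP; first by rewrite Il.
  move=> a /andP[Ia ia] am; split=> //.
    by rewrite ia andbT; apply: (am l); rewrite Il.
  by move=> b Ib ib; apply: am; rewrite Ib.
exists (fun i : 'I_n.+1 => if i <= l then lo i else hi i); split.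
- move=> a b ab; case: (leqP a l) => al; case: (leqP b l) => bl; [| | lia|].
  + have [Ib b1 _] := loP b bl; have [_ _ am] := loP a al.
    by apply: am => //; lia.
  + by have [_ ? _] := loP a al; have [_ ? _] := hiP b (ltnW bl); lia.
  + have [Ia a1 _] := hiP a (ltnW al); have [_ _ bm] := hiP b (ltnW bl).
    by apply: bm => //; lia.
- by move=> i; case: leqP => il; [have [] := loP i il|have [] := hiP i (ltnW il)].
- move=> i Ii; apply: ord_inj; case: leqP => il.
    by have [_ ? h] := loP i il; have := h i Ii (leqnn _); lia.
  by have [_ ? h] := hiP i (ltnW il); have := h i Ii (leqnn _); lia.
Qed.

Definition ord_onto n m (th : 'I_n.+1 -> 'I_m.+1) := forall j, exists i, th i = j.

Lemma ord_onto0 n m (th : 'I_n.+1 -> 'I_m.+1) : monotone th -> ord_onto th ->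
  th ord0 = ord0.
Proof.
move=> mth /(_ ord0)[i i0]; apply/ord_inj/eqP; rewrite -leqn0 /=.
by have := mth ord0 i (leq0n _); rewrite i0.
Qed.

(** Prescribing one point of the section is what lets [rigid_uniq] compare two degeneracies vertex
    by vertex. *)
Lemma ord_onto_section n m (th : 'I_n.+1 -> 'I_m.+1) i0 : monotone th -> ord_onto th ->
  exists mu : 'I_m.+1 -> 'I_n.+1,
    [/\ monotone mu, cancel mu th & mu (th i0) = i0].
Proof.
move=> mth sth.
pose mu j := if j == th i0 then i0 else projT1 (cid (sth j)).
have muK : cancel mu th.
  by move=> j; rewrite /mu; case: eqP => [->//|_]; exact: (projT2 (cid (sth j))).
exists mu; split=> //; last by rewrite /mu eqxx.
move=> a b ab; case: (leqP (mu a) (mu b)) => // ba.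
have := mth (mu b) (mu a) (ltnW ba); rewrite !muK => ba'.
have : a = b by apply/ord_inj/eqP; rewrite eqn_leq ab ba'.
by move=> e; rewrite e ltnn in ba.
Qed.

Section EilenbergZilber.
Variable X : sset.

Lemma face_irr m n (th ph : 'I_m.+1 -> 'I_n.+1) (tm : monotone th)
  (pm : monotone ph) (x : X n) : th =1 ph -> face tm x = face pm x.
Proof.
move=> /funext e; case: _ / e pm => pm.
by congr face; apply: Prop_irrelevance.
Qed.

Lemma face_idE n (th : 'I_n.+1 -> 'I_n.+1) (tm : monotone th) (x : X n) :
  th =1 id -> face tm x = x.
Proof. by move=> e; rewrite (face_irr tm (@monotone_id n) x e) face_id. Qed.

(* Nondegeneracy, phrased so that it needs no choice of degeneracies. *)
Definition rigid n (x : X n) := forall th (tm : monotone th),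
  face tm x = x -> th =1 id.

Lemma face_stutter n m (th : 'I_n.+2 -> 'I_m.+1) (tm : monotone th) (j : 'I_n.+2)
    (pm : monotone (th \o lift j)) (x : X m) :
  (forall i, th (lift j (squeeze j i)) = th i) ->
  face (@monotone_squeeze n j) (face pm x) = face tm x.
Proof. by move=> h; rewrite -face_comp; apply: face_irr => i; exact: h. Qed.

(** The existence half of the Eilenberg-Zilber lemma: a simplex that is not rigid is fixed by a
    self-map other than the identity, which repeats a vertex, so the simplex is a degeneracy of one
    of its own faces. *)
Lemma rigid_rep n (x : X n) : exists m (y : X m) th (tm : monotone th),
  [/\ m <= n, rigid y, ord_onto th & face tm y = x].
Proof.
have id_rep n' (z : X n') : rigid z -> exists m (y : X m) th (tm : monotone th),
    [/\ m <= n', rigid y, ord_onto th & face tm y = z].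
  move=> rz; exists n', z, id, (@monotone_id n'); split=> //; last exact: face_id.
  by move=> j; exists j.
elim: n x => [|n IH] x.
  by apply: id_rep => th tm _ i; rewrite !ord1.
case: (pselect (rigid x)) => [/id_rep//|nr].
have [th [tm [xth nth]]] : exists th (tm : monotone th), face tm x = x /\ ~ (th =1 id).
  apply: contrapT => h; apply: nr => th tm xth; apply: contrapT => nth.
  by apply: h; exists th, tm.
have [[j jth]|//] := stutters_endo tm.
pose pm := monotone_comp tm (@monotone_lift n j).
have xE : face (@monotone_squeeze n j) (face pm x) = x.
  by rewrite (face_stutter tm) // xth.
have [m [y [ph [phm [mn ry sph yE]]]]] := IH (face pm x).
exists m, y, (ph \o squeeze j), (monotone_comp phm (@monotone_squeeze n j)).
split=> //; first exact: leqW.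
  move=> k; have [i ik] := sph k; have [i' ii] := squeeze_onto j i.
  by exists i'; rewrite /= ii.
by rewrite face_comp yE.
Qed.

(** The uniqueness half. Sections [mu] of [th] and [nu] of [th'] turn [y] and [y'] into faces of
    each other; rigidity makes [th' \o mu] and [th \o nu] mutually inverse, so the dimensions agree
    and both maps are identities. With [mu] chosen through [i], this gives [th i = th' i]. *)
Lemma rigid_uniq n m m' (y : X m) (y' : X m') (th : 'I_n.+1 -> 'I_m.+1)
    (th' : 'I_n.+1 -> 'I_m'.+1) (tm : monotone th) (tm' : monotone th') :
  rigid y -> rigid y' -> ord_onto th -> ord_onto th' -> face tm y = face tm' y' ->
  exists e : m = m', eq_rect m X y m' e = y' /\
    forall i, th i = th' i :> nat.
Proof.
move=> ry ry' sth sth' E.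
have bij i0 : exists2 mu : 'I_m.+1 -> 'I_n.+1, monotone mu /\ cancel mu th &
  mu (th i0) = i0 /\ exists2 nu : 'I_m'.+1 -> 'I_n.+1, monotone nu /\ cancel nu th' &
    (th \o nu) \o (th' \o mu) =1 id /\ (th' \o mu) \o (th \o nu) =1 id.
  have [mu [mm muK mi]] := ord_onto_section i0 tm sth.
  have [nu [nm nuK _]] := ord_onto_section ord0 tm' sth'.
  exists mu => //; split=> //; exists nu => //.
  have yE : face (monotone_comp tm' mm) y' = y.
    by rewrite face_comp -E -face_comp; apply: face_idE => i /=; exact: muK.
  have yE' : face (monotone_comp tm nm) y = y'.
    by rewrite face_comp E -face_comp; apply: face_idE => i /=; exact: nuK.
  split.
    apply: (ry _ (monotone_comp (monotone_comp tm nm) (monotone_comp tm' mm))).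
    by rewrite face_comp yE' yE.
  apply: (ry' _ (monotone_comp (monotone_comp tm' mm) (monotone_comp tm nm))).
  by rewrite face_comp yE yE'.
have e : m = m'.
  have [mu _ [_ [nu _ [h1 h2]]]] := bij ord0.
  have := leq_card _ (@can_inj _ _ (th' \o mu) (th \o nu) h1).
  have := leq_card _ (@can_inj _ _ (th \o nu) (th' \o mu) h2).
  by rewrite !card_ord => a b; apply/eqP; rewrite -eqSS eqn_leq a b.
exists e; case: _ / e y' th' tm' ry' sth' E bij => y' th' tm' ry' sth' E bij.
have key i0 : exists2 mu : 'I_m.+1 -> 'I_n.+1, monotone mu /\ cancel mu th &
    mu (th i0) = i0 /\ th' \o mu =1 id.
  have [mu [mm muK] [mi [nu _ [h1 h2]]]] := bij i0.
  exists mu => //; split=> //.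
  case: m y y' th th' tm tm' ry ry' sth sth' E mu mm muK mi nu h1 h2 {bij} =>
    [|m] y y' th th' tm tm' ry ry' sth sth' E mu mm muK mi nu h1 h2.
    by move=> i; rewrite !ord1.
  have [st|//] := stutters_endo (monotone_comp tm' mm).
  by case: (stutters_noninj st (@can_inj _ _ (th' \o mu) (th \o nu) h1)).
split=> /= [|i].
  have [mu [mm muK] [_ h]] := key ord0.
  rewrite -(face_idE (monotone_comp tm mm) y muK) face_comp E -face_comp.
  exact: face_idE.
have [mu _ [mi h]] := key i.
by rewrite -[in RHS]mi; congr nat_of_ord; rewrite -[LHS]h.
Qed.

End EilenbergZilber.

(** * Families of maps into contractible carriers *)

Section Vertices.
Variables (Ob : Type) (C : category Ob).

Definition vx n (x : nerve C n) (i : 'I_n.+1) : Ob := projT1 x i.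

Definition edge n (x : nerve C n) (i j : 'I_n.+1) (ij : i <= j) :
  Mor C (vx x i) (vx x j) := fmap (projT2 x) (ij : Mor (ordcat n) i j).

Definition edge0 n (x : nerve C n) (i : 'I_n.+1) : Mor C (vx x ord0) (vx x i) :=
  @edge n x ord0 i (leq0n i).

Lemma edge_id n (x : nerve C n) (i : 'I_n.+1) (ii : i <= i) : edge x ii = idm C (vx x i).
Proof.
rewrite -(fmap_id (projT2 x)); congr (fmap (projT2 x)); exact: bool_irrelevance.
Qed.

Lemma edge_comp n (x : nerve C n) (i j k : 'I_n.+1) (ij : i <= j) (jk : j <= k) (ik : i <= k) :
  comp (edge x jk) (edge x ij) = edge x ik.
Proof.
rewrite /edge -(fmap_comp (projT2 x)); congr (fmap (projT2 x)); exact: bool_irrelevance.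
Qed.

End Vertices.

Section Carrier.
Variables (R : realType) (Ob : Type) (C : category Ob).
Variable K : Ob -> topologicalType.
Variable kf : forall X Y, Mor C X Y -> K Y -> K X.
Hypothesis kf_cont : forall X Y (u : Mor C X Y), continuous (kf u).
Hypothesis kf_id : forall X k, kf (idm C X) k = k.
Hypothesis kf_comp : forall X Y Z (v : Mor C Y Z) (u : Mor C X Y) k,
  kf (comp v u) k = kf u (kf v k).
Hypothesis K_contr : forall X, contractible R (K X).

Definition family := forall n (x : nerve C n), simplex R n * R -> K (vx x ord0).

(* A simplex is carried by its initial vertex, which the face th moves to
   th ord0. *)
Definition compatible (g : family) m n :=
  forall th (tm : monotone th) (x : nerve C n) (t : simplex R m) u,
    kf (edge0 x (th ord0)) (g m (face tm x) (t, u)) = g n x (push th t, u).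

(** Equal simplices have initial vertices that are only provably equal, so values must be
    transported between the corresponding spaces. *)
Let castO X Y (e : X = Y) (k : K X) : K Y := eq_rect X K k Y e.

Let castO_id X (e : X = X) k : castO e k = k.
Proof. by rewrite (Prop_irrelevance e erefl). Qed.

Let cast_fam (g : family) n (a b : nerve C n) (E : a = b)
    (e : vx a ord0 = vx b ord0) z : castO e (g n a z) = g n b z.
Proof. by case: _ / E e => e; rewrite castO_id. Qed.

Let cast_vx n (x : nerve C n) a b (ab : a = b) (e : vx x a = vx x b) k :
  kf (edge0 x b) (castO e k) = kf (edge0 x a) k.
Proof. by case: _ / ab e => e; rewrite castO_id. Qed.

Let kf_edge0 m n (x : nerve C n) (th : 'I_m.+1 -> 'I_n.+1) (tm : monotone th) i k :
  kf (edge0 x (th ord0)) (kf (edge0 (face tm x) i) k) = kf (edge0 x (th i)) k.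
Proof.
rewrite -kf_comp; congr (kf _ k).
exact: (@edge_comp _ _ _ x ord0 (th ord0) (th i) (leq0n (th ord0)) (tm ord0 i (leq0n i)) (leq0n (th i))).
Qed.

Let fam_face_comp (g : family) m n k (th : 'I_n.+1 -> 'I_k.+1)
    (ph : 'I_m.+1 -> 'I_n.+1) (tm : monotone th) (pm : monotone ph)
    (qm : monotone (th \o ph)) (x : nerve C k) z :
  g m (face pm (face tm x)) z = g m (face qm x) z.
Proof.
have E : face pm (face tm x) = face qm x.
  by rewrite -face_comp; apply: face_irr.
exact: (cast_fam g E erefl).
Qed.

Section Step.
Variables (fl : bool) (p : bool -> family).
Hypothesis p_cont : fl -> forall b n x, continuous (@p b n x).
Hypothesis p_comp : fl -> forall b m n, compatible (@p b) m n.

Definition good_upto N (g : family) :=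
  [/\ forall n (x : nerve C n), n < N -> continuous (@g n x),
      forall m n, m < N -> n < N -> compatible g m n
    & fl -> forall n (x : nerve C n) t u, n < N ->
      (u <= 0 -> g n x (t, u) = p true x (t, u))%R /\
      (1 <= u -> g n x (t, u) = p false x (t, u))%R].

Variables (N : nat) (g : family).
Hypothesis gN : good_upto N g.

Let kf_edge0_inj n (w : nerve C n) i : i = ord0 -> injective (kf (edge0 w i)).
Proof.
move=> i0 a b /(congr1 (kf (edge w (eq_leq (congr1 val i0))))).
by rewrite -!kf_comp /edge0 !(edge_comp _ _ _ (leqnn i)) edge_id !kf_id.
Qed.

(** The only possible value on the degenerate simplex [face sm w]: compatibility forces it once the
    value on [w] is known. *)
Let back m n (w : nerve C m) (s : 'I_n.+1 -> 'I_m.+1) (sm : monotone s)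
    (s0 : s ord0 = ord0) (z : simplex R n * R) : K (vx (face sm w) ord0) :=
  kf (edge w (eq_leq (congr1 val s0))) (g w (push s z.1, z.2)).

Let back_edge0 m n (w : nerve C m) (s : 'I_n.+1 -> 'I_m.+1) (sm : monotone s)
    (s0 : s ord0 = ord0) z :
  kf (edge0 w (s ord0)) (back w sm s0 z) = g w (push s z.1, z.2).
Proof.
by rewrite /back -kf_comp /edge0 (edge_comp _ _ _ (leqnn ord0)) edge_id kf_id.
Qed.

Let cast_edge0 n (a b : nerve C n) (E : a = b) i
    (e : vx a i = vx b i) (e' : vx a ord0 = vx b ord0) q :
  kf (edge0 b i) (castO e q) = castO e' (kf (edge0 a i) q).
Proof. by case: _ / E e e' => e e'; rewrite !castO_id. Qed.

Let gcomp m n : m < N -> n < N -> compatible g m n.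
Proof. by case: gN => _ h _; exact: h. Qed.

Let back_face m k n (w : nerve C k) (s : 'I_n.+1 -> 'I_k.+1) (sm : monotone s)
    (s0 : s ord0 = ord0) (th : 'I_m.+1 -> 'I_n.+1) (tm : monotone th)
    (t : simplex R m) u : m < N -> k < N ->
  kf (edge0 (face sm w) (th ord0)) (g (face tm (face sm w)) (t, u)) =
  back w sm s0 (push th t, u).
Proof.
move=> mN kN; apply: (kf_edge0_inj s0); rewrite back_edge0 kf_edge0 /=.
rewrite (fam_face_comp g sm tm (monotone_comp sm tm)).
by rewrite -push_comp; apply: (gcomp mN kN).
Qed.

(** Since [m < N], [th] repeats a vertex and factors through some [squeeze j]. The rigid
    representative of the resulting face of [y] also represents [face sm w], so by uniqueness it is
    [w], and compatibility below [N] does the rest. *)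
Let deg_value N' k (w : nerve C k) (s : 'I_N'.+2 -> 'I_k.+1) (sm : monotone s)
    (s0 : s ord0 = ord0) : N = N'.+1 -> rigid w -> ord_onto s -> k < N ->
  forall m (y : nerve C m) (th : 'I_N'.+2 -> 'I_m.+1) (tm : monotone th)
    (E : face sm w = face tm y) (e : vx w (s ord0) = vx y (th ord0)) z, m < N ->
  kf (edge0 y (th ord0)) (castO e (back w sm s0 z)) = g y (push th z.1, z.2).
Proof.
move=> NE rw ss kN m y th tm E e z mN.
have [j jth] : stutters th by apply: stutters_lt => //; rewrite -NE.
pose pm := monotone_comp tm (@monotone_lift N' j).
pose sq := @monotone_squeeze N' j.
have [k' [w' [s' [sm' [_ rw' ss' E']]]]] := rigid_rep (face pm y).
have Ec : face (monotone_comp sm' sq) w' = face sm w.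
  by rewrite face_comp E' (face_stutter tm) // E.
have ssc : ord_onto (s' \o squeeze j).
  move=> i; have [i1 <-] := ss' i; have [i2 <-] := squeeze_onto j i1.
  by exists i2.
have [ke [wE sE]] := rigid_uniq rw' rw ssc ss Ec.
case: _ / ke w rw s sm s0 ss kN E e Ec wE sE => w rw s sm s0 ss kN E e Ec wE sE.
rewrite /= in wE; case: _ / wE rw E e Ec => rw E e Ec.
have {}sE : s = s' \o squeeze j by apply/funext => i; apply: ord_inj; rewrite sE.
rewrite {}sE in sm s0 ss E e Ec *.
have s'0 := ord_onto0 sm' ss'.
have qE : kf (edge0 (face sm' w') (squeeze j ord0)) (back w' sm s0 z) =
          g (face sm' w') (push (squeeze j) z.1, z.2).
  apply: (kf_edge0_inj s'0); rewrite kf_edge0 (back_edge0 w' sm s0).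
  by rewrite (gcomp _ kN) -?push_comp // NE.
have vE i : vx w' (s' i) = vx y (th (lift j i)).
  exact: (congr1 (fun x : nerve C N' => vx x i) E').
have -> : kf (edge0 y (th ord0)) (castO e (back w' sm s0 z)) =
    kf (edge0 y (th (lift j (squeeze j ord0)))) (castO (vE (squeeze j ord0)) (back w' sm s0 z)).
  move: (vE (squeeze j ord0)); rewrite (jth ord0) => e1.
  by rewrite (Prop_irrelevance e1 e).
rewrite -(@kf_edge0 _ _ y _ pm) (cast_edge0 E' (vE _) (vE ord0)) qE (cast_fam g E').
by rewrite (gcomp _ mN) -?push_comp ?NE //=; congr (g _ (_, _)); congr push; apply/funext => i; apply: jth.
Qed.

Let support_ex n (t : simplex R n) : exists l, bcoord t l != 0%R.
Proof.
apply: contrapT => h; have := bcoord_sum t; rewrite big1 => [/esym/eqP|i _].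
  by rewrite oner_eq0.
by apply/eqP/negPn/negP => ti; apply: h; exists i.
Qed.

Section BoundaryValue.
Variables (N' : nat) (NE : N = N'.+1) (x : nerve C N'.+1).

Let bval m (th : 'I_m.+1 -> 'I_N'.+2) (tm : monotone th) (z : simplex R m * R) :
  K (vx x ord0) := kf (edge0 x (th ord0)) (g (face tm x) z).

Let bval_push m k (th : 'I_m.+1 -> 'I_N'.+2) (tm : monotone th)
    (be : 'I_k.+1 -> 'I_m.+1) (bm : monotone be) s u :
  m < N -> k < N ->
  bval tm (push be s, u) = bval (monotone_comp tm bm) (s, u).
Proof.
move=> mN kN; rewrite /bval -(gcomp kN mN bm) kf_edge0.
by rewrite (fam_face_comp g tm bm (monotone_comp tm bm)).
Qed.

Let bval_irr m (th th' : 'I_m.+1 -> 'I_N'.+2) (tm : monotone th)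
    (tm' : monotone th') z : th =1 th' -> bval tm z = bval tm' z.
Proof.
move=> /funext e; case: _ / e tm' => tm'.
by rewrite (Prop_irrelevance tm tm').
Qed.

(* The prescribed value at a boundary point does not depend on the chosen face
   containing it: retract onto the support first. *)
Let bval_uniq (j : 'I_N'.+2) m (th : 'I_m.+1 -> 'I_N'.+2) (tm : monotone th)
    (s : simplex R m) u : m < N -> bcoord (push th s) j = 0%R ->
  bval tm (s, u) =
  bval (@monotone_lift N' j) (push (squeeze j) (push th s), u).
Proof.
move=> mN tj; have [l sl] := support_ex s.
have [be [bm beI beF]] := @support_retract _ (fun i => bcoord s i != 0%R) l sl.
have sE : push be s = s by apply: push_fix => i; exact: beF.
have thj i : th (be i) != j.
  apply/eqP => e; move: tj; rewrite bcoord_push => /psumr_eq0P h.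
  have := beI i; rewrite h ?eqxx //; last exact/eqP.
  by move=> k _; exact: bcoord_ge0.
rewrite -{1}sE bval_push // -{2}sE -!push_comp.
rewrite (bval_push _ (monotone_comp (monotone_comp (@monotone_squeeze N' j) tm) bm)) ?NE //.
  by apply: bval_irr => i /=; rewrite lift_squeeze.
by rewrite -NE.
Qed.

Let face_value (j : 'I_N'.+2) (z : simplex R N'.+1 * R) : K (vx x ord0) :=
  bval (@monotone_lift N' j) (push (squeeze j) z.1, z.2).

Let face_value_spec j z : bcoord z.1 j = 0%R ->
  exists2 s, push (lift j) s = z.1 & face_value j z = bval (@monotone_lift N' j) (s, z.2).
Proof.
move=> zj; exists (push (squeeze j) z.1) => //; rewrite -push_comp.
apply: push_fix => i zi /=; apply: lift_squeeze.
by apply: contraNneq zi => ->; rewrite zj.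
Qed.

Let face_value_cont j : continuous (face_value j).
Proof.
have cg : continuous (@g _ (face (@monotone_lift N' j) x)).
  by case: gN => h _ _; apply: h; rewrite NE.
apply: (continuous_compT (f := fun z : simplex R N'.+1 * R =>
  g (face (@monotone_lift N' j) x) (push (squeeze j) z.1, z.2))); last exact: kf_cont.
apply: (continuous_compT (f := fun z : simplex R N'.+1 * R => (push (squeeze j) z.1, z.2))) => //.
apply: continuous_pair; last exact: continuous_sndT.
exact: continuous_fst_comp (@push_continuous _ _ _ _).
Qed.

Lemma extend_over_simplex : exists h : simplex R N'.+1 * R -> K (vx x ord0),
  [/\ continuous h,
      forall m th (tm : monotone th) (t : simplex R m) u, m < N'.+1 ->
        kf (edge0 x (th ord0)) (g (face tm x) (t, u)) = h (push th t, u)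
    & fl -> forall t u, (u <= 0 -> h (t, u) = p true x (t, u))%R /\
                        (1 <= u -> h (t, u) = p false x (t, u))%R].
Proof.
have [b0 _] := K_contr (vx x ord0).
pose f (j : 'I_N'.+2 + bool) := match j with
  | inl j => face_value j
  | inr b => if fl then p b x else cst b0 end.
have fp (j : 'I_N'.+2) (b : bool) z : bdry fl (inl j) z ->
    bdry fl (inr b) z -> face_value j z = p b x z.
  case: z => t u /= tj bz.
  have [s sE ->] := face_value_spec (z := (t, u)) tj; rewrite /= in sE; rewrite -sE.
  have f1 : fl by case: b bz => -[].
  rewrite -(p_comp f1 b (@monotone_lift N' j)) /bval /=; congr (kf _ _).
  have [_ _ /(_ f1 _ (face (@monotone_lift N' j) x) s u)] := gN.
  rewrite NE ltnS leqnn => /(_ isT)[h0 h1].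
  by case: b bz => -[_]; [exact: h0|exact: h1].
have [||h ch hE] := @extend_boundary R N'.+1 fl (K (vx x ord0)) f (K_contr _).
- case=> [j|b] /=; first exact: face_value_cont.
  by case f1: fl; [exact: p_cont|exact: continuous_cstT].
- move=> j k z; case: j k => [j|b] [k|b'].
  + move=> jz kz; rewrite /f; case: z jz kz => t u jz kz.
    have [s sE ->] := face_value_spec (z := (t, u)) jz.
    rewrite /= in sE kz; rewrite -sE in kz.
    by rewrite (@bval_uniq k _ _ _ s u _ kz) ?NE //= /face_value /= sE.
  + by move=> jz bz; rewrite /f (fp _ _ _ jz bz); case: fl bz => //; case: b' => -[].
  + by move=> bz jz; rewrite /f (fp _ _ _ jz bz); case: fl bz => //; case: b => -[].
  + by case: b b' => -[] //= [? h1] [? h2]; [have := le_trans h2 h1|have := le_trans h1 h2]; rewrite ler10.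
exists h; split=> //.
- move=> m th tm t u mN.
  (* A map from fewer vertices misses some [j], so its image lies in the facet opposite to [j]. *)
  have [j jth] : exists j, forall i, th i != j.
    apply: contrapT => no; have : #|'I_N'.+2| <= #|'I_m.+1|.
      have on : ord_onto th.
        move=> j; apply: contrapT => nj; apply: no; exists j => i.
        by apply/eqP => e; apply: nj; exists i.
      have [mu [_ muK _]] := ord_onto_section ord0 tm on.
      exact: leq_card (can_inj muK).
    by rewrite !card_ord; lia.
  have zj : bcoord (push th t) j = 0%R.
    by rewrite bcoord_push big1 // => i /eqP ij; move: (jth i); rewrite ij eqxx.
  rewrite (hE (inl j) (push th t, u) zj) /f /face_value /=.
  by rewrite -(bval_uniq tm) // NE.
- move=> f1 t u; split=> hu.
    by rewrite (hE (inr true)) /f ?f1.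
  by rewrite (hE (inr false)) /f ?f1.
Qed.

End BoundaryValue.

(** A degenerate simplex takes the value forced by its rigid representative; a rigid one takes an
    extension of its boundary values into the contractible carrier, and then the third condition is
    void. *)
Lemma extend_simplex n (x : nerve C n) : n = N ->
  exists h : simplex R n * R -> K (vx x ord0),
  [/\ continuous h,
      forall m th (tm : monotone th) (t : simplex R m) u, m < n ->
        kf (edge0 x (th ord0)) (g (face tm x) (t, u)) = h (push th t, u),
      forall m (y : nerve C m) th (tm : monotone th) (E : x = face tm y)
        (e : vx x ord0 = vx y (th ord0)) t u, m < n ->
        kf (edge0 y (th ord0)) (castO e (h (t, u))) = g y (push th t, u)
    & fl -> forall t u, (u <= 0 -> h (t, u) = p true x (t, u))%R /\
                        (1 <= u -> h (t, u) = p false x (t, u))%R].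
Proof.
move=> nN; have [k [w [s [sm [kn rw ss wE]]]]] := rigid_rep x.
have s0 := ord_onto0 sm ss.
case: (ltnP k n) => [{}kn|nk].
  have kN : k < N by rewrite -nN.
  have N0 : 0 < n by apply: leq_ltn_trans kn.
  case: n nN x s sm ss wE s0 kn N0 => // n nN x s sm ss wE s0 kn _.
  case: _ / wE; exists (back w sm s0); split.
  - rewrite /back; apply: (continuous_compT (f := fun z : simplex R n.+1 * R => g w (push s z.1, z.2)));
      last exact: kf_cont.
    apply: (continuous_compT (f := fun z : simplex R n.+1 * R => (push s z.1, z.2))).
      apply: continuous_pair; last exact: continuous_sndT.
      exact: continuous_fst_comp (@push_continuous _ _ _ _).
    by case: gN => h _ _; apply: h.
  - by move=> m th tm t u mn; apply: back_face => //; rewrite -nN.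
  - by move=> m y th tm E e t u mn; rewrite (deg_value s0 (esym nN) rw ss kN E) // -nN.
  - move=> f1 t u; have [_ _ /(_ f1 _ w (push s t) u kN)[h0 h1]] := gN.
    by split=> hu; apply: (kf_edge0_inj s0); rewrite back_edge0 (p_comp f1) /=; [exact: h0|exact: h1].
have {}kn : k = n by apply/eqP; rewrite eqn_leq kn.
case: _ / kn nN x nk s sm ss wE s0 => {n} nN x _ s sm ss wE s0.
have {wE} rx : rigid x.
  case: k nN w rw x s sm ss wE {s0} => [|k] nN w rw x s sm ss wE.
    by move=> ? ? ? ?; rewrite !ord1.
  have [mu [mm muK _]] := ord_onto_section ord0 sm ss.
  have [/stutters_noninj/(_ (can_inj muK))//|mid] := stutters_endo mm.
  by rewrite -wE (face_idE sm) // => i; rewrite -{1}[i]mid muK.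
have nodeg m (y : nerve C m) th (tm : monotone th) : m < k -> x = face tm y -> False.
  case: k nN w rw x s sm ss s0 rx th tm => // k nN w rw x s sm ss s0 rx th tm mk xE.
  have [j jth] := stutters_lt tm mk.
  have := rx _ (monotone_comp (@monotone_lift k j) (@monotone_squeeze k j)).
  rewrite face_comp {1}xE -[face _ (face tm y)]face_comp (face_stutter tm) // -xE.
  by move=> /(_ erefl j)/eqP; rewrite /= eq_sym (negPf (neq_lift _ _)).
(* In dimension 0 the facets are empty, because the only coordinate is 1; just the ends of the time
   interval constrain [h]. *)
case: k nN w rw x s sm ss s0 rx nodeg => [|k] nN w rw x s sm ss s0 rx nodeg.
  have [b0 _] := K_contr (vx x ord0).
  have [||h ch hE] := @extend_boundary R 0 fl (K (vx x ord0))
      (fun j => if j is inr b then if fl then p b x else cst b0 else cst b0) (K_contr _).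
  - case=> [j|b] /=; first exact: continuous_cstT.
    by case f1: fl; [exact: p_cont|exact: continuous_cstT].
  - have n0 j (z : simplex R 0 * R) : bdry fl (inl j) z -> False.
      move=> /= zj; have := bcoord_sum z.1; rewrite big_ord1 (_ : ord0 = j) ?zj.
        by move/esym/eqP; rewrite oner_eq0.
      by rewrite !ord1.
    case=> [j|b] [k|b'] z; [by move/n0|by move/n0|by move=> _ /n0|].
    by case: b b' => -[] //= [? h1] [? h2]; [have := le_trans h2 h1|have := le_trans h1 h2]; rewrite ler10.
  exists h; split=> // f1 t u; split=> hu.
    by rewrite (hE (inr true)) ?f1.
  by rewrite (hE (inr false)) ?f1.
have [h [ch hf hp]] := extend_over_simplex (esym nN) x.
exists h; split=> // m y th tm E e t u mk.
by case: (nodeg m y th tm mk E).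
Qed.

(** The extensions over different simplices of dimension [N] can be chosen independently, as each is
    compared only with [p] and with [g] in lower dimensions. *)
Lemma extend_good : exists g' : family,
  good_upto N.+1 g' /\ forall n (x : nerve C n), n < N -> g' n x = g x.
Proof.
have ex n (x : nerve C n) : exists h : simplex R n * R -> K (vx x ord0),
    (n < N -> h = g x) /\ (n = N -> [/\ continuous h,
      forall m th (tm : monotone th) (t : simplex R m) u, m < n ->
        kf (edge0 x (th ord0)) (g (face tm x) (t, u)) = h (push th t, u),
      forall m (y : nerve C m) th (tm : monotone th) (E : x = face tm y)
        (e : vx x ord0 = vx y (th ord0)) t u, m < n ->
        kf (edge0 y (th ord0)) (castO e (h (t, u))) = g y (push th t, u)
    & fl -> forall t u, (u <= 0 -> h (t, u) = p true x (t, u))%R /\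
                        (1 <= u -> h (t, u) = p false x (t, u))%R]).
  case: (eqVneq n N) => [nN|nN].
    have [h [h1 h2 h3 h4]] := extend_simplex x nN.
    by exists h; split=> // nlt; rewrite nN ltnn in nlt.
  by exists (g x); split=> // e; rewrite e eqxx in nN.
pose g' : family := fun n x => projT1 (cid (ex n x)).
have g'old n x : n < N -> g' n x = g x by case: (projT2 (cid (ex n x))).
have g'new n x (nN : n = N) := (projT2 (cid (ex n x))).2 nN.
have gN' := gN; case: gN' => gc gcp gp.
exists g'; split; last exact: g'old.
split.
- move=> n x; rewrite ltnS leq_eqVlt => /orP[/eqP nN|nN].
    by have [] := g'new n x nN.
  by rewrite g'old //; apply: gc.
- move=> m n; rewrite !ltnS leq_eqVlt => /orP[/eqP mN|mN];
    rewrite leq_eqVlt => /orP[/eqP nN|nN] th tm x t u; last first.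
  + by rewrite !g'old //; apply: gcp.
  + rewrite g'old //; have [_ hf _ _] := g'new n x nN.
    by apply: hf; rewrite nN.
  + have [_ _ hd _] := g'new m (face tm x) mN.
    rewrite [in RHS]g'old //.
    by rewrite -(hd n x th tm erefl erefl) ?mN //.
  + have mn : m = n by rewrite mN.
    case: n / mn nN th tm x t u => _ th tm x t u.
    case: m mN th tm x t u => [|n] mN th tm x t u.
      have the : th = id by apply/funext => i; rewrite [LHS]ord1 [RHS]ord1.
      rewrite the in tm *; rewrite push_id.
      have E : face tm x = x by exact: face_idE.
      rewrite -(@cast_fam g' _ _ _ E erefl) castO_id.
      by rewrite /edge0 edge_id kf_id.
    (* A self-map of the top dimension that repeats a vertex factors through dimension [n], where
       both sides reduce to the value of [g] on the face along [pm]. *)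
    have [[j jth]|/funext the] := stutters_endo tm; last first.
      rewrite the in tm *; rewrite push_id.
      have E : face tm x = x by exact: face_idE.
      rewrite -(@cast_fam g' _ _ _ E erefl) castO_id.
      by rewrite /edge0 edge_id kf_id.
    pose pm := monotone_comp tm (@monotone_lift n j).
    have E : face tm x = face (@monotone_squeeze n j) (face pm x).
      by rewrite (face_stutter tm).
    have e : vx x (th ord0) = vx x (th (lift j (squeeze j ord0))) by rewrite jth.
    have [_ _ hd _] := g'new _ (face tm x) mN.
    have {}hd := hd _ _ _ _ E e t u (ltnSn _).
    have [_ hf _ _] := g'new _ x mN.
    have {}hf := hf _ _ pm (push (squeeze j) t) u (ltnSn _).
    rewrite -push_comp in hf.
    have thE : (th \o lift j) \o squeeze j = th by apply/funext => i; exact: jth.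
    rewrite thE in hf.
    rewrite -[RHS]/(projT1 (cid (ex n.+1 x)) (push th t, u)) -hf -hd kf_edge0 /=.
    by rewrite (cast_vx (esym (jth ord0))).
- move=> f1 n x t u; rewrite ltnS leq_eqVlt => /orP[/eqP nN|nN].
    by have [_ _ _ hp] := g'new n x nN; exact: hp f1 t u.
  by rewrite g'old //; apply: gp.
Qed.

End Step.

(* With [fl], the family is moreover a homotopy between the two given ones. *)
Theorem carrier_family (fl : bool) (p : bool -> family) :
  (fl -> forall b n (x : nerve C n), continuous (@p b n x)) ->
  (fl -> forall b m n, compatible (@p b) m n) ->
  exists g : family,
    [/\ forall n (x : nerve C n), continuous (@g n x),
        forall m n, compatible g m n
      & fl -> forall n (x : nerve C n) t u,
        (u <= 0 -> g n x (t, u) = p true n x (t, u))%R /\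
        (1 <= u -> g n x (t, u) = p false n x (t, u))%R].
Proof.
move=> pc pcmp.
pose g0 : family := fun n x _ => projT1 (cid (K_contr (vx x ord0))).
have good0 : good_upto fl p 0 g0 by split.
have step N (g : {g | good_upto fl p N g}) : {g' | good_upto fl p N.+1 g' /\
    forall n (x : nerve C n), n < N -> g' n x = sval g n x}.
  by apply: cid; have [g' [h1 h2]] := extend_good pc pcmp (svalP g); exists g'.
pose fix G N : {g | good_upto fl p N g} := match N with
  | 0 => exist _ g0 good0
  | N.+1 => exist _ (sval (step N (G N))) (svalP (step N (G N))).1 end.
have GE N n x : n < N -> sval (G N) n x = sval (G n.+1) n x.
  elim: N => // N IH; rewrite ltnS leq_eqVlt => /orP[/eqP nN|nN].
    by case: N / nN IH.
  by rewrite -IH // [LHS](svalP (step N (G N))).2.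
(* Stage [n.+1] is the first to settle dimension [n], and later stages keep its values. *)
exists (fun n x => sval (G n.+1) n x); split.
- by move=> n x; have [h _ _] := svalP (G n.+1); apply: h.
- move=> m n th tm x t u; pose N := (m + n).+1.
  have [_ h _] := svalP (G N).
  rewrite -!(GE N) /N; [|lia..].
  by apply: h; rewrite /N; lia.
- by move=> f1 n x t u; have [_ _ h] := svalP (G n.+1); apply: h.
Qed.

End Carrier.

(** * Maps and homotopies obtained from carriers *)

Section CarrierMaps.
Variables (R : realType) (Ob : Type) (C : category Ob).
Variable K : Ob -> topologicalType.
Variable kf : forall X Y, Mor C X Y -> K Y -> K X.
Hypothesis kf_cont : forall X Y (u : Mor C X Y), continuous (kf u).
Hypothesis kf_id : forall X k, kf (idm C X) k = k.
Hypothesis kf_comp : forall X Y Z (v : Mor C Y Z) (u : Mor C X Y) k,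
  kf (comp v u) k = kf u (kf v k).
Hypothesis K_contr : forall X, contractible R (K X).

Definition carried (g : forall n (x : nerve C n), simplex R n -> K (vx x ord0)) :=
  (forall n (x : nerve C n), continuous (@g n x)) /\
  (forall m n th (tm : monotone th) (x : nerve C n) (t : simplex R m),
     kf (edge0 x (th ord0)) (g m (face tm x) t) = g n x (push th t)).

Lemma carried_exists : exists g, carried g.
Proof.
have [||g [gc gg _]] := @carrier_family R Ob C K kf kf_cont kf_id kf_comp K_contr
  false (fun _ n x _ => projT1 (cid (K_contr (vx x ord0)))) => //.
exists (fun n x t => g n x (t, 0%R)); split=> [n x|m n th tm x t]; last exact: gg.
apply: (continuous_compT (f := fun t : simplex R n => (t, 0%R : R))); last exact: gc.
by apply: continuous_pair; [exact: continuous_idT|exact: continuous_cstT].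
Qed.

Variables (Z : topologicalType) (q : forall X, K X -> Z).
Hypothesis q_cont : forall X, continuous (@q X).
Hypothesis q_nat : forall X Y (u : Mor C X Y) k, q (kf u k) = q k.

Lemma carried_map g : carried g -> exists2 f : nerve_realization R C -> Z,
  continuous f & forall n (x : nerve C n) t, f (rpt x t) = q (g n x t).
Proof.
move=> [gc gg]; have [] := @realization_rec R (nerve C) Z (fun n x t => q (g n x t)).
  by move=> m n th tm x t; rewrite -gg q_nat.
move=> f fE; exists f => //; apply: realization_continuous => n x.
rewrite (_ : (fun t => _) = fun t => q (g n x t)); last by apply/funext => t.
by apply: continuous_compT; [exact: gc|exact: q_cont].
Qed.

Lemma carried_homot g0 g1 (f0 f1 : nerve_realization R C -> Z) :
  carried g0 -> carried g1 ->
  (forall n (x : nerve C n) t, f0 (rpt x t) = q (g0 n x t)) ->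
  (forall n (x : nerve C n) t, f1 (rpt x t) = q (g1 n x t)) ->
  homot R f0 f1.
Proof.
move=> [c0 g0g] [c1 g1g] f0E f1E.
have [||g [gc gg gp]] := @carrier_family R Ob C K kf kf_cont kf_id kf_comp K_contr
  true (fun b n x z => if b then g0 n x z.1 else g1 n x z.1).
- by move=> _ [] n x; [exact: continuous_fst_comp (c0 n x)|exact: continuous_fst_comp (c1 n x)].
- by move=> _ [] m n th tm x t u /=; [apply: g0g|apply: g1g].
have [||H cH HE] := @realization_recH R (nerve C) Z (fun n x z => q (g n x z)).
- by move=> n x; apply: continuous_compT; [exact: gc|exact: q_cont].
- by move=> m n th tm x t u; rewrite -gg q_nat.
exists H => //; split=> z u hu; have [n [x [t ->]]] := rpt_surj z; rewrite HE.
  by have [h _] := gp isT n x t u; rewrite f0E h.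
by have [_ h] := gp isT n x t u; rewrite f1E h.
Qed.

End CarrierMaps.

Section NerveExt.
Variables (Ob : Type) (C : category Ob).

(** A morphism packed with its ends, so that the edges of two simplices can be compared before their
    vertices are known to agree. *)
Definition arrow (X Y : Ob) (f : Mor C X Y) : {XY : Ob * Ob & Mor C XY.1 XY.2} :=
  existT (fun XY : Ob * Ob => Mor C XY.1 XY.2) (X, Y) f.

Lemma existT_inj (A : Type) (P : A -> Type) (a : A) (x y : P a) :
  existT P a x = existT P a y -> x = y.
Proof.
move=> e; have := projT2_eq e.
by rewrite (Prop_irrelevance (projT1_eq e) erefl).
Qed.

Lemma nerve_ext n (a a' : nerve C n) :
  (forall (i j : 'I_n.+1) (ij : i <= j), arrow (edge a ij) = arrow (edge a' ij)) ->
  a = a'.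
Proof.
case: a a' => h F [h' F'] E.
have hh : h = h'.
  by apply/funext => i; have /(congr1 (fun f => (projT1 f).1)) := E i i (leqnn i).
case: _ / hh F' E => F' E; congr existT; apply: functor_eq => i j ij.
exact: existT_inj (E i j ij).
Qed.

End NerveExt.

(** * Contraction onto the apex of a cone *)

Section Cone.
Variables (R : realType) (Ob : Type) (B : category Ob) (b : Ob).
Variable c : forall X, Mor B b X.
Hypothesis c_nat : forall X Y (u : Mor B X Y), comp u (c X) = c Y.

Let le_opt n (o1 o2 : option 'I_n.+1) : bool :=
  match o1, o2 with
  | None, _ => true | Some _, None => false | Some i, Some j => i <= j end.

Let ob n (x : nerve B n) (o : option 'I_n.+1) : Ob := if o is Some i then vx x i else b.

Let mor n (x : nerve B n) (o1 o2 : option 'I_n.+1) :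
    le_opt o1 o2 -> Mor B (ob x o1) (ob x o2) :=
  match o1, o2 return le_opt o1 o2 -> Mor B (ob x o1) (ob x o2) with
  | None, None => fun _ => idm B b
  | None, Some j => fun _ => c (vx x j)
  | Some i, None => fun H => False_rect _ (Bool.diff_false_true H)
  | Some i, Some j => fun H => edge x H end.

Let mor_comp n (x : nerve B n) o1 o2 o3 (h12 : le_opt o1 o2) (h23 : le_opt o2 o3)
  (h13 : le_opt o1 o3) : comp (mor x h23) (mor x h12) = mor x h13.
Proof.
case: o1 h12 h13 => [i|]; case: o2 h23 => [j|]; case: o3 => [k|] //= h23 h12 h13.
- exact: edge_comp.
- by rewrite comp_idr.
- by rewrite comp_idl.
Qed.

Let mor_id n (x : nerve B n) o (h : le_opt o o) : mor x h = idm B (ob x o).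
Proof. by case: o h => //= i h; rewrite edge_id. Qed.

Let le_unlift n (i j : 'I_n.+2) : i <= j -> le_opt (unlift ord0 i) (unlift ord0 j).
Proof.
by case: (unliftP ord0 i) => [i'|] ->; case: (unliftP ord0 j) => [j'|] ->.
Qed.

Let arrow_mor n (x : nerve B n) o1 o2 o1' o2' (h : le_opt o1 o2) (h' : le_opt o1' o2') :
  o1 = o1' -> o2 = o2' -> arrow (mor x h) = arrow (mor x h').
Proof.
move=> e1 e2; case: _ / e1 h' => h'; case: _ / e2 h' => h'.
by rewrite (bool_irrelevance h h').
Qed.

Let cone n (x : nerve B n) : nerve B n.+1.
Proof.
exists (fun i => ob x (unlift ord0 i)).
refine (@Functor _ _ (ordcat n.+1) B _ (fun i j ij => mor x (le_unlift ij)) _ _).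
- by move=> i; rewrite mor_id.
- by move=> i j k g f; rewrite (mor_comp x _ _ (le_unlift (comp g f))).
Defined.

Let face_lift n (x : nerve B n) : face (@monotone_lift n ord0) (cone x) = x.
Proof.
apply: nerve_ext => i j ij.
by apply: (@arrow_mor _ x _ _ (Some i) (Some j) _ ij); rewrite liftK.
Qed.

Let shift m n (th : 'I_m.+1 -> 'I_n.+1) (i : 'I_m.+2) : 'I_n.+2 :=
  if unlift ord0 i is Some i' then lift ord0 (th i') else ord0.

Let shift_mono m n (th : 'I_m.+1 -> 'I_n.+1) : monotone th -> monotone (shift th).
Proof.
move=> tm i j; rewrite /shift.
case: (unliftP ord0 i) => [i'|] ->; case: (unliftP ord0 j) => [j'|] -> //=.
by rewrite !leq_bump2; apply: tm.
Qed.

Let unlift_shift m n (th : 'I_m.+1 -> 'I_n.+1) i :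
  unlift ord0 (shift th i) = omap th (unlift ord0 i).
Proof. by rewrite /shift; case: (unliftP ord0 i) => [i'|] _ /=; rewrite ?liftK ?unlift_none. Qed.

Let cone_face m n (th : 'I_m.+1 -> 'I_n.+1) (tm : monotone th) (x : nerve B n) :
  face (shift_mono tm) (cone x) = cone (face tm x).
Proof.
apply: nerve_ext => i j ij.
have h := le_unlift ij.
have h' : le_opt (omap th (unlift ord0 i)) (omap th (unlift ord0 j)).
  by move: h; case: (unlift ord0 i) => [i'|]; case: (unlift ord0 j) => [j'|] //=; apply: tm.
transitivity (arrow (mor x h')); first by apply: arrow_mor; exact: unlift_shift.
transitivity (arrow (mor (face tm x) h)); last by apply: arrow_mor.
move: h h'; case: (unlift ord0 i) => [i'|]; case: (unlift ord0 j) => [j'|] //= h h'.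
by congr arrow; congr (fmap (projT2 x)); apply: bool_irrelevance.
Qed.

Let apex : nerve B 0 := existT _ (fun _ => b)
  (@Functor _ _ (ordcat 0) B (fun _ => b) (fun _ _ _ => idm B b)
    (fun _ => erefl) (fun _ _ _ _ _ => esym (comp_idl _))).

Let mono0 n : monotone (fun _ : 'I_1 => ord0 : 'I_n.+1). Proof. by []. Qed.

Let cone_apex n (x : nerve B n) : face (@mono0 n.+1) (cone x) = apex.
Proof.
apply: nerve_ext => i j ij.
by apply: (@arrow_mor _ x _ _ None None _ isT); rewrite unlift_none.
Qed.

Local Open Scope ring_scope.

Let cl (u : R) : R := Num.max 0 (Num.min u 1).

Let cl01 u : 0 <= cl u <= 1.
Proof. by rewrite /cl le_max lexx /= ge_max ler01 ge_min lexx orbT. Qed.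

Let cl_cont : continuous cl.
Proof.
apply: continuous_maxT; first exact: continuous_cstT.
by apply: continuous_minT; [exact: continuous_idT|exact: continuous_cstT].
Qed.

Let wt n (t : simplex R n) (u : R) (i : 'I_n.+2) : R :=
  if unlift ord0 i is Some i' then (1 - cl u) * bcoord t i' else cl u.

Let wt0 n (t : simplex R n) u i : 0 <= wt t u i.
Proof.
have /andP[c0 c1] := cl01 u; rewrite /wt; case: unlift => // i'.
by apply: mulr_ge0; rewrite ?subr_ge0 ?bcoord_ge0.
Qed.

Let wt1 n (t : simplex R n) u : \sum_i wt t u i = 1.
Proof.
rewrite big_ord_recl /wt unlift_none.
under eq_bigr do rewrite liftK.
by rewrite -mulr_sumr bcoord_sum mulr1 addrC subrK.
Qed.

Let join n (t : simplex R n) u : simplex R n.+1 := mk_simplex (wt0 t u) (wt1 t u).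

Let join_push m n (th : 'I_m.+1 -> 'I_n.+1) (t : simplex R m) u :
  push (shift th) (join t u) = join (push th t) u.
Proof.
apply: simplex_ext => j; rewrite bcoord_push bcoord_mk.
under eq_bigr do rewrite bcoord_mk.
rewrite big_mkcond big_ord_recl /= /shift unlift_none.
under eq_bigr do rewrite liftK.
rewrite /wt unlift_none; case: (unliftP ord0 j) => [j'|] ->.
  rewrite add0r bcoord_push mulr_sumr [RHS]big_mkcond; apply: eq_bigr => i _.
  by rewrite liftK (inj_eq lift_inj).
by rewrite eqxx big1 ?addr0.
Qed.

Let pt0 : simplex R 0 := @mk_simplex R 0 (fun _ => 1) (fun _ => ler01) (big_ord1 _ _).

(** The component [c b] need not be the identity, so [b] need not be initial. A simplex [x] is
    contracted inside [cone x] by moving its weight to the apex. *)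
Lemma cone_contractible : contractible R (nerve_realization R B).
Proof.
exists (rpt apex pt0).
have [||H cH HE] := @realization_recH R (nerve B) (nerve_realization R B)
  (fun n x z => rpt (cone x) (join z.1 z.2)).
- move=> n x; apply: (continuous_compT (f := fun z : simplex R n * R => join z.1 z.2));
    last exact: rpt_continuous.
  apply: simplex_continuous => i.
  rewrite (_ : (fun z => _) = fun z => wt z.1 z.2 i); last by apply/funext => z; rewrite bcoord_mk.
  rewrite /wt; case: unlift => [i'|]; last exact: continuous_snd_comp.
  apply: continuousMT; last exact: continuous_fst_comp (@bcoord_continuous _ _ _).
  by apply: continuousBT; [exact: continuous_cstT|exact: continuous_snd_comp].
- by move=> m n th tm x t u /=; rewrite -cone_face rpt_face join_push.
exists H => //; split=> z u hu; have [n [x [t ->]]] := rpt_surj z; rewrite HE /=.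
  rewrite -[in RHS](face_lift x) rpt_face; congr rpt.
  have cl0 : cl u = 0 by rewrite /cl max_l // ge_min hu.
  apply: simplex_ext => j; rewrite bcoord_mk bcoord_push /wt cl0 subr0.
  case: (unliftP ord0 j) => [j'|] ->; last by rewrite big_pred0.
  by rewrite mul1r (big_pred1 j') // => i; rewrite (inj_eq lift_inj).
rewrite -(cone_apex x) rpt_face; congr rpt.
have cl1 : cl u = 1 by rewrite /cl min_r // max_r.
apply: simplex_ext => j; rewrite bcoord_mk bcoord_push /wt cl1 subrr big_mkcond big_ord1 bcoord_mk.
by case: (unliftP ord0 j) => [j'|] -> //=; rewrite mul0r.
Qed.

End Cone.

(** * Quillen's Theorem A *)

Lemma nerve_eq (Ob : Type) (C : category Ob) n (h : 'I_n.+1 -> Ob)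
    (F G : functor (ordcat n) C h) :
  (forall i j (f : Mor (ordcat n) i j), fmap F f = fmap G f) ->
  existT _ h F = existT _ h G :> nerve C n.
Proof. by move=> FG; rewrite (functor_eq FG). Qed.

Section Comma.
Variables (O1 O2 : Type) (C : category O1) (D : category O2) (h : O1 -> O2).
Variable F : functor C D h.

(** Primitive projections make [a] convertible to [CommaOb (carr a)], so that an arbitrary simplex
    of the comma category has the shape required by [comma_nerve_eq]. *)
#[projections(primitive)]
Record comma_ob (A : O2) := CommaOb { cob : O1; carr : Mor D A (h cob) }.

Definition comma_mor (A : O2) (a b : comma_ob A) :=
  {v : Mor C (cob a) (cob b) | comp (fmap F v) (carr a) = carr b}.

Definition comma_idm (A : O2) (a : comma_ob A) : comma_mor a a.
Proof. by exists (idm C (cob a)); rewrite fmap_id comp_idl. Defined.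

Definition comma_comp (A : O2) (a b c : comma_ob A) (v : comma_mor b c)
  (u : comma_mor a b) : comma_mor a c.
Proof.
by exists (comp (sval v) (sval u)); rewrite fmap_comp -comp_assoc (svalP u) (svalP v).
Defined.

Lemma comma_mor_eq (A : O2) (a b : comma_ob A) (u v : comma_mor a b) :
  sval u = sval v -> u = v.
Proof. by case: u v => u pu [v pv] /= uv; apply: eq_exist. Qed.

Definition comma (A : O2) : category (comma_ob A).
Proof.
refine (@Category (comma_ob A) (@comma_mor A) (@comma_idm A) (@comma_comp A) _ _ _).
- by move=> a b f; apply: comma_mor_eq; rewrite /= comp_idl.
- by move=> a b f; apply: comma_mor_eq; rewrite /= comp_idr.
- by move=> a b c d k g f; apply: comma_mor_eq; rewrite /= comp_assoc.
Defined.

Lemma comma_preP (A B : O2) (u : Mor D A B) (a b : comma_ob B) (v : comma_mor a b) :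
  comp (fmap F (sval v)) (comp (carr a) u) = comp (carr b) u.
Proof. by rewrite comp_assoc (svalP v). Qed.

Definition comma_pre (A B : O2) (u : Mor D A B) :
  functor (comma B) (comma A) (fun a => CommaOb (comp (carr a) u)).
Proof.
refine (@Functor _ _ (comma B) (comma A) (fun a => CommaOb (comp (carr a) u))
  (fun a b v => exist _ (sval v) (comma_preP u v)) _ _).
- by move=> a; apply: comma_mor_eq.
- by move=> a b c g f; apply: comma_mor_eq.
Defined.

Definition comma_forget (A : O2) : functor (comma A) C (@cob A).
Proof. by refine (@Functor _ _ (comma A) C (@cob A) (fun a b v => sval v) _ _). Defined.

Lemma comma_underP (A : O2) n (z : nerve C n) (m : Mor D A (h (vx z ord0)))
  (i j : 'I_n.+1) (ij : i <= j) :
  comp (fmap F (edge z ij)) (comp (fmap F (edge0 z i)) m) = comp (fmap F (edge0 z j)) m.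
Proof. by rewrite comp_assoc -fmap_comp (@edge_comp _ _ _ z ord0 i j (leq0n i) ij (leq0n j)). Qed.

Definition comma_under (A : O2) n (z : nerve C n) (m : Mor D A (h (vx z ord0))) :
  nerve (comma A) n.
Proof.
exists (fun i => CommaOb (comp (fmap F (edge0 z i)) m)).
refine (@Functor _ _ (ordcat n) (comma A)
  (fun i => CommaOb (comp (fmap F (edge0 z i)) m))
  (fun i j (ij : Mor (ordcat n) i j) => exist _ (edge z ij) (comma_underP m ij)) _ _).
- by move=> i; apply: comma_mor_eq; rewrite /= edge_id.
- move=> i j k jk ij; apply: comma_mor_eq; rewrite /=.
  by rewrite (edge_comp z ij jk (comp jk ij)).
Defined.

Lemma comma_nerve_eq (A : O2) n (Q : 'I_n.+1 -> O1) (m m' : forall i, Mor D A (h (Q i)))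
    (G : functor (ordcat n) (comma A) (fun i => CommaOb (m i)))
    (G' : functor (ordcat n) (comma A) (fun i => CommaOb (m' i))) :
  (forall i, m i = m' i) ->
  (forall i j (ij : Mor (ordcat n) i j), sval (fmap G ij) = sval (fmap G' ij)) ->
  existT _ _ G = existT _ _ G' :> nerve (comma A) n.
Proof.
move=> mm; have {}mm : m = m' by apply: functional_extensionality_dep.
case: _ / mm G' => G' GG; apply: nerve_eq => i j f.
by apply: comma_mor_eq; apply: GG.
Qed.

Lemma comma_pre_id A n (a : nerve (comma A) n) : nerve_map (comma_pre (idm D A)) _ a = a.
Proof.
case: a => k G; apply: (@comma_nerve_eq A n (fun i => cob (k i))
  (fun i => comp (carr (k i)) (idm D A)) (fun i => carr (k i)) _ G) => // i.
by rewrite comp_idr.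
Qed.

Lemma comma_pre_comp A B E (v : Mor D B E) (u : Mor D A B) n (a : nerve (comma E) n) :
  nerve_map (comma_pre (comp v u)) _ a =
  nerve_map (comma_pre u) _ (nerve_map (comma_pre v) _ a).
Proof.
by case: a => k G; apply: comma_nerve_eq => // i; rewrite comp_assoc.
Qed.

Lemma comma_forget_under A n (z : nerve C n) (m : Mor D A (h (vx z ord0))) :
  nerve_map (comma_forget A) _ (comma_under m) = z.
Proof. by case: z m => k G m; apply: nerve_eq. Qed.

End Comma.

Definition functor_id (Ob : Type) (C : category Ob) : functor C C id :=
  @Functor _ _ C C id (fun X Y f => f) (fun X => erefl) (fun X Y Z g f => erefl).

Section NerveRealization.
Variable R : realType.

Lemma nerve_realization_mapE (O1 O2 : Type) (C : category O1) (D : category O2)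
    (h : O1 -> O2) (F : functor C D h) n (x : nerve C n) (t : simplex R n) :
  nerve_realization_map R F (rpt x t) = rpt (nerve_map F _ x) t.
Proof. exact: realization_mapE. Qed.

Lemma nerve_realization_map_continuous (O1 O2 : Type) (C : category O1)
    (D : category O2) (h : O1 -> O2) (F : functor C D h) :
  continuous (nerve_realization_map R F).
Proof. exact: realization_map_continuous. Qed.

Lemma nerve_realization_map_comp (O1 O2 O3 : Type) (C : category O1)
    (D : category O2) (E : category O3) (h : O1 -> O2) (k : O2 -> O3)
    (F : functor C D h) (G : functor D E k) :
  nerve_realization_map R (functor_comp G F) =
  nerve_realization_map R G \o nerve_realization_map R F.
Proof.
apply/funext => z; have [n [x [t ->]]] := rpt_surj z.
by rewrite /= !nerve_realization_mapE; congr rpt; case: x => a b; apply: nerve_eq.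
Qed.

Lemma nerve_realization_map_id (Ob : Type) (C : category Ob) :
  nerve_realization_map R (functor_id C) = id.
Proof.
apply/funext => z; have [n [x [t ->]]] := rpt_surj z.
by rewrite nerve_realization_mapE; congr rpt; case: x => a b; apply: nerve_eq.
Qed.

Section CommaSpace.
Variables (O1 O2 : Type) (C : category O1) (D : category O2) (h : O1 -> O2).
Variable F : functor C D h.

Definition comma_space (X : O2) : topologicalType := nerve_realization R (comma F X).

Definition comma_restr X Y (u : Mor D X Y) : comma_space Y -> comma_space X :=
  nerve_realization_map R (comma_pre F u).

Lemma comma_restr_continuous X Y (u : Mor D X Y) : continuous (comma_restr u).
Proof. exact: nerve_realization_map_continuous. Qed.

Lemma comma_restrE X Y (u : Mor D X Y) n (a : nerve (comma F Y) n) (t : simplex R n) :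
  comma_restr u (rpt a t) = rpt (nerve_map (comma_pre F u) _ a) t.
Proof. exact: nerve_realization_mapE. Qed.

Lemma comma_restr_id X (k : comma_space X) : comma_restr (idm D X) k = k.
Proof.
have [n [a [t ->]]] := rpt_surj k.
by rewrite comma_restrE comma_pre_id.
Qed.

Lemma comma_restr_comp X Y Z (v : Mor D Y Z) (u : Mor D X Y) k :
  comma_restr (comp v u) k = comma_restr u (comma_restr v k).
Proof.
have [n [a [t ->]]] := rpt_surj k.
by rewrite !comma_restrE comma_pre_comp.
Qed.

Definition comma_proj X : comma_space X -> nerve_realization R C :=
  nerve_realization_map R (comma_forget F X).

Lemma comma_proj_continuous X : continuous (@comma_proj X).
Proof. exact: nerve_realization_map_continuous. Qed.

Lemma comma_proj_restr X Y (u : Mor D X Y) k : comma_proj (comma_restr u k) = comma_proj k.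
Proof.
have [n [a [t ->]]] := rpt_surj k.
rewrite comma_restrE /comma_proj !nerve_realization_mapE; congr rpt.
by case: a => ? ?; apply: nerve_eq.
Qed.

End CommaSpace.

Lemma coslice_contractible (Ob : Type) (D : category Ob) X :
  contractible R (comma_space (functor_id D) X).
Proof.
apply: (@cone_contractible R _ (comma (functor_id D) X)
  (@CommaOb _ _ D id X X (idm D X))
  (fun a => exist _ (carr a) (comp_idr (carr a)) : Mor (comma (functor_id D) X) (CommaOb (idm D X)) a)).
by move=> a b u; apply: comma_mor_eq; apply: (svalP u).
Qed.

Section NaturalTransformation.
Variables (O1 O2 : Type) (C : category O1) (D : category O2) (f g : O1 -> O2).
Variables (F : functor C D f) (G : functor C D g).
Variable eta : forall X, Mor D (f X) (g X).
Hypothesis eta_nat : forall X Y (u : Mor C X Y),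
  comp (fmap G u) (eta X) = comp (eta Y) (fmap F u).

(** Both maps are carried by the coslices under [f X], which are contractible: the image of a
    simplex under [F] is placed there by an identity, its image under [G] by [eta]. *)
Theorem natural_homot : homot R (nerve_realization_map R F) (nerve_realization_map R G).
Proof.
pose Id := functor_id D.
pose kf X Y (u : Mor C X Y) := @comma_restr _ _ _ _ _ Id _ _ (fmap F u).
apply: (@carried_homot R O1 C (fun X => comma_space Id (f X)) kf _ _ _ _
  (nerve_realization R D) (fun X => @comma_proj _ _ _ _ _ Id (f X)) _ _
  (fun n z t => rpt (@comma_under _ _ _ _ _ Id _ n (nerve_map F _ z) (idm D _)) t)
  (fun n z t => rpt (@comma_under _ _ _ _ _ Id _ n (nerve_map G _ z) (eta _)) t)).
- by move=> X Y u; apply: comma_restr_continuous.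
- by move=> X k; rewrite /kf fmap_id comma_restr_id.
- by move=> X Y Z v u k; rewrite /kf fmap_comp comma_restr_comp.
- by move=> X; apply: coslice_contractible.
- by move=> X; apply: comma_proj_continuous.
- by move=> X Y u k; apply: comma_proj_restr.
- split=> [n x|m n th tm x t]; first exact: rpt_continuous.
  rewrite /kf comma_restrE -rpt_face; congr rpt; apply: comma_nerve_eq => // i /=.
  rewrite !comp_idr /edge0 /edge /= -fmap_comp; congr (fmap F _).
  exact: (@edge_comp _ _ _ x ord0 (th ord0) (th i) (leq0n (th ord0)) (tm ord0 i (leq0n i)) (leq0n (th i))).
- split=> [n x|m n th tm x t]; first exact: rpt_continuous.
  rewrite /kf comma_restrE -rpt_face; congr rpt; apply: comma_nerve_eq => // i /=.
  rewrite -comp_assoc -eta_nat comp_assoc /edge0 /edge /= -fmap_comp; congr (comp (fmap G _) _).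
  exact: (@edge_comp _ _ _ x ord0 (th ord0) (th i) (leq0n (th ord0)) (tm ord0 i (leq0n i)) (leq0n (th i))).
- move=> n x t; rewrite /comma_proj !nerve_realization_mapE; congr rpt.
  by case: x => ? ?; apply: nerve_eq.
- move=> n x t; rewrite /comma_proj !nerve_realization_mapE; congr rpt.
  by case: x => ? ?; apply: nerve_eq.
Qed.

End NaturalTransformation.

Section QuillenA.
Variables (O1 O2 : Type) (C : category O1) (D : category O2) (h : O1 -> O2).
Variable F : functor C D h.
Hypothesis fibers : forall X, contractible R (comma_space F X).

Let Id := functor_id D.

Let comma_map X : functor (comma F X) (comma Id X)
  (fun a => @CommaOb _ _ D id X (h (cob a)) (carr a)).
Proof.
refine (@Functor _ _ (comma F X) (comma Id X)
  (fun a => @CommaOb _ _ D id X (h (cob a)) (carr a))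
  (fun a b v => exist _ (fmap F (sval v)) (svalP v)) _ _).
- by move=> a; apply: comma_mor_eq; rewrite /= fmap_id.
- by move=> a b c v u; apply: comma_mor_eq; rewrite /= fmap_comp.
Defined.

(** The inverse [r] is a carried family in the fibers, projected to the nerve of [C]. On one side
    [r] after [F] and the identity are both carried by the fibers over [h X]; on the other, [F]
    after [r] and the identity are both carried by the coslices of [D]. *)
Theorem quillen_A : homotopy_equivalence R (nerve_realization_map R F).
Proof.
apply/homotopy_equivalenceP; split; first exact: nerve_realization_map_continuous.
have [g cg] := carried_exists (@comma_restr_continuous _ _ _ _ _ F)
  (@comma_restr_id _ _ _ _ _ F) (@comma_restr_comp _ _ _ _ _ F) fibers.
have [r cr rE] := carried_map (@comma_proj_continuous _ _ _ _ _ F)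
  (@comma_proj_restr _ _ _ _ _ F) cg.
have [gc gg] := cg.
exists r; split=> //.
- pose kf X Y (u : Mor C X Y) := @comma_restr _ _ _ _ _ F _ _ (fmap F u).
  have cast n (a b : nerve D n) (E : a = b) (e : vx a ord0 = vx b ord0) t :
      eq_rect _ (comma_space F) (g n a t) _ e = g n b t.
    by case: _ / E e => e; rewrite (Prop_irrelevance e erefl).
  apply: (@carried_homot R O1 C (fun X => comma_space F (h X)) kf _ _ _ _
    (nerve_realization R C) (fun X => @comma_proj _ _ _ _ _ F (h X)) _ _
    (fun n z t => g n (nerve_map F _ z) t)
    (fun n z t => rpt (@comma_under _ _ _ _ _ F _ n z (idm D _)) t)).
  + by move=> X Y u; apply: comma_restr_continuous.
  + by move=> X k; rewrite /kf fmap_id comma_restr_id.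
  + by move=> X Y Z v u k; rewrite /kf fmap_comp comma_restr_comp.
  + by move=> X; apply: fibers.
  + by move=> X; apply: comma_proj_continuous.
  + by move=> X Y u k; apply: comma_proj_restr.
  + split=> [n x|m n th tm x t]; first exact: (gc n (nerve_map F _ x)).
    have E := smap_nat (nerve_map F) tm x.
    by rewrite -gg -(cast _ _ _ E erefl).
  + split=> [n x|m n th tm x t]; first exact: rpt_continuous.
    rewrite /kf comma_restrE -rpt_face; congr rpt; apply: comma_nerve_eq => // i /=.
    rewrite !comp_idr -fmap_comp; congr (fmap F _).
    exact: (@edge_comp _ _ _ x ord0 (th ord0) (th i) (leq0n (th ord0)) (tm ord0 i (leq0n i)) (leq0n (th i))).
  + by move=> n x t; rewrite /= nerve_realization_mapE rE.
  + by move=> n x t; rewrite /comma_proj nerve_realization_mapE comma_forget_under.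
- apply: (@carried_homot R O2 D (fun X => comma_space Id X)
    (@comma_restr _ _ _ _ _ Id) _ _ _ _
    (nerve_realization R D) (@comma_proj _ _ _ _ _ Id) _ _
    (fun n x t => nerve_realization_map R (comma_map _) (g n x t))
    (fun n x t => rpt (@comma_under _ _ _ _ _ Id _ n x (idm D _)) t)).
  + exact: comma_restr_continuous.
  + exact: comma_restr_id.
  + exact: comma_restr_comp.
  + exact: coslice_contractible.
  + exact: comma_proj_continuous.
  + exact: comma_proj_restr.
  + split=> [n x|m n th tm x t].
      by apply: continuous_compT; [exact: gc|exact: nerve_realization_map_continuous].
    rewrite -gg; have [k [a [s ->]]] := rpt_surj (g m (face tm x) t).
    rewrite comma_restrE !nerve_realization_mapE comma_restrE; congr rpt.
    by case: a => ? ?; apply: comma_nerve_eq.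
  + split=> [n x|m n th tm x t]; first exact: rpt_continuous.
    rewrite comma_restrE -rpt_face; congr rpt; apply: comma_nerve_eq => // i /=.
    rewrite !comp_idr.
    exact: (@edge_comp _ _ _ x ord0 (th ord0) (th i) (leq0n (th ord0)) (tm ord0 i (leq0n i)) (leq0n (th i))).
  + move=> n x t; rewrite /= rE; have [k [a [s ->]]] := rpt_surj (g n x t).
    rewrite /comma_proj !nerve_realization_mapE; congr rpt.
    by case: a => ? ?; apply: nerve_eq.
  + by move=> n x t; rewrite /comma_proj nerve_realization_mapE comma_forget_under.
Qed.

End QuillenA.
End NerveRealization.

(** * Zigzags, coreflections and full subcategories *)

Section CategoryLemmas.
Variable R : realType.

Definition const_functor (O1 O2 : Type) (C : category O1) (D : category O2) (b : O2) :
  functor C D (fun _ => b) :=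
  @Functor _ _ C D (fun _ => b) (fun _ _ _ => idm D b) (fun _ => erefl)
    (fun _ _ _ _ _ => esym (comp_idl _)).

Lemma const_functor_map (O1 O2 : Type) (C : category O1) (D : category O2) (b : O2) :
  exists p, nerve_realization_map R (const_functor C D b) = cst p.
Proof.
pose x0 : nerve D 0 := existT _ (fun _ => b) (const_functor (ordcat 0) D b).
have m0 n : monotone (fun _ : 'I_n.+1 => ord0 : 'I_1) by [].
pose t0 : simplex R 0 := @mk_simplex R 0 (fun _ => 1%R) (fun _ => ler01) (big_ord1 _ _).
exists (rpt x0 t0); apply/funext => z; have [n [x [t ->]]] := rpt_surj z.
rewrite nerve_realization_mapE.
have -> : nerve_map (const_functor C D b) n x = face (m0 n) x0 by apply: nerve_eq.
rewrite rpt_face; congr rpt; apply: simplex_ext => j.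
rewrite bcoord_push bcoord_mk -[RHS](bcoord_sum t); apply: eq_bigl => i.
by rewrite [j]ord1.
Qed.

(* Objects that admit at most one morphism to any object make every square
   starting at them commute, so naturality of the zigzag
   X <- r X -> t X <- b costs nothing. *)
Lemma zigzag_contractible (Ob : Type) (B : category Ob) (r t : Ob -> Ob) (b : Ob) :
  (forall X Y (u v : Mor B (r X) Y), u = v) ->
  (forall X Y (u v : Mor B (t X) Y), u = v) ->
  (forall Y (u v : Mor B b Y), u = v) ->
  (forall X, inhabited (Mor B (r X) X)) ->
  (forall X, inhabited (Mor B (r X) (t X))) ->
  (forall X, inhabited (Mor B b (t X))) ->
  (forall X Y, Mor B X Y -> inhabited (Mor B (r X) (r Y))) ->
  (forall X Y, Mor B X Y -> inhabited (Mor B (t X) (t Y))) ->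
  contractible R (nerve_realization R B).
Proof.
move=> ru tu bu e n k rm tm.
have pick T : inhabited T -> T by move=> iT; have : exists _ : T, True by [case: iT => x; exists x]; move/cid => [].
pose Fr : functor B B r := @Functor _ _ B B r (fun X Y u => pick _ (rm X Y u))
  (fun X => ru _ _ _ _) (fun X Y Z v u => ru _ _ _ _).
pose Ft : functor B B t := @Functor _ _ B B t (fun X Y u => pick _ (tm X Y u))
  (fun X => tu _ _ _ _) (fun X Y Z v u => tu _ _ _ _).
have h1 : homot R (nerve_realization_map R Fr) id.
  rewrite -(nerve_realization_map_id R B).
  by apply: (@natural_homot R _ _ B B r id Fr (functor_id B) (fun X => pick _ (e X))) => *; apply: ru.
have h2 : homot R (nerve_realization_map R Fr) (nerve_realization_map R Ft).
  by apply: (@natural_homot R _ _ B B r t Fr Ft (fun X => pick _ (n X))) => *; apply: ru.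
have h3 : homot R (nerve_realization_map R (const_functor B B b)) (nerve_realization_map R Ft).
  by apply: (@natural_homot R _ _ B B _ t (const_functor B B b) Ft (fun X => pick _ (k X))) => *; apply: bu.
have [p pE] := const_functor_map B B b; exists p; rewrite -pE.
apply: homot_trans (homot_sym h1) _.
exact: homot_trans h2 (homot_sym h3).
Qed.

(** Only the object part [c] of the right adjoint is given; the universal property of [ep] supplies
    its action on morphisms and the unit, and [natural_homot] applies to unit and counit. *)
Lemma coreflective_equivalence (O1 O2 : Type) (C : category O1) (D : category O2)
    (h : O1 -> O2) (F : functor C D h) (c : O2 -> O1)
    (ep : forall X, Mor D (h (c X)) X) :
  (forall X Q (m : Mor D (h Q) X), exists v : Mor C Q (c X), comp (ep X) (fmap F v) = m) ->
  (forall X Q (v v' : Mor C Q (c X)),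
     comp (ep X) (fmap F v) = comp (ep X) (fmap F v') -> v = v') ->
  homotopy_equivalence R (nerve_realization_map R F).
Proof.
move=> ex un.
pose lift X Q (m : Mor D (h Q) X) := projT1 (cid (ex X Q m)).
have liftE X Q (m : Mor D (h Q) X) : comp (ep X) (fmap F (lift X Q m)) = m.
  exact: (projT2 (cid (ex X Q m))).
have lift_id X : lift X (c X) (comp (idm D X) (ep X)) = idm C (c X).
  by apply: un; rewrite liftE fmap_id comp_idl comp_idr.
have lift_comp X Y Z (v : Mor D Y Z) (u : Mor D X Y) :
    lift Z (c X) (comp (comp v u) (ep X)) =
    comp (lift Z (c Y) (comp v (ep Y))) (lift Y (c X) (comp u (ep X))).
  by apply: un; rewrite liftE fmap_comp comp_assoc liftE -!comp_assoc liftE.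
pose G : functor D C c := @Functor _ _ D C c
  (fun X Y u => lift Y (c X) (comp u (ep X))) lift_id lift_comp.
apply/homotopy_equivalenceP; split; first exact: nerve_realization_map_continuous.
exists (nerve_realization_map R G); split; first exact: nerve_realization_map_continuous.
- rewrite -nerve_realization_map_comp -(nerve_realization_map_id R C).
  apply: homot_sym.
  apply: (@natural_homot R _ _ C C id (c \o h) (functor_id C) (functor_comp G F)
    (fun Q => lift (h Q) Q (idm D (h Q)))) => X Y u.
  apply: un; rewrite !fmap_comp /= !comp_assoc !liftE -comp_assoc liftE.
  by rewrite comp_idl comp_idr.
- rewrite -nerve_realization_map_comp -(nerve_realization_map_id R D).
  apply: (@natural_homot R _ _ D D (h \o c) id (functor_comp F G) (functor_id D) ep) => X Y u.
  by rewrite /= liftE.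
Qed.

Section Subcategories.
Variables (Ob : Type) (C : category Ob).

Definition sub_functor (A B : Ob -> Prop) (AB : forall X, A X -> B X) :
  functor (fullsub C A) (fullsub C B) (fun X => exist B (sval X) (AB _ (svalP X))) :=
  @Functor _ _ (fullsub C A) (fullsub C B)
    (fun X => exist B (sval X) (AB _ (svalP X)))
    (fun X Y f => f) (fun X => erefl) (fun X Y Z g f => erefl).

Definition incl_equivalence (A : Ob -> Prop) :=
  homotopy_equivalence R (nerve_realization_map R (incl_functor C A)).

Lemma incl_sub_functor (A B : Ob -> Prop) (AB : forall X, A X -> B X) :
  nerve_realization_map R (incl_functor C A) =
  nerve_realization_map R (incl_functor C B) \o nerve_realization_map R (sub_functor AB).
Proof.
rewrite -nerve_realization_map_comp; apply/funext => z.
by have [n [x [t ->]]] := rpt_surj z; rewrite !nerve_realization_mapE.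
Qed.

End Subcategories.
End CategoryLemmas.

Local Close Scope ring_scope.
Local Close Scope classical_set_scope.
From mathcomp Require Import fintype finset fingroup.
Local Open Scope group_scope.

(** * Fusion systems *)

Section FusionBasics.
Variables (gT : finGroupType) (S : {group gT}) (F : fusion_system S).
Implicit Types P Q T E : subgrp S.
Local Notation M := (Mor (fusion_cat F)).

Lemma mem_conjV (A : {group gT}) g k : g \in 'N(A) -> k \in A -> g * k * g^-1 \in A.
Proof.
by move=> Ng Ak; rewrite (_ : g * k * g^-1 = k ^ g^-1) ?memJ_norm ?groupV // conjgE invgK mulgA.
Qed.

Lemma subgrp_inj P Q : P = Q :> {set gT} -> P = Q.
Proof. by move=> PQ; apply/val_inj/group_inj. Qed.

Lemma fappM P Q (f : M P Q) x y : x \in P -> y \in P ->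
  fapp f (x * y) = fapp f x * fapp f y.
Proof.
move=> Px Py; have [fM _] := fhom_inj (svalP f).
by rewrite /fapp subgM // fM.
Qed.

Lemma fapp_inj P Q (f : M P Q) : {in P &, injective (fapp f)}.
Proof.
move=> x y Px Py; have [_ fI] := fhom_inj (svalP f).
rewrite /fapp => /val_inj/fI/(congr1 sgval).
by rewrite !subgK.
Qed.

Lemma fapp1 P Q (f : M P Q) : fapp f 1 = 1.
Proof. by apply: (mulgI (fapp f 1)); rewrite -fappM ?group1 // !mulg1. Qed.

Lemma fappV P Q (f : M P Q) x : x \in P -> fapp f x^-1 = (fapp f x)^-1.
Proof.
by move=> Px; apply: (mulgI (fapp f x)); rewrite -fappM ?groupV // !mulgV fapp1.
Qed.

Lemma fapp_conj P Q (f : M P Q) x y : x \in P -> y \in P ->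
  fapp f (x * y * x^-1) = fapp f x * fapp f y * (fapp f x)^-1.
Proof. by move=> Px Py; rewrite !fappM ?groupM ?groupV // fappV. Qed.

Lemma fmor_eq P Q (f g : M P Q) : {in P, fapp f =1 fapp g} -> f = g.
Proof.
move=> fg; apply/val_inj/ffunP => x; apply/val_inj.
by have := fg _ (subgP x); rewrite !fappE.
Qed.

Lemma fapp_top P Q (f : M P Q) x : fapp f x \in S.
Proof. by apply: (subsetP (valP Q)); apply: fapp_in. Qed.

Lemma fconj_ex P Q x : x \in S -> (forall g, g \in P -> x * g * x^-1 \in Q) ->
  exists f : M P Q, forall g, g \in P -> fapp f g = x * g * x^-1.
Proof.
move=> Sx xPQ.
pose f : {ffun [subg P] -> [subg Q]} := [ffun g => subg Q (x * sgval g * x^-1)].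
have Ff : f \in fhom F P Q.
  apply: (subsetP (fhom_conj F P Q)); rewrite inE; apply/existsP; exists x.
  rewrite Sx; apply/forallP => g; rewrite ffunE subgK // xPQ //.
  exact: subgP.
exists (exist _ f Ff) => g Pg; rewrite /fapp /= ffunE [sgval (subg P g)]subgK // subgK //.
exact: xPQ.
Qed.

Lemma fincl_ex P Q : P \subset Q -> exists f : M P Q, {in P, fapp f =1 id}.
Proof.
move=> PQ; have [|f fE] := @fconj_ex P Q 1 (group1 S).
  by move=> g Pg; rewrite mul1g invg1 mulg1 (subsetP PQ).
by exists f => g Pg; rewrite fE // mul1g invg1 mulg1.
Qed.

Lemma ffactor P Q (f : M P Q) : exists T (a : M P T) (b : M T P),
  [/\ T \subset Q, T = fapp f @: P :> {set gT}, {in P, fapp a =1 fapp f},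
      {in P, forall x, fapp b (fapp f x) = x}
    & {in T, forall y, fapp f (fapp b y) = y}].
Proof.
have [T [a [b [TQ Fa Fb [ab ba] fa]]]] := fhom_factor (svalP f).
exists T, (exist _ a Fa), (exist _ b Fb).
have aE x : x \in P -> fapp (exist (fun a => a \in fhom F P T) a Fa) x = fapp f x.
  by move=> Px; rewrite /fapp /= -fa.
split=> //.
- apply/setP => y; apply/idP/imsetP => [Ty|[x Px ->]].
    exists (sgval (b (subg T y))); first exact: subgP.
    by rewrite -aE ?subgP // fappE /= ba subgK.
  by rewrite -aE //; apply: fapp_in.
- by move=> x Px; rewrite -aE // /fapp /= sgvalK ab subgK.
- move=> y Ty; rewrite -aE; last exact: fapp_in.
  by rewrite /fapp /= sgvalK ba subgK.
Qed.

Lemma frestr P Q (f : M P Q) P0 Q0 : P0 \subset P ->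
  (forall x, x \in P0 -> fapp f x \in Q0) ->
  exists f0 : M P0 Q0, {in P0, fapp f0 =1 fapp f}.
Proof.
move=> P0P fQ0; have [i iE] := fincl_ex P0P.
have [T [a [b [_ TE aE _ _]]]] := ffactor (comp f i).
have TQ0 : T \subset Q0.
  apply/subsetP => y; rewrite TE => /imsetP[x Px ->].
  by rewrite fapp_comp iE // fQ0.
have [j jE] := fincl_ex TQ0; exists (comp j a) => x Px.
by rewrite fapp_comp jE ?fapp_in // aE // fapp_comp iE.
Qed.

Lemma finv_ex P Q (f : M P Q) T : T = fapp f @: P :> {set gT} ->
  exists b : M T P, {in P, forall x, fapp b (fapp f x) = x} /\
                    {in T, forall y, fapp f (fapp b y) = y}.
Proof.
move=> TE; have [T' [a [b [_ TE' _ b1 b2]]]] := ffactor f.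
have eT : T' = T by apply: subgrp_inj; rewrite TE' TE.
by case: _ / eT {TE} => *; exists b.
Qed.

Lemma FconjP P Q : Fconj F P Q <-> exists f : M P Q, Q = fapp f @: P :> {set gT}.
Proof.
split=> [[f [g [gf fg]]]|[f QE]].
  exists f; apply/setP => y; apply/idP/imsetP => [Qy|[x _ ->]]; last exact: fapp_in.
  by exists (fapp g y); [exact: fapp_in|rewrite -fapp_comp fg fapp_id].
have [b [b1 b2]] := finv_ex QE; exists f, b; split; apply: fmor_eq => x Px.
  by rewrite fapp_comp b1 // fapp_id.
by rewrite fapp_comp b2 // fapp_id.
Qed.

Lemma Fconj_refl P : Fconj F P P.
Proof. by exists (idm (fusion_cat F) P), (idm (fusion_cat F) P); rewrite comp_idl. Qed.

Lemma Fconj_sym P Q : Fconj F P Q -> Fconj F Q P.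
Proof. by case=> f [g [gf fg]]; exists g, f. Qed.

Lemma Fconj_trans P Q T : Fconj F P Q -> Fconj F Q T -> Fconj F P T.
Proof.
case=> f [g [gf fg]] [h [k [kh hk]]]; exists (comp h f), (comp g k); split.
  by rewrite -comp_assoc [comp k _]comp_assoc kh comp_idl.
by rewrite -comp_assoc [comp f _]comp_assoc fg comp_idl.
Qed.

Lemma Fconj_maps P Q : Fconj F P Q -> exists (f : M P Q) (g : M Q P),
  {in P, forall x, fapp g (fapp f x) = x} /\ {in Q, forall y, fapp f (fapp g y) = y}.
Proof.
case=> f [g [gf fg]]; exists f, g.
by split=> x Px; rewrite -fapp_comp ?gf ?fg fapp_id.
Qed.

Lemma Fconj_image P Q (f : M P Q) P0 Q0 : P0 \subset P ->
  Q0 = fapp f @: P0 :> {set gT} -> Fconj F P0 Q0.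
Proof.
move=> P0P QE; have [|f0 f0E] := @frestr P Q f P0 Q0 P0P.
  by move=> x Px; rewrite QE imset_f.
by apply/FconjP; exists f0; rewrite QE; apply: eq_in_imset => x Px; rewrite f0E.
Qed.

Lemma image_subgrp P Q (f : M P Q) P0 : P0 \subset P ->
  exists T, T = fapp f @: P0 :> {set gT}.
Proof.
move=> P0P; have [i iE] := fincl_ex P0P.
have [T [a [b [_ TE aE _ _]]]] := ffactor (comp f i); exists T; rewrite TE.
by apply: eq_in_imset => x Px; rewrite fapp_comp iE.
Qed.

Lemma card_fapp P Q (f : M P Q) (A : {set gT}) : A \subset P ->
  #|fapp f @: A| = #|A|.
Proof.
by move=> AP; apply: card_in_imset => x y Ax Ay; apply: fapp_inj; apply: (subsetP AP).
Qed.

Lemma quasicentric_Fconj P Q : Fconj F P Q -> quasicentric F P -> quasicentric F Q.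
Proof. by move=> PQ qP P' QP'; apply: qP; apply: Fconj_trans QP'. Qed.

Lemma fully_normalized_ex P : exists2 Q, Fconj F P Q & fully_normalized F Q.
Proof.
have PP : `[< Fconj F P P >] by apply/asboolP/Fconj_refl.
pose nN (Q : subgrp S) := #|'N_S(Q)|.
pose Q := [arg max_(Q > P | `[< Fconj F P Q >]) nN Q].
exists Q; rewrite /Q; case: arg_maxnP => // Q0 /asboolP PQ mx; first by [].
move=> T QT; apply: mx; apply/asboolP; exact: Fconj_trans QT.
Qed.

(** The predicate given to [pick] depends only on the conjugacy class, so conjugate subgroups
    receive the very same representative. The default is never reached. *)
Definition frep P : subgrp S :=
  odflt P [pick Q | `[< Fconj F P Q /\ fully_normalized F Q >]].

Lemma frepP P : Fconj F P (frep P) /\ fully_normalized F (frep P).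
Proof.
rewrite /frep; case: pickP => [Q /asboolP//|no].
by have [Q PQ nQ] := fully_normalized_ex P; have /asboolP[] := no Q.
Qed.

Lemma frep_Fconj P Q : Fconj F P Q -> frep P = frep Q.
Proof.
move=> PQ; rewrite /frep.
have -> : [pick T | `[< Fconj F P T /\ fully_normalized F T >]] =
          [pick T | `[< Fconj F Q T /\ fully_normalized F T >]].
  apply: eq_pick => T; apply: asbool_equiv_eq; split=> -[h n]; split=> //.
    exact: Fconj_trans (Fconj_sym PQ) h.
  exact: Fconj_trans PQ h.
case: pickP => [//|no].
by have [T QT nT] := fully_normalized_ex Q; have /asboolP[] := no T.
Qed.

Lemma frep_idem P : frep (frep P) = frep P.
Proof. by rewrite -(frep_Fconj (frepP P).1). Qed.

End FusionBasics.

(** * Automorphism groups and the extension axiom *)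

Section Automorphisms.
Variables (gT : finGroupType) (S : {group gT}) (F : fusion_system S) (p : nat).
Implicit Types P Q T E K : subgrp S.
Local Notation M := (Mor (fusion_cat F)).
Local Notation top := (top_subgrp S).

Definition AutF_group P := Group (AutF_group_set F P).

Lemma aut_mor P (a : {perm [subg P]}) : a \in AutF F P ->
  exists f : M P P, forall x : [subg P], fapp f (sgval x) = sgval (a x).
Proof.
rewrite inE => Fa; exists (exist (fun h => h \in fhom F P P) _ Fa) => x.
by rewrite fappE /= ffunE.
Qed.

Lemma mor_aut P (f : M P P) : exists2 a, a \in AutF F P &
  forall x : [subg P], sgval (a x) = fapp f (sgval x).
Proof.
have inj : injective (sval f) by have [] := fhom_inj (svalP f).
exists (perm inj); last by move=> x; rewrite permE fappE.
rewrite inE (_ : [ffun x => _] = sval f); first exact: svalP f.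
by apply/ffunP => x; rewrite ffunE permE.
Qed.

Section ConjAction.
Variables (K P : subgrp S) (f : M K P) (g : M P K).
Hypothesis fg : {in P, forall y, fapp f (fapp g y) = y}.
Hypothesis gf : {in K, forall x, fapp g (fapp f x) = x}.

Let rfun (u : gT) : {ffun [subg P] -> [subg P]} :=
  [ffun x => subg P (fapp f (fapp g (sgval x) ^ u))].

(** The action of ['N_S(K)] on K, transported to P along the isomorphism [f] with inverse [g]. Right
    conjugation matches the order of composition in permutations; the default 1 matters only outside
    ['N_S(K)]. *)
Definition tract (u : gT) : {perm [subg P]} := insubd (1 : {perm [subg P]}) (rfun u).

Lemma tractE u x : u \in 'N_S(K) -> sgval (tract u x) = fapp f (fapp g (sgval x) ^ u).
Proof.
case/setIP=> _ Nu; rewrite /tract.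
have Kg y : fapp g y ^ u \in K by rewrite memJ_norm // fapp_in.
have inj : injectiveb (rfun u).
  apply/injectiveP => y z; rewrite !ffunE => /(congr1 sgval).
  rewrite !subgK ?fapp_in // => /(fapp_inj (Kg _) (Kg _))/conjg_inj e.
  by apply/val_inj; rewrite /= -(fg (subgP y)) e fg ?subgP.
by rewrite -pvalE insubdK // ffunE subgK ?fapp_in.
Qed.

Lemma tractM : {in 'N_S(K) &, {morph tract : u v / u * v}}.
Proof.
move=> u v Nu Nv; apply/permP => x; apply/val_inj.
rewrite permM /= !tractE ?groupM //.
by rewrite gf ?conjgM // memJ_norm ?fapp_in //; case/setIP: Nu.
Qed.

Canonical tract_morphism := Morphism tractM.

Lemma tract_AutF u : u \in 'N_S(K) -> tract u \in AutF F P.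
Proof.
move=> Nu; have /setIP[Su NKu] := Nu.
have [||c cE] := @fconj_ex _ _ F K K u^-1.
- by rewrite groupV.
- by move=> k Kk; rewrite invgK -mulgA -conjgE memJ_norm.
rewrite inE (_ : [ffun x => _] = sval (comp f (comp c g))); first exact: svalP (comp f (comp c g)).
apply/ffunP => x; apply/val_inj; rewrite ffunE.
change (sgval (tract u x) = sgval (sval (comp f (comp c g)) x)); rewrite tractE //.
rewrite -fappE !fapp_comp cE ?fapp_in //.
by rewrite invgK -mulgA -conjgE.
Qed.

Lemma tract_sub : tract @* 'N_S(K) \subset AutF F P.
Proof. by apply/subsetP => _ /morphimP[u _ Nu ->]; apply: tract_AutF. Qed.

Lemma tract_pgroup : p.-group S -> p.-group (tract @* 'N_S(K)).
Proof. by move=> pS; apply: morphim_pgroup; apply: pgroupS pS; apply: subsetIl. Qed.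

End ConjAction.

Lemma AutSP P (a : {perm [subg P]}) :
  reflect (exists2 u, u \in 'N_S(P) & forall x : [subg P], sgval (a x) = sgval x ^ u)
          (a \in AutS P).
Proof.
rewrite inE inE; apply: (iffP existsP) => [[x /andP[Sx /forallP xE]]|[u /setIP[Su Nu] uE]].
  have xE' y : sgval (a y) = sgval y ^ x^-1.
    by have /eqP := xE y; rewrite ffunE => ->; rewrite conjgE invgK mulgA.
  exists x^-1; rewrite // inE groupV Sx /= inE.
  apply/subsetP => _ /imsetP[y Py ->].
  by have := xE' (subg P y); rewrite subgK // => <-; apply: subgP.
exists u^-1; rewrite groupV Su; apply/forallP => x; rewrite ffunE uE.
by rewrite conjgE invgK mulgA.
Qed.

Let id1 P : {in P, forall y, fapp (idm (fusion_cat F) P) (fapp (idm (fusion_cat F) P) y) = y}.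
Proof. by move=> y Py; rewrite !fapp_id. Qed.

Lemma tract_AutS P : tract_morphism (@id1 P) (@id1 P) @* 'N_S(P) = AutS P.
Proof.
apply/setP => a; apply/idP/AutSP => [/morphimP[u Nu _ ->]|[u Nu aE]].
  exists u => // x; rewrite /= (tractE (@id1 P)) // !fapp_id ?subgP //.
  by rewrite memJ_norm ?subgP //; case/setIP: Nu.
apply/morphimP; exists u => //; apply/permP => x; apply/val_inj.
rewrite /= (tractE (@id1 P)) // aE !fapp_id ?subgP //.
by rewrite memJ_norm ?subgP //; case/setIP: Nu.
Qed.

Hypothesis satF : saturated F p.

Lemma fully_normalized_centralized P : fully_normalized F P -> fully_centralized F P.
Proof. by move=> nP; have [] := satF.1 P nP. Qed.

(** Sylow's theorem in [AutF F P], where [AutS P] is a Sylow subgroup by axiom (I). *)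
Lemma AutS_absorb P (B : {group {perm [subg P]}}) : fully_normalized F P ->
  B \subset AutF F P -> p.-group B ->
  exists2 a, a \in AutF F P & forall b, b \in B -> b ^ a \in AutS P.
Proof.
move=> nP sB pB; have [_ syl] := satF.1 P nP; rewrite -tract_AutS in syl.
have [a Aa sBa] := @Sylow_Jsub p _ (AutF_group P) _ B syl sB pB.
exists a => // b Bb; rewrite -tract_AutS; apply: (subsetP sBa).
by rewrite memJ_conjg.
Qed.

Lemma AutS_sub_pcore P : fully_normalized F P -> 'O_p(AutF_group P) \subset AutS P.
Proof.
move=> nP; have [_ syl] := satF.1 P nP; rewrite -tract_AutS in syl *.
exact: (@pcore_sub_Hall _ _ (AutF_group P) _ syl).
Qed.

Lemma extension K P (f : M K P) (R : subgrp S) : P = fapp f @: K :> {set gT} ->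
  fully_centralized F P -> K \subset R -> R \subset 'N_S(K) ->
  (forall g, g \in R -> exists2 h, h \in 'N_S(P) &
     forall k, k \in K -> fapp f (g * k * g^-1) = h * fapp f k * h^-1) ->
  exists f' : M R top, {in K, fapp f' =1 fapp f}.
Proof.
move=> PE cP KR RN ext.
have [i iE] := @fincl_ex _ _ F P top (valP P).
have fE x : x \in K -> fapp (comp i f) x = fapp f x.
  by move=> Kx; rewrite fapp_comp iE ?fapp_in.
have imE : fapp (comp i f) @: K = P.
  by rewrite PE; apply: eq_in_imset => x Kx; apply: fE.
have [N [g [NE gE]]] := satF.2 K (comp i f) P (esym imE) cP.
have RsubN : R \subset N.
  apply/subsetP => x Rx; have NSx := subsetP RN _ Rx.
  have /setIP[_ Nx] := NSx; rewrite NE inE NSx /=.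
  have [h Nh hE] := ext x Rx; apply/existsP; exists h; rewrite imE Nh /=.
  apply/forallP => k; apply/implyP => Kk; rewrite !fE ?hE //.
  exact: mem_conjV.
have [|f' f'E] := @frestr _ _ F _ _ g R top RsubN.
  by move=> x _; apply: fapp_in.
by exists f' => x Kx; rewrite f'E ?(subsetP KR) // gE // fE.
Qed.

Hypothesis pS : p.-group S.

(** The action of ['N_S(K)], transported to P, is a p-group of automorphisms. After composition with
    an automorphism of P it lies in Aut_S(P), and then all of ['N_S(K)] satisfies the condition of
    axiom (II). *)
Lemma normalizer_extension K P (R : subgrp S) : fully_normalized F P -> Fconj F K P ->
  K \subset R -> R \subset 'N_S(K) ->
  exists f : M R top, P = fapp f @: K :> {set gT}.
Proof.
move=> nP KP KR RN; have [f [g [gf fg]]] := Fconj_maps KP.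
have [a Aa aE] := AutS_absorb nP (tract_sub fg gf) (tract_pgroup fg gf pS).
have [al alE] := aut_mor Aa.
have imE : fapp (comp al f) @: K = P.
  apply/eqP; rewrite eqEcard card_fapp // (Fconj_card KP) leqnn andbT.
  by apply/subsetP => _ /imsetP[x _ ->]; apply: fapp_in.
have [|e eE] := extension (f := comp al f) (esym imE) (fully_normalized_centralized nP) KR RN.
  move=> u Ru; have Nu := subsetP RN _ Ru.
  have Bu : tract f g u^-1 \in tract_morphism fg gf @* 'N_S(K).
    by apply: (mem_morphim (tract_morphism fg gf)); rewrite groupV.
  have /AutSP[h Nh hE] := aE _ Bu.
  exists h^-1; rewrite ?groupV // => k Kk.
  have := hE (a (subg P (fapp f k))).
  rewrite permJ -!alE (tractE fg) ?groupV // subgK ?fapp_in // gf // => ke.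
  rewrite !fapp_comp (_ : u * k * u^-1 = k ^ u^-1); last by rewrite conjgE invgK mulgA.
  by rewrite ke invgK conjgE mulgA.
by exists e; rewrite -[LHS]imE; apply: eq_in_imset => x Kx; rewrite eE.
Qed.

End Automorphisms.

(** * Extension to K C_S(K) and automorphisms of p-power order *)

Section Quasicentric.
Variables (gT : finGroupType) (S : {group gT}) (F : fusion_system S) (p : nat).
Implicit Types P Q T E K : subgrp S.
Local Notation M := (Mor (fusion_cat F)).
Local Notation top := (top_subgrp S).
Hypothesis satF : saturated F p.
Hypothesis pS : p.-group S.

Definition mk_subgrp (A : {group gT}) (AS : A \subset S) : subgrp S := exist _ A AS.

Lemma join_cent_sub K : K <*> 'C_S(K) \subset S.
Proof. by rewrite join_subG (valP K) subsetIl. Qed.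

Definition join_cent K : subgrp S := mk_subgrp (join_cent_sub K).

Lemma join_centE K : join_cent K = K * 'C_S(K) :> {set gT}.
Proof. by rewrite /= cent_joinEr // subsetIr. Qed.

Lemma join_cent_norm K : join_cent K \subset 'N_S(K).
Proof.
rewrite subsetI (valP (join_cent K)) join_subG normG /=.
by apply: subset_trans (subsetIr _ _) (cent_sub _).
Qed.

Lemma join_cent_memP K g : g \in join_cent K -> exists q c,
  [/\ q \in K, c \in 'C_S(K) & g = q * c].
Proof. by move=> gK; have /mulsgP[q c Kq Cc ->] : g \in K * 'C_S(K); [rewrite -join_centE|exists q, c]. Qed.

Lemma sub_join_cent K : K \subset join_cent K.
Proof. exact: joing_subl. Qed.

Lemma cent_sub_join K : 'C_S(K) \subset join_cent K.
Proof. exact: joing_subr. Qed.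

(** An element [q * c] with [c] centralizing K acts on K as [q] does, so its action is transported
    by [f] to that of [fapp f q], and axiom (II) applies. *)
Lemma cent_extension K P (f : M K P) : P = fapp f @: K :> {set gT} ->
  fully_centralized F P ->
  exists e : M (join_cent K) top, {in K, fapp e =1 fapp f}.
Proof.
move=> PE cP; apply: (extension satF PE cP (sub_join_cent K) (join_cent_norm K)).
move=> g /join_cent_memP[q [c [Kq /setIP[Sc Cc] ->]]].
exists (fapp f q); first by rewrite inE fapp_top (subsetP (normG P)) ?fapp_in.
move=> k Kk; rewrite -(fapp_conj _ Kq Kk); congr fapp.
by rewrite invMg !mulgA -[q * c * k]mulgA (centP Cc k Kk) !mulgA mulgK.
Qed.

(** Quasicentricity speaks of fully centralized conjugates, so [al] is first transported along an
    extension to P C_S(P) of an isomorphism onto such a conjugate P'. There its restriction to the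
    image of C_E(P) is a morphism of C_F(P'), hence conjugation by an element [y] of the p-group S,
    and the order of [y] gives the exponent. *)
Lemma pi_power_cent P E (al : M E E) : quasicentric F P -> P \subset E ->
  {in P, fapp al =1 id} ->
  exists k, forall x, x \in 'C_E(P) -> iter (p ^ k) (fapp al) x = x.
Proof.
move=> qP PE al1.
have [PP' /(fully_normalized_centralized satF) cP'] := frepP F P.
set P' := frep F P in PP' cP'.
have [f [f' [f'f ff']]] := Fconj_maps PP'.
have imf : P' = fapp f @: P :> {set gT}.
  apply/setP => y; apply/idP/imsetP => [Py|[x Px ->]]; last exact: fapp_in.
  by exists (fapp f' y); rewrite ?fapp_in ?ff'.
have [e eE] := cent_extension imf cP'.
have CS : 'C_E(P) \subset S by apply: subset_trans (subsetIl _ _) (valP E).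
pose T := mk_subgrp CS.
have TC : T \subset 'C_S(P) by rewrite /= setSI // (valP E).
have TJ : T \subset join_cent P := subset_trans TC (cent_sub_join P).
have TPS : T <*> P \subset S by rewrite join_subG (valP T) (valP P).
pose TP := mk_subgrp TPS.
have TPE : TP = T * P :> {set gT}.
  by rewrite /= cent_joinEl // subsetIr.
have TPJ : TP \subset join_cent P by rewrite /= join_subG sub_join_cent TJ.
have TPsE : TP \subset E by rewrite /= join_subG subsetIl PE.
have alT x : x \in T -> fapp al x \in T.
  case/setIP=> Ex Cx; apply/setIP; split; first exact: fapp_in.
  apply/centP => y Py; rewrite /commute -{1}(al1 y Py) -{2}(al1 y Py).
  have Ey := subsetP PE y Py.
  by rewrite -!fappM // (centP Cx y Py).
have [alTP alTPE] : exists a : M TP TP, {in TP, fapp a =1 fapp al}.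
  apply: frestr => // x; rewrite TPE => /mulsgP[t y Tt Py ->].
  have Et : t \in E by case/setIP: Tt.
  by rewrite fappM ?(subsetP PE y) // (al1 y Py) mem_mulg // alT.
have [T' T'E] := image_subgrp e TJ.
have [TP' TP'E] := image_subgrp e TPJ.
have [e1 e1E] : exists e1 : M TP TP', {in TP, fapp e1 =1 fapp e}.
  by apply: frestr => // x Tx; rewrite TP'E imset_f.
have im1 : TP' = fapp e1 @: TP :> {set gT}.
  by rewrite TP'E; apply: eq_in_imset => x Tx; rewrite e1E.
have [b1 [b1e e1b]] := finv_ex im1.
pose G : M TP' TP' := comp e1 (comp alTP b1).
have TsTP : T \subset TP by exact: joing_subl.
have PsTP : P \subset TP by exact: joing_subr.
have GE x : x \in TP -> fapp G (fapp e x) = fapp e (fapp al x).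
  move=> Tx; rewrite /G !fapp_comp -(e1E _ Tx) b1e // alTPE //.
  by rewrite e1E // -alTPE // fapp_in.
have T'sTP' : T' \subset TP'.
  by rewrite T'E TP'E; apply: imsetS.
have [G0 G0E] : exists g : M T' T', {in T', fapp g =1 fapp G}.
  apply: frestr => // y; rewrite T'E => /imsetP[x Tx ->].
  by rewrite GE ?(subsetP TsTP) // imset_f // alT.
have T'C : T' \subset 'C_S(P').
  apply/subsetP => y; rewrite T'E => /imsetP[x Tx ->]; rewrite inE fapp_top /=.
  apply/centP => z; rewrite imf => /imsetP[w Pw ->]; rewrite -eE // /commute.
  have Jw := subsetP (sub_join_cent P) w Pw; have Jx := subsetP TJ x Tx.
  rewrite -!fappM //; congr fapp.
  by have /setIP[_ /centP/(_ w Pw)] := subsetP TC x Tx.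
have TP'M : TP' = T' * P' :> {set gT}.
  rewrite TP'E T'E imf; apply/setP => y; apply/imsetP/mulsgP.
    case=> x; rewrite TPE => /mulsgP[t w Tt Pw ->] ->.
    exists (fapp e t) (fapp f w); rewrite ?imset_f //.
    have Jt := subsetP TJ t Tt; have Jw := subsetP (sub_join_cent P) w Pw.
    by rewrite fappM // (eE w).
  case=> _ _ /imsetP[t Tt ->] /imsetP[w Pw ->] ->; exists (t * w).
    by rewrite TPE mem_mulg.
  have Jt := subsetP TJ t Tt; have Jw := subsetP (sub_join_cent P) w Pw.
  by rewrite fappM // (eE w).
have : sval G0 \in centralizer_hom F P' T' T'.
  rewrite inE (svalP G0); apply/asboolP; exists TP', TP', G; split=> //.
    by move=> x; rewrite -G0E ?subgP // fappE.
  move=> y; rewrite imf => /imsetP[x Px ->]; rewrite -eE // GE ?(subsetP PsTP) //.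
  by rewrite al1.
rewrite (qP P' PP' cP' T' T' T'C T'C) inE => /existsP[y /andP[Cy /forallP yE]].
have step x : x \in T -> fapp e (fapp al x) = y * fapp e x * y^-1.
  move=> Tx; have T'x : fapp e x \in T' by rewrite T'E imset_f.
  rewrite -GE ?(subsetP TsTP) // -G0E //.
  by have /eqP := yE (subg T' (fapp e x)); rewrite -fappE subgK.
have iterT n x : x \in T -> iter n (fapp al) x \in T.
  by move=> Tx; elim: n => // n IH; rewrite iterS alT.
have iterE n x : x \in T -> fapp e (iter n (fapp al) x) = y ^+ n * fapp e x * y ^- n.
  move=> Tx; elim: n => [|n IH]; first by rewrite expg0 invg1 mulg1 mul1g.
  by rewrite iterS step ?iterT // IH expgS invMg !mulgA.
have /setIP[Sy _] := Cy.
have [k yk] := p_natP (mem_p_elt pS Sy).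
exists k => x Tx; apply: (fapp_inj (f := e)); rewrite ?(subsetP TJ) ?iterT //.
by rewrite iterE // -yk expg_order invg1 mulg1 mul1g.
Qed.

End Quasicentric.

(** * Overgroups of quasicentric subgroups *)

Section Overgroups.
Variables (gT : finGroupType) (S : {group gT}) (F : fusion_system S) (p : nat).
Implicit Types P Q T E K : subgrp S.
Local Notation M := (Mor (fusion_cat F)).
Local Notation top := (top_subgrp S).
Hypothesis satF : saturated F p.
Hypothesis pS : p.-group S.

Definition pointwise_stab E Q : {set {perm [subg E]}} :=
  [set a in AutF F E | [forall x : [subg E], (sgval x \in Q) ==> (a x == x)]].

Lemma pointwise_stabP E Q (a : {perm [subg E]}) :
  reflect (a \in AutF F E /\ forall x : [subg E], sgval x \in Q -> a x = x)
          (a \in pointwise_stab E Q).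
Proof.
rewrite /pointwise_stab; apply: (iffP setIdP) => -[Aa h]; split=> //.
  by move=> x Qx; have /forallP/(_ x)/implyP/(_ Qx)/eqP := h.
by apply/forallP => x; apply/implyP => Qx; rewrite h.
Qed.

Lemma pointwise_stab_group_set E Q : group_set (pointwise_stab E Q).
Proof.
apply/group_setP; split.
  by apply/pointwise_stabP; split=> [|x _]; [exact: (group1 (AutF_group F E))|rewrite perm1].
move=> a b /pointwise_stabP[Aa fa] /pointwise_stabP[Ab fb]; apply/pointwise_stabP.
split; first exact: (@groupM _ (AutF_group F E)).
by move=> x Qx; rewrite permM fa // fb.
Qed.

Definition pointwise_stab_group E Q := Group (pointwise_stab_group_set E Q).

(** By Cauchy it suffices to treat an element of prime order r. As E lies in Q C_S(Q), every element
    of E is a product of one fixed by it and one in C_E(P), on which a p-power of it is trivial by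
    [pi_power_cent]. So r divides a power of p. *)
Lemma pointwise_stab_pgroup P Q E : quasicentric F P -> P \subset Q -> Q \subset E ->
  E \subset join_cent Q -> p.-group (pointwise_stab_group E Q).
Proof.
move=> qP PQ QE EJ; apply/pgroupP => r prr /(Cauchy prr)[a /pointwise_stabP[Aa fa] oa].
have [al alE] := aut_mor Aa.
have al1 x : x \in Q -> fapp al x = x.
  move=> Qx; have Ex := subsetP QE x Qx.
  by have := alE (subg E x); rewrite fa subgK.
have [|k kE] := pi_power_cent satF pS qP (subset_trans PQ QE) (al := al).
  by move=> x Px; apply: al1; apply: (subsetP PQ).
have iterE n x : x \in E -> iter n (fapp al) x = sgval ((a ^+ n) (subg E x)).
  move=> Ex; elim: n => [|n IH]; first by rewrite expg0 perm1 subgK.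
  by rewrite iterS IH alE expgSr permM.
have ak : a ^+ (p ^ k) = 1.
  apply/permP => x; apply/val_inj; rewrite perm1 /=.
  have := iterE (p ^ k)%N (sgval x) (subgP x); rewrite sgvalK => <-.
  have [q [c [Qq Cc xE]]] := join_cent_memP (subsetP EJ _ (subgP x)).
  have Eq := subsetP QE q Qq.
  have Ec : c \in E by rewrite -(groupMl _ Eq) -xE subgP.
  have iterM n y z : y \in E -> z \in E ->
      iter n (fapp al) (y * z) = iter n (fapp al) y * iter n (fapp al) z.
    move=> Ey Ez; elim: n => // n IH; rewrite !iterS IH fappM //.
      by case: n {IH} => [//|n]; rewrite iterS fapp_in.
    by case: n {IH} => [//|n]; rewrite iterS fapp_in.
  rewrite xE iterM // (kE c); last first.
    have /setIP[_ CQc] := Cc; apply/setIP; split; first exact: Ec.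
    by apply: (subsetP (centS PQ)).
  by congr (_ * _); elim: (p ^ k)%N => // n IH; rewrite iterS IH al1.
have : r %| p ^ k by rewrite -oa order_dvdn ak.
have [k0|k0] := posnP k; first by rewrite k0 expn0 dvdn1 => /eqP r1; rewrite r1 in prr.
rewrite Euclid_dvdX // => /andP[rp _].
(* Primality of [p] is read off from a nontrivial S; for trivial S, E has no automorphism of prime
   order. *)
have [S1|pp] := eqVneq (S : {set gT}) 1%g.
  have E1 : E = 1%g :> {set gT} by apply/trivgP; rewrite -S1 (valP E).
  have : a = 1.
    by apply/permP => x; apply/val_inj; rewrite perm1 /=; have := subgP (a x); have := subgP x;
      rewrite E1 => /set1P -> /set1P ->.
  by move=> a1; move: oa; rewrite a1 order1 => r1; rewrite -r1 in prr.
have [prp _ _] := pgroup_pdiv pS pp.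
by rewrite !inE -(dvdn_prime2 prr prp).
Qed.

Let measure_step (j a b m : nat) : (a < b)%N -> (b <= j)%N -> (j - a < m.+1)%N -> (j - b < m)%N.
Proof. by lia. Qed.

Section MainClaim.
Variables (P Q : subgrp S).
Hypothesis qP : quasicentric F P.
Hypothesis PQ : P \subset Q.
Hypothesis cQ : fully_centralized F Q.

Lemma centralizing_image E E1 (f : M E E1) x : Q \subset E -> E \subset join_cent Q ->
  {in Q, fapp f =1 id} -> x \in E -> fapp f x \in join_cent Q.
Proof.
move=> QE EJ f1 Ex; have [q [c [Qq Cc xE]]] := join_cent_memP (subsetP EJ x Ex).
have Eq := subsetP QE q Qq.
have Ec : c \in E by rewrite -(groupMl _ Eq) -xE.
rewrite xE fappM // (f1 q Qq); apply: groupM; first exact: (subsetP (sub_join_cent Q)).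
apply: (subsetP (cent_sub_join Q)); rewrite inE fapp_top /=; apply/centP => y Qy.
have Ey := subsetP QE y Qy.
rewrite /commute -{1}(f1 y Qy) -{2}(f1 y Qy) -!fappM //; congr fapp.
by have /setIP[_ /centP/(_ y Qy)] := Cc.
Qed.

(* Downward induction on E. After conjugation to a fully normalized E', all
   automorphisms of E' fixing the image of Q act as elements of S: they form a
   p-group by pi_power_cent. So f extends to a normalizer unless E = Q C_S(Q). *)
Theorem centralizing_is_conj E (f : M E top) : Q \subset E -> E \subset join_cent Q ->
  {in Q, fapp f =1 id} ->
  exists2 y, y \in 'C_S(Q) & forall x, x \in E -> fapp f x = y * x * y^-1.
Proof.
have [n] := ubnP (#|join_cent Q| - #|E|); elim: n E f => // n IH E f nE QE EJ f1.
have [EE' nE'] := frepP F E; set E' := frep F E in EE' nE'.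
have cE' := fully_normalized_centralized satF nE'.
have [f0 [g0 [g0f0 f0g0]]] := Fconj_maps EE'.
have [Q0 Q0E] := image_subgrp f0 QE.
have PE := subset_trans PQ QE.
have [P0 P0E] := image_subgrp f0 PE.
have pB : p.-group (pointwise_stab_group E' Q0).
  apply: (@pointwise_stab_pgroup P0).
  - exact: quasicentric_Fconj (Fconj_image PE P0E) qP.
  - by rewrite P0E Q0E imsetS.
  - by apply/subsetP => yy; rewrite Q0E => /imsetP[x _ ->]; apply: fapp_in.
  - apply/subsetP => z E'z; rewrite -(f0g0 z E'z).
    have := fapp_in g0 z; set x := fapp g0 z => Ex.
    have [q [c [Qq /setIP[Sc Cc] xE]]] := join_cent_memP (subsetP EJ x Ex).
    have Eq := subsetP QE q Qq.
    have Ec : c \in E by rewrite -(groupMl _ Eq) -xE.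
    rewrite xE fappM //; apply: groupM.
      by apply: (subsetP (sub_join_cent Q0)); rewrite Q0E imset_f.
    apply: (subsetP (cent_sub_join Q0)); rewrite inE fapp_top /=; apply/centP.
    move=> yy; rewrite Q0E => /imsetP[w Qw ->]; have Ew := subsetP QE w Qw.
    by rewrite /commute -!fappM // (centP Cc w Qw).
have sB : pointwise_stab_group E' Q0 \subset AutF F E'.
  by apply/subsetP => b /pointwise_stabP[].
have [a Aa aE] := AutS_absorb satF nE' sB pB.
have [al alE] := aut_mor Aa.
pose phi := comp al f0.
have imphi : E' = fapp phi @: E :> {set gT}.
  apply/eqP; rewrite eq_sym eqEcard card_fapp // (Fconj_card EE') leqnn andbT.
  by apply/subsetP => _ /imsetP[x _ ->]; apply: fapp_in.
have [psi [psiphi phipsi]] := finv_ex imphi.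
have star (be : M E' E') : {in Q, forall x, fapp be (fapp phi x) = fapp phi x} ->
    exists2 h, h \in 'N_S(E') & forall z, z \in E' -> fapp be z = h * z * h^-1.
  move=> beQ; have [b Ab bE] := mor_aut be.
  have /aE : b ^ a^-1 \in pointwise_stab_group E' Q0.
    apply/pointwise_stabP; split; first by rewrite (@groupJ _ (AutF_group F E')) // groupV.
    move=> x; rewrite Q0E => /imsetP[w Qw xE]; have Ew := subsetP QE w Qw.
    rewrite conjgE invgK !permM; have -> : b (a x) = a x; last by rewrite permK.
    by apply/val_inj; rewrite /= bE -alE xE -[fapp al (fapp f0 w)]fapp_comp beQ.
  rewrite -conjgM mulVg conjg1 => /AutSP[h Nh hE]; exists h^-1; rewrite ?groupV //.
  move=> z Ez; have := hE (subg E' z); rewrite bE subgK // => ->.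
  by rewrite conjgE invgK mulgA.
clearbody phi.
have [Q' Q'E] := image_subgrp phi QE.
have QQ' : Fconj F Q Q' := Fconj_image QE Q'E.
have [chi0 chi0E] : exists c : M Q' Q, {in Q, forall x, fapp c (fapp phi x) = x}.
  have Q'sE' : Q' \subset E'.
    by apply/subsetP => yy; rewrite Q'E => /imsetP[x _ ->]; apply: fapp_in.
  have [|c cE] := frestr (f := psi) (P0 := Q') (Q0 := Q) Q'sE'.
    by move=> yy; rewrite Q'E => /imsetP[x Qx ->]; rewrite psiphi // (subsetP QE).
  exists c => x Qx; rewrite cE ?psiphi // ?(subsetP QE) //.
  by rewrite Q'E imset_f.
have imchi0 : Q = fapp chi0 @: Q' :> {set gT}.
  apply/setP => x; apply/idP/imsetP => [Qx|[y _ ->]]; last exact: fapp_in.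
  by exists (fapp phi x); rewrite ?chi0E // Q'E imset_f.
(* [chi] brings the image of Q back to Q, so that an extension of [phi] followed by [chi] fixes Q
   and falls under the induction hypothesis. *)
have [chi chiE] := cent_extension satF imchi0 cQ.
have chiphi x : x \in Q -> fapp chi (fapp phi x) = x.
  by move=> Qx; rewrite chiE ?chi0E // Q'E imset_f.
(* This will be used for [h] the identity of E and for [h] the inverse of [f]: in the comparison of
   the two results the unknown map [chi phi] cancels. *)
have key E1 (h : M E1 E) : Q \subset E1 -> E = fapp h @: E1 :> {set gT} ->
    E1 \proper join_cent Q -> {in Q, fapp h =1 id} ->
    exists2 y, y \in 'C_S(Q) & forall x, x \in E1 ->
      fapp chi (fapp phi (fapp h x)) = y * x * y^-1.
  move=> QE1 imh prE1 h1.
  have NS : 'N_(join_cent Q)(E1) \subset S by apply: subset_trans (subsetIl _ _) (valP (join_cent Q)).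
  pose N1 := mk_subgrp NS.
  have pN : E1 \proper N1.
    apply: nilpotent_proper_norm prE1; apply: (pgroup_nil (p := p)).
    exact: pgroupS (valP (join_cent Q)) pS.
  have E1N1 := proper_sub pN.
  have im1 : E' = fapp (comp phi h) @: E1 :> {set gT}.
    rewrite imphi imh -imset_comp; apply: eq_in_imset => x Ex.
    by rewrite [RHS]fapp_comp.
  have [b [b1 b2]] := finv_ex im1.
  have [||w wE] := extension satF im1 cE' E1N1.
  - by rewrite /= setSI // (valP (join_cent Q)).
  - move=> g /setIP[Jg Ng]; have [q [c [Qq Cc gE]]] := join_cent_memP Jg.
    have Eq := subsetP QE1 q Qq.
    have Nq : q \in 'N(E1) by apply: (subsetP (normG E1)).
    have Nc : c \in 'N(E1) by rewrite -(groupMl _ Nq) -gE.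
    have /setIP[Sc CQc] := Cc.
    have [cc ccE] := @fconj_ex _ _ F E1 E1 c Sc (fun k Ek => mem_conjV Nc Ek).
    (* Only the factor [c] requires [star], which applies since [c] centralizes Q; conjugation by
       [q] is transported by the morphism itself. *)
    have [x Qx|h0 Nh0 h0E] := star (comp (comp phi h) (comp cc b)).
      rewrite !fapp_comp -{1}(h1 x Qx) -[fapp phi (fapp h x)]fapp_comp b1 ?(subsetP QE1) //.
      rewrite ccE ?(subsetP QE1) // (centP CQc x Qx) mulgK.
      by rewrite h1.
    exists (fapp (comp phi h) q * h0).
      by rewrite groupMl // inE fapp_top (subsetP (normG E')) ?fapp_in.
    move=> k Ek; have := h0E _ (fapp_in (comp phi h) k).
    rewrite fapp_comp [fapp (comp cc b) _]fapp_comp b1 // ccE // => e.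
    rewrite gE invMg -!mulgA [c * (k * _)]mulgA [c * k * _]mulgA [q * (_ * _)]mulgA.
    rewrite (fapp_conj _ Eq (mem_conjV Nc Ek)) e invMg.
    by rewrite !mulgA.
  have wQ x : x \in Q -> fapp w x = fapp phi x.
    by move=> Qx; rewrite wE ?(subsetP QE1) // fapp_comp h1.
  have [w' w'E] : exists w' : M N1 (join_cent Q'), {in N1, fapp w' =1 fapp w}.
    apply: frestr => // g Ng; have /setIP[Jg _] := Ng.
    have [q [c [Qq Cc gE]]] := join_cent_memP Jg.
    have Nq : q \in N1 := subsetP (subset_trans QE1 E1N1) q Qq.
    have Nc : c \in N1 by rewrite -(groupMl _ Nq) -gE.
    rewrite gE fappM //; apply: groupM.
      by apply: (subsetP (sub_join_cent Q')); rewrite wQ // Q'E imset_f.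
    apply: (subsetP (cent_sub_join Q')); rewrite inE fapp_top /=; apply/centP.
    move=> yy; rewrite Q'E => /imsetP[x Qx ->]; rewrite -wQ //.
    have Nx : x \in N1 := subsetP (subset_trans QE1 E1N1) x Qx.
    by have /setIP[_ /centP/(_ x Qx) cx] := Cc; rewrite /commute -!fappM // cx.
  have [|||x Qx|y Cy yE] := IH N1 (comp chi w').
  - have cE1 : #|E1| = #|E| by rewrite imh card_fapp.
    have := proper_card pN; have := proper_card prE1; rewrite cE1.
    have : (#|N1| <= #|join_cent Q|)%N by apply: subset_leq_card; apply: subsetIl.
    by move=> e1 e2 e3; apply: measure_step e3 e1 nE.
  - exact: subset_trans QE1 E1N1.
  - exact: subsetIl.
  - have Nx : x \in N1 := subsetP (subset_trans QE1 E1N1) x Qx.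
    by rewrite fapp_comp w'E // wQ // chiphi.
  exists y => // x Ex; have Nx := subsetP E1N1 x Ex.
  by rewrite -yE // fapp_comp w'E // wE // fapp_comp.
have fJ x : x \in E -> fapp f x \in join_cent Q by apply: centralizing_image.
have [EqJ|prE] := eqVproper EJ.
  (* When E is all of Q C_S(Q), [f] is an automorphism of E. Transported to E' it is conjugation by
     some [s] in C_S(Q'), and a comparison of orders, with Q fully centralized, shows that [s] comes
     from C_S(Q). *)
  have [fr frE] : exists fr : M E E, {in E, fapp fr =1 fapp f}.
    by apply: frestr => // x Ex; rewrite EqJ fJ.
  have [x Qx|s Ns sE] := star (comp phi (comp fr psi)).
    have Ex := subsetP QE x Qx.
    by rewrite !fapp_comp psiphi // frE // f1.
  have CE : 'C_S(Q) \subset E by rewrite EqJ cent_sub_join.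
  have imC : fapp phi @: 'C_S(Q) = 'C_S(Q').
    apply/eqP; rewrite eqEcard card_fapp // (cQ QQ') andbT.
    apply/subsetP => _ /imsetP[c /setIP[Sc Cc] ->]; rewrite inE fapp_top /=.
    apply/centP => yy; rewrite Q'E => /imsetP[x Qx ->].
    have Ex := subsetP QE x Qx; have Ec : c \in E by apply: (subsetP CE); rewrite inE Sc.
    by rewrite /commute -!fappM // (centP Cc x Qx).
  have Cs : s \in 'C_S(Q').
    have /setIP[Ss _] := Ns; rewrite inE Ss; apply/centP => yy; rewrite Q'E => /imsetP[x Qx ->].
    have Ex := subsetP QE x Qx.
    have := sE _ (fapp_in phi x); rewrite !fapp_comp psiphi // frE // f1 // => e.
    by rewrite /commute {2}e mulgKV.
  have [c Cc cE] : exists2 c, c \in 'C_S(Q) & s = fapp phi c.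
    by apply/imsetP; rewrite imC.
  exists c => // x Ex; have Ec := subsetP CE c Cc.
  have := sE _ (fapp_in phi x).
  rewrite fapp_comp [fapp (comp fr psi) _]fapp_comp psiphi // cE -fapp_conj //.
  by move/(fapp_inj (fapp_in fr x)) => <-; rewrite ?frE // !groupM ?groupV.
have [||y0 Cy0 y0E] := key E (idm (fusion_cat F) E) QE _ prE.
- apply/setP => x; apply/idP/imsetP => [Ex|[y Ey ->]]; last by rewrite fapp_id.
  by exists x; rewrite ?fapp_id.
- by move=> x Qx; rewrite fapp_id // (subsetP QE).
have [T TE] := image_subgrp f (subxx E).
have [b [bf fb]] := finv_ex TE.
have QT : Q \subset T.
  by apply/subsetP => x Qx; rewrite TE; apply/imsetP; exists x; rewrite ?f1 // (subsetP QE).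
have TJ : T \subset join_cent Q.
  by apply/subsetP => yy; rewrite TE => /imsetP[x Ex ->]; apply: fJ.
have [|||y1 Cy1 y1E] := key T b QT.
- apply/setP => x; apply/idP/imsetP => [Ex|[y Ty ->]]; last exact: fapp_in.
  by exists (fapp f x); rewrite ?bf // TE imset_f.
- rewrite properEcard TJ TE card_fapp //; exact: proper_card.
- by move=> x Qx; rewrite -{1}(f1 x Qx) bf // (subsetP QE).
exists (y1^-1 * y0); first by rewrite groupM ?groupV.
move=> x Ex; have Tx : fapp f x \in T by rewrite TE imset_f.
have := y1E _ Tx; rewrite bf // -[in LHS](fapp_id F Ex) y0E // => e.
apply: (mulgI y1); apply: (mulIg y1^-1).
by rewrite -e invMg invgK !mulgA mulgV mul1g mulgK.
Qed.

End MainClaim.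

(** A morphism of C_F(Q1) out of T1 extends to T1 Q1 and fixes Q1. As T1 Q1 lies between Q1 and Q1
    C_S(Q1), [centralizing_is_conj] applies, with the image of P as the quasicentric subgroup. *)
Theorem quasicentric_overgroup P Q : quasicentric F P -> P \subset Q -> quasicentric F Q.
Proof.
move=> qP PQ Q1 QQ1 cQ1 T1 T2 T1C T2C.
have [f [g [gf fg]]] := Fconj_maps QQ1.
have [P1 P1E] := image_subgrp f PQ.
have qP1 := quasicentric_Fconj (Fconj_image PQ P1E) qP.
have P1Q1 : P1 \subset Q1.
  by apply/subsetP => yy; rewrite P1E => /imsetP[x _ ->]; apply: fapp_in.
have prodE (T : subgrp S) : T \subset 'C_S(Q1) -> exists E : subgrp S,
    E = T * Q1 :> {set gT} /\ E \subset join_cent Q1.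
  move=> TC; have TS : T <*> Q1 \subset S by rewrite join_subG (valP T) (valP Q1).
  exists (mk_subgrp TS); split.
    by rewrite /= cent_joinEl // (subset_trans TC) // subsetIr.
  by rewrite /= join_subG sub_join_cent (subset_trans TC) // cent_sub_join.
apply/setP => u; rewrite [LHS]inE [RHS]inE; apply/andP/existsP.
  case=> Fu /asboolP[E1 [E2 [h [E1E E2E hu h1]]]].
  have [i iE] := @fincl_ex _ _ F E2 top (valP E2).
  have [E0 [E0E E0J]] := prodE T1 T1C.
  have e0 : E0 = E1 by apply: subgrp_inj; rewrite E0E.
  rewrite e0 in E0J.
  have Q1E1 : Q1 \subset E1 by rewrite E1E mulG_subr.
  have [x Qx|y Cy yE] := centralizing_is_conj qP1 P1Q1 cQ1 (f := comp i h) Q1E1 E0J.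
    by rewrite fapp_comp iE ?fapp_in // h1.
  exists y; rewrite Cy; apply/forallP => x.
  have E1x : sgval x \in E1.
    by rewrite -[_ \in _]/(_ \in gval E1) E1E -[sgval x]mulg1 mem_mulg ?subgP.
  by rewrite -hu -yE // fapp_comp iE ?fapp_in.
case=> y /andP[Cy /forallP yE]; have /setIP[Sy CQy] := Cy; split.
  apply: (subsetP (fhom_conj F T1 T2)); rewrite inE; apply/existsP; exists y.
  by rewrite Sy; apply/forallP.
apply/asboolP.
have [E1 [E1E _]] := prodE T1 T1C; have [E2 [E2E _]] := prodE T2 T2C.
have conjT t : t \in T1 -> y * t * y^-1 = sgval (u (subg T1 t)).
  by move=> Tt; have /eqP -> := yE (subg T1 t); rewrite subgK.
have [g0|h hE] := @fconj_ex _ _ F E1 E2 y Sy.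
  rewrite -[_ \in E1]/(_ \in gval E1) E1E => /mulsgP[t q Tt Qq ->].
  rewrite -[_ \in _]/(_ \in gval E2) E2E -mulgA -[t * q * _]mulgA.
  rewrite -(centP (groupVr CQy) q Qq) !mulgA conjT //.
  by rewrite mem_mulg // subgP.
exists E1, E2, h; split=> // [x|q Qq].
  rewrite hE; last first.
    by rewrite -[_ \in _]/(_ \in gval E1) E1E -[sgval x]mulg1 mem_mulg ?subgP.
  by have /eqP -> := yE x.
rewrite hE; last by rewrite -[_ \in _]/(_ \in gval E1) E1E -[q]mul1g mem_mulg.
by rewrite (centP CQy q Qq) mulgK.
Qed.

End Overgroups.

(** * Elements acting through O_p *)

Section Hat.
Variables (gT : finGroupType) (S : {group gT}) (F : fusion_system S) (p : nat).
Implicit Types P Q T E K : subgrp S.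
Local Notation M := (Mor (fusion_cat F)).
Hypothesis satF : saturated F p.
Hypothesis pS : p.-group S.

Variable P : subgrp S.
Hypothesis nP : fully_normalized F P.

Let id1 : {in P, forall y, fapp (idm (fusion_cat F) P) (fapp (idm (fusion_cat F) P) y) = y}.
Proof. by move=> y Py; rewrite !fapp_id. Qed.

Let r := tract_morphism id1 id1.

Let sgval_perm (a b : {perm [subg P]}) : (forall x, sgval (a x) = sgval (b x)) -> a = b.
Proof. by move=> ab; apply/permP => x; apply/val_inj/ab. Qed.

Let rE u (x : [subg P]) : u \in 'N_S(P) -> sgval (r u x) = sgval x ^ u.
Proof.
move=> Nu; rewrite /= (tractE id1) // !fapp_id ?subgP //.
by rewrite memJ_norm ?subgP //; case/setIP: Nu.
Qed.

Let AutS_r : AutS P = r @* 'N_S(P).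
Proof. 
by rewrite -(tract_AutS F P) /r; congr (morphim (MorPhantom (mfun (tract_morphism _ _))) _); apply: Prop_irrelevance. Qed.

Let sPN : P \subset 'N_S(P).
Proof. by rewrite subsetI (valP P) normG. Qed.

Definition hat_group := [group of r @*^-1 'O_p(AutF_group F P)].

Lemma hat_norm : hat_group \subset 'N_S(P).
Proof. exact: subsetIl. Qed.

Let hat_sub : hat_group \subset S.
Proof. exact: subset_trans hat_norm (subsetIl _ _). Qed.

Definition hat : subgrp S := mk_subgrp hat_sub.

Let mem_hat g : g \in 'N_S(P) -> (g \in hat) = (r g \in 'O_p(AutF_group F P)).
Proof. by move=> Ng; apply/idP/idP => [/morphpreP[]|Og] //; apply/morphpreP. Qed.

Let InnE : Inn P = r @* P.
Proof.
apply/setP => a; rewrite inE inE; apply/existsP/morphimP.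
  case=> x /andP[Px /forallP xE]; have Nx := subsetP sPN _ (groupVr Px).
  exists x^-1 => //; first by rewrite groupV.
  apply: sgval_perm => y; rewrite rE //.
  by have /eqP := xE y; rewrite ffunE => ->; rewrite conjgE invgK mulgA.
case=> u Nu Pu ->; exists u^-1; rewrite groupV Pu; apply/forallP => x.
by rewrite ffunE rE // conjgE invgK mulgA.
Qed.

Let Inn_normal : r @* P <| AutF_group F P.
Proof.
rewrite /normal (subset_trans (morphimS _ sPN)) ?tract_sub //=.
apply/subsetP => a Aa; rewrite inE; apply/subsetP => _ /imsetP[_ /morphimP[u Nu Pu ->] ->].
apply/morphimP; have Nau : sgval (a (subg P u)) \in 'N_S(P) by apply: (subsetP sPN); apply: subgP.
exists (sgval (a (subg P u))) => //; first exact: subgP.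
have [f fE] := aut_mor Aa.
apply: sgval_perm => x; rewrite -(permKV a x) permJ; set y := a^-1 x.
rewrite [RHS]rE // -!fE rE // !conjgE subgK //.
by rewrite !fappM ?fappV ?groupM ?groupV ?subgP // -conjgE.
Qed.

Lemma sub_hat : P \subset hat.
Proof.
apply/subsetP => x Px; have Nx := subsetP sPN x Px; rewrite mem_hat //.
have sI : r @* P \subset 'O_p(AutF_group F P).
  apply: pcore_max Inn_normal; apply: morphim_pgroup.
  exact: pgroupS (valP P) pS.
by apply: (subsetP sI); apply: mem_morphim.
Qed.

Lemma hat_acts g h : g \in 'N_S(P) -> h \in hat ->
  (forall x, x \in P -> g * x * g^-1 = h * x * h^-1) -> g \in hat.
Proof.
move=> Ng Hh gh; have Nh := subsetP hat_norm _ Hh.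
rewrite -groupV mem_hat ?groupV // (_ : r g^-1 = r h^-1) -?mem_hat ?groupV //.
apply: sgval_perm => x; rewrite !rE ?groupV //.
by have := gh _ (subgP x); rewrite !conjgE !invgK !mulgA.
Qed.

(** O_p(Aut_F(P)) is normal in Aut_F(P) and contained in Aut_S(P), so conjugating the action of [g]
    by [f] gives again the action of an element of H. *)
Lemma hat_conj (f : M P P) g : g \in hat -> exists2 g', g' \in hat &
  forall x, x \in P -> fapp f (g * x * g^-1) = g' * fapp f x * g'^-1.
Proof.
move=> Hg; have Ng := subsetP hat_norm _ Hg.
have [a Aa aE] := mor_aut f.
have Og : r g^-1 \in 'O_p(AutF_group F P) by rewrite -mem_hat ?groupV.
have Oga : r g^-1 ^ a \in 'O_p(AutF_group F P).
  by rewrite memJ_norm //; apply: (subsetP (gFnorm _ _)).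
have := subsetP (AutS_sub_pcore satF nP) _ Oga; rewrite AutS_r => /morphimP[u Nu _ uE].
exists u^-1; first by rewrite groupV mem_hat // -uE.
move=> x Px; have Ngx : g * x * g^-1 \in P.
  by apply: mem_conjV => //; case/setIP: Ng.
have := congr1 (fun b : {perm [subg P]} => sgval (b (a (subg P x)))) uE.
rewrite rE // aE subgK // permJ aE rE ?groupV // subgK // !conjgE !invgK !mulgA => ->.
by [].
Qed.

(** If H = P, then O_p(Aut_F(P)) = Inn(P), which makes P radical, and C_S(P), being contained in H,
    is Z(P). Orders transfer the last equality to the conjugates of P, because P is fully
    centralized. *)
Lemma hat_proper : ~ (radical F p P /\ centric F P) -> P \proper hat.
Proof.
move=> nrc; rewrite properE sub_hat /=; apply/negP => HP; apply: nrc.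
have cP := fully_normalized_centralized satF nP.
split.
  have OI : 'O_p(AutF_group F P) = r @* P.
    apply/eqP; rewrite eqEsubset; apply/andP; split.
      apply/subsetP => a Oa.
      have := subsetP (AutS_sub_pcore satF nP) _ Oa; rewrite AutS_r => /morphimP[u Nu _ uE].
      rewrite uE; apply: mem_morphim => //; apply: (subsetP HP).
      by rewrite mem_hat // -uE.
    apply: pcore_max Inn_normal; apply: morphim_pgroup.
    exact: pgroupS (valP P) pS.
  rewrite /radical InnE.
  have pI : p.-group (r @* P) by apply: morphim_pgroup; apply: pgroupS (valP P) pS.
  by have := pquotient_pcore Inn_normal pI; rewrite OI trivg_quotient.
have CP : 'C_S(P) \subset 'Z(P).
  apply/subsetP => c /setIP[Sc Cc]; rewrite inE Cc andbT; apply: (subsetP HP).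
  apply: (@hat_acts c 1) => [||x Px]; rewrite ?group1 //.
    by rewrite inE Sc (subsetP (cent_sub _)).
  by rewrite (centP Cc x Px) mulgK mul1g invg1 mulg1.
move=> Q PQ; apply/eqP; rewrite eq_sym eqEcard setSI ?(valP Q) //=.
apply: leq_trans (cP Q PQ) _; apply: leq_trans (subset_leq_card CP) _.
have [f [g [gf fg]]] := Fconj_maps PQ.
rewrite -(card_fapp f (subsetIl P 'C(P))); apply: subset_leq_card.
apply/subsetP => _ /imsetP[z /setIP[Pz Cz] ->]; rewrite inE fapp_in /=.
apply/centP => y Qy; rewrite /commute -(fg y Qy) -!fappM ?fapp_in //.
by rewrite (centP Cz) ?fapp_in.
Qed.

End Hat.

(** * Linking systems *)

Section Linking.
Variables (gT : finGroupType) (S : {group gT}) (F : fusion_system S) (p : nat).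
Local Notation M := (Mor (fusion_cat F)).
Hypothesis satF : saturated F p.
Hypothesis pS : p.-group S.
Variable Lq : quasicentric_linking_system F.
Implicit Types X Y Z T : quasicentric_obj F.
Local Notation fc X := (fully_centralized F (sval X)).

Definition pf X Y (f : Mor Lq X Y) : M (sval X) (sval Y) := fmap (qproj Lq) f.

Definition lact X Y (f : Mor Lq X Y) : gT -> gT := fapp (pf f).

Lemma pf_comp X Y Z (g : Mor Lq Y Z) (f : Mor Lq X Y) :
  pf (comp g f) = comp (pf g) (pf f).
Proof. by rewrite /pf fmap_comp. Qed.

Lemma pf_id X : pf (idm Lq X) = idm (fusion_cat F) (sval X).
Proof. by rewrite /pf fmap_id. Qed.

Lemma pf_surj X Y (u : M (sval X) (sval Y)) : exists f : Mor Lq X Y, pf f = u.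
Proof. exact: qproj_surj. Qed.

Lemma lact_comp X Y Z (g : Mor Lq Y Z) (f : Mor Lq X Y) x :
  lact (comp g f) x = lact g (lact f x).
Proof. by rewrite /lact pf_comp fapp_comp. Qed.

Lemma lact_in X Y (f : Mor Lq X Y) x : lact f x \in sval Y.
Proof. exact: fapp_in. Qed.

Lemma lact_inj X Y (f : Mor Lq X Y) : {in sval X &, injective (lact f)}.
Proof. exact: fapp_inj. Qed.

Lemma delta1 X : qdelta Lq X 1 = idm Lq X.
Proof.
have X1 : 1 \in sval X * 'C_S(sval X) by rewrite -[1]mulg1 mem_mulg.
have [d [d1 d2]] := qdelta_aut Lq X1.
by rewrite -d1 -[in RHS](mulg1 1) qdelta_mul // comp_assoc d1 comp_idl.
Qed.

Lemma cent_mem X z : z \in 'C_S(sval X) -> z \in sval X * 'C_S(sval X).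
Proof. by move=> Cz; rewrite -[z]mul1g mem_mulg. Qed.

Lemma self_mem X z : z \in sval X -> z \in sval X * 'C_S(sval X).
Proof. by move=> Cz; rewrite -[z]mulg1 mem_mulg. Qed.

Lemma orbit_lift X Y (f g : Mor Lq X Y) : fc X -> pf f = pf g ->
  exists2 z, z \in 'C_S(sval X) & g = comp f (qdelta Lq X z).
Proof. by move=> cX fg; have /(_ fg) := (qproj_orbit f g cX).1. Qed.

(** Morphisms of F are injective, so [u] and [u'] agree in F and differ by an element of C_S(X),
    which freeness forces to be 1. *)
Lemma link_mono X Y Z (c : Mor Lq Y Z) (u u' : Mor Lq X Y) : fc X ->
  comp c u = comp c u' -> u = u'.
Proof.
move=> cX cu; have [|z Cz u'E] := orbit_lift (f := u) (g := u') cX.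
  apply: fmor_eq => x Xx; apply: (fapp_inj (f := pf c)); rewrite ?fapp_in //.
  by rewrite -!fapp_comp -!pf_comp cu.
move: cu; rewrite u'E comp_assoc => /esym/(qfree cX Cz) ->.
by rewrite delta1 comp_idr.
Qed.

Lemma delta_free X Y (f : Mor Lq X Y) z z' : fc X ->
  z \in 'C_S(sval X) -> z' \in 'C_S(sval X) ->
  comp f (qdelta Lq X z) = comp f (qdelta Lq X z') -> z = z'.
Proof.
move=> cX Cz Cz' /(link_mono cX); apply: qdelta_inj; exact: cent_mem.
Qed.

(** The factorization is immediate in F; a lift of it is off by an element of C_S(X), which is
    absorbed into [v]. *)
Lemma link_factor X Y Z (u : Mor Lq X Z) (c : Mor Lq Y Z) : fc X ->
  (forall x, x \in sval X -> lact u x \in lact c @: sval Y) ->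
  exists v : Mor Lq X Y, u = comp c v.
Proof.
move=> cX uc; have [T [a [b [_ TE _ _ cb]]]] := ffactor (pf c).
have [|f0 f0E] := frestr (f := pf u) (P0 := sval X) (Q0 := T) (subxx _).
  by move=> x Xx; rewrite -[_ \in T]/(_ \in gval T) TE uc.
have [v0 v0E] := pf_surj (comp b f0).
have [|z Cz uE] := orbit_lift (f := comp c v0) (g := u) cX.
  apply: fmor_eq => x Xx; rewrite pf_comp v0E !fapp_comp cb ?fapp_in //.
  exact: f0E.
by exists (comp v0 (qdelta Lq X z)); rewrite comp_assoc.
Qed.

Lemma rep_quasicentric X : quasicentric F (frep F (sval X)).
Proof. exact: quasicentric_Fconj (frepP F (sval X)).1 (svalP X). Qed.

Definition rep X : quasicentric_obj F := exist _ _ (@rep_quasicentric X).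

Lemma fully_centralized_rep X : fc (rep X).
Proof. have h := (frepP F (sval X)).2; exact (fully_normalized_centralized satF h). Qed.

(* The axioms control only the morphisms out of fully centralized objects, so X
   need not be isomorphic to rep X: there is a retraction, and f o g is the
   identity only as seen from fully centralized objects. *)
Lemma rep_retract X : exists (f : Mor Lq (rep X) X) (g : Mor Lq X (rep X)),
  [/\ comp g f = idm Lq (rep X), {in sval X, forall x, lact f (lact g x) = x}
    & forall Y (m : Mor Lq Y X), fc Y -> comp f (comp g m) = m].
Proof.
have [a [b [ba ab]]] := Fconj_maps (frepP F (sval X)).1.
have [f fE] := @pf_surj (rep X) X b; have [g0 g0E] := @pf_surj X (rep X) a.
have cP := @fully_centralized_rep X.
have [|z Cz idE] := orbit_lift (f := comp g0 f) (g := idm Lq (rep X)) cP.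
  by apply: fmor_eq => x Px; rewrite pf_comp pf_id fapp_comp fE g0E ab // fapp_id.
have [d [d1 d2]] := qdelta_aut Lq (cent_mem Cz).
pose g := comp (qdelta Lq (rep X) z) g0.
have gf : comp g f = idm Lq (rep X).
  rewrite /g -comp_assoc (_ : comp g0 f = d); first by rewrite d2.
  by rewrite -[LHS]comp_idr -d2 comp_assoc -idE comp_idl.
exists f, g; split=> // [x Xx|Y m cY].
  apply: (@lact_inj _ _ g) => //; first exact: lact_in.
  by rewrite -lact_comp gf /lact pf_id fapp_id ?fapp_in.
by apply: (link_mono (c := g)) => //; rewrite comp_assoc gf comp_idl.
Qed.

(* The inverse of m extends to the quasicentric group K C_S(K), K the image of m,
   and turns x into an element of C_S(X), which acts freely. *)
Lemma delta_top_free X (m : Mor Lq X (quasi_top F)) x : fc X -> x \in S ->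
  comp (qdelta Lq (quasi_top F) x) m = m -> x = 1.
Proof.
move=> cX Sx mx.
have [K KE] := image_subgrp (pf m) (subxx (sval X)).
have [b [bm mb]] := finv_ex KE.
have imb : sval X = fapp b @: K :> {set gT}.
  apply/setP => y; apply/idP/imsetP => [Xy|[k _ ->]]; last exact: fapp_in.
  by exists (fapp (pf m) y); rewrite ?bm // KE imset_f.
have CKx : x \in 'C_S(K).
  rewrite inE Sx; apply/centP => k; rewrite KE => /imsetP[y Xy ->].
  have := congr1 (fun f => lact f y) mx; rewrite /lact pf_comp fapp_comp.
  rewrite [fapp (pf (qdelta _ _ _)) _]qproj_delta //; last exact: fapp_in.
  by move=> e; rewrite /commute -{2}e mulgKV.
have [e eE] := cent_extension satF imb cX.
have qK : quasicentric F K.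
  exact: quasicentric_Fconj (Fconj_image (subxx _) KE) (svalP X).
pose N : quasicentric_obj F :=
  exist _ (join_cent K) (quasicentric_overgroup satF pS qK (sub_join_cent K)).
have Nx : x \in sval N := subsetP (cent_sub_join K) _ CKx.
have [i [iE iD]] := qiota Lq N.
have [m' m'E] : exists v, m = comp i v.
  apply: link_factor => // y Xy; apply/imsetP; exists (lact m y).
    by apply: (subsetP (sub_join_cent K)); rewrite KE imset_f.
  rewrite [RHS]iE //; apply: (subsetP (sub_join_cent K)).
  by rewrite KE imset_f.
have lact' y : y \in sval X -> lact m' y = lact m y.
  by move=> Xy; rewrite m'E lact_comp [RHS]iE // lact_in.
have m'x : comp (qdelta Lq N x) m' = m'.
  apply: (link_mono (c := i)) => //.
  by rewrite -m'E -[RHS]mx m'E !comp_assoc iD // self_mem.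
have [eh ehE] := @pf_surj N (quasi_top F) e.
have [j [jE jD]] := qiota Lq X.
have [|z Cz zE] := orbit_lift (f := j) (g := comp eh m') cX.
  apply: fmor_eq => y Xy; rewrite [LHS]jE // pf_comp fapp_comp ehE.
  rewrite [fapp _ y]lact' // eE; first by rewrite [RHS]bm.
  by rewrite -[_ \in K]/(_ \in gval K) KE imset_f.
have Cy : fapp e x \in 'C_S(sval X).
  rewrite inE fapp_top; apply/centP => y; rewrite imb => /imsetP[k Kk ->].
  have Jk := subsetP (sub_join_cent K) k Kk.
  rewrite -eE // /commute -!fappM //.
  by have /setIP[_ /centP/(_ k Kk) ->] := CKx.
have ex : fapp e x = 1.
  have : comp j (qdelta Lq X (fapp e x * z)) = comp j (qdelta Lq X z).
    rewrite qdelta_mul ?cent_mem // comp_assoc -jD ?cent_mem // -comp_assoc -zE.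
    by rewrite -{1}ehE comp_assoc -[fapp (pf eh) x]/(fapp (fmap (qproj Lq) eh) x)
         -qdelta_nat // -comp_assoc m'x.
  by move/(delta_free cX (groupM Cy Cz) Cz) => h; apply: (mulIg z); rewrite mul1g.
by apply: (fapp_inj (f := e)) => //; rewrite ?group1 // ex fapp1.
Qed.

(** After composition with an inclusion into S, normality gives [comp (qdelta Lq Y y) m = comp m g],
    so the values of both morphisms at [y] act alike on [comp v m]; [delta_top_free] makes them
    equal. The morphisms then differ by some [z] in C_S(Y) with [comp (qdelta Lq Y z) m = m], and
    the same lemma gives [z = 1]. *)
Lemma normal_epi X Y Z (m : Mor Lq X Y) (u u' : Mor Lq Y Z) : fc X -> fc Y ->
  (forall y x, y \in sval Y -> x \in sval X -> y * lact m x * y^-1 \in lact m @: sval X) ->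
  comp u m = comp u' m -> u = u'.
Proof.
move=> cX cY nm um; have [i [_ _]] := qiota Lq Z.
apply: (link_mono (c := i)) => //; set v := comp i u; set v' := comp i u'.
have vm : comp v m = comp v' m by rewrite /v /v' -!comp_assoc um.
have [|z Cz v'E] := orbit_lift (f := v) (g := v') cY.
  apply: fmor_eq => y Yy.
  have [g gE] : exists g, comp (qdelta Lq Y y) m = comp m g.
    apply: link_factor => // x Xx.
    by rewrite lact_comp [lact _ _]qproj_delta ?lact_in // nm.
  have ev (w : Mor Lq Y (quasi_top F)) : comp w m = comp v m ->
      comp (qdelta Lq _ (lact w y)) (comp v m) = comp (comp v m) g.
    move=> <-; have nw : comp w (qdelta Lq Y y) = comp (qdelta Lq _ (lact w y)) w.
      exact: qdelta_nat.
    by rewrite comp_assoc -nw -comp_assoc gE comp_assoc.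
  have e := etrans (ev v erefl) (esym (ev v' (esym vm))).
  rewrite -/(lact v y) -/(lact v' y); set a := lact v y in e *; set b := lact v' y in e *.
  have Sa : a \in S by apply: fapp_in.
  have Sb : b \in S by apply: fapp_in.
  have memS s : s \in S -> s \in S * 'C_S(S) by move=> Ss; rewrite -[s]mulg1 mem_mulg.
  have : b^-1 * a = 1.
    apply: (delta_top_free (m := comp v m)) => //; first by rewrite groupM ?groupV.
    rewrite qdelta_mul ?memS ?groupV // -comp_assoc e comp_assoc.
    by rewrite -qdelta_mul ?memS ?groupV // mulVg delta1 comp_idl.
  by move/(congr1 (mulg b)); rewrite mulKVg mulg1.
have zm : comp (qdelta Lq Y z) m = m.
  by apply: (link_mono (c := v)) => //; rewrite comp_assoc -v'E.
have [j [jE jD]] := qiota Lq Y.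
suff z1 : z = 1 by rewrite v'E z1 delta1 comp_idr.
apply: (delta_top_free (m := comp j m)) => //; first by case/setIP: Cz.
by rewrite comp_assoc jD ?cent_mem // -comp_assoc zm.
Qed.

End Linking.

(** * Factoring and extending arrows out of a representative *)

Section Resolution.
Variables (gT : finGroupType) (S : {group gT}) (F : fusion_system S) (p : nat).
Local Notation M := (Mor (fusion_cat F)).
Hypothesis satF : saturated F p.
Hypothesis pS : p.-group S.
Variable Lq : quasicentric_linking_system F.
Implicit Types X Y Z A : quasicentric_obj F.
Local Notation fc X := (fully_centralized F (sval X)).

Definition is_rep X := frep F (sval X) = sval X.

Lemma is_rep_normalized X : is_rep X -> fully_normalized F (sval X).
Proof. by rewrite /is_rep => <-; exact: (frepP F (sval X)).2. Qed.

Lemma is_rep_centralized X : is_rep X -> fc X.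
Proof. by move=> rX; exact (fully_normalized_centralized satF (is_rep_normalized rX)). Qed.

Lemma is_rep_rep X : is_rep (rep X).
Proof. exact: frep_idem. Qed.

Lemma quasicentric_obj_eq X Y : sval X = sval Y -> X = Y.
Proof. by case: X Y => P qP [Q qQ] /= PQ; apply: eq_exist. Qed.

Lemma card_lact X Y (f : Mor Lq X Y) : #|lact f @: sval X| = #|sval X|.
Proof. exact: card_fapp. Qed.

Lemma lact_conj X Y (f : Mor Lq X Y) x y : x \in sval X -> y \in sval X ->
  lact f (x * y * x^-1) = lact f x * lact f y * (lact f x)^-1.
Proof. exact: fapp_conj. Qed.

Variable X : quasicentric_obj F.
Hypothesis repX : is_rep X.
Let cX : fc X := is_rep_centralized repX.
Let nX := is_rep_normalized repX.

Definition normal_arrow A (a : Mor Lq X A) := forall y x,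
  y \in sval A -> x \in sval X -> y * lact a x * y^-1 \in lact a @: sval X.

(** B is an object because it contains the quasicentric image of X. It is replaced by its
    representative, since only morphisms out of fully centralized objects are under control. *)
Lemma sub_arrow Y (m : Mor Lq X Y) (B : subgrp S) : lact m @: sval X \subset B ->
  B \subset sval Y -> exists A (a : Mor Lq X A) (c : Mor Lq A Y),
    [/\ is_rep A, comp c a = m & lact c @: sval A = B].
Proof.
move=> mB BY; have [K KE] := image_subgrp (pf m) (subxx (sval X)).
have qK : quasicentric F K.
  exact: quasicentric_Fconj (Fconj_image (subxx _) KE) (svalP X).
have KB : K \subset B by rewrite KE.
pose BO : quasicentric_obj F := exist _ B (quasicentric_overgroup satF pS qK KB).
have [f [g [gf fg _]]] := rep_retract satF Lq BO.
have [i0 i0E] := @fincl_ex _ _ F B (sval Y) BY.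
have [i iE] := pf_surj Lq (i0 : M (sval BO) (sval Y)).
have cE y : y \in sval (rep BO) -> lact (comp i f) y = lact f y.
  move=> Ry; have Bf : lact f y \in B by apply: (lact_in f).
  by rewrite lact_comp [lact i _]/(fapp (pf i) _) iE; apply: i0E.
have imc : lact (comp i f) @: sval (rep BO) = B.
  apply/setP => x; apply/imsetP/idP => [[y Ry ->]|Bx].
    by rewrite cE //; apply: (lact_in f).
  exists (lact g x); first exact: lact_in.
  by rewrite cE ?lact_in // fg.
have [|a aE] := link_factor (u := m) (c := comp i f) cX.
  by move=> x Xx; rewrite imc (subsetP mB) // imset_f.
by exists (rep BO), a, (comp i f); split=> //; apply: is_rep_rep.
Qed.

Lemma normal_arrow_image A (a : Mor Lq X A) Y (c : Mor Lq A Y) :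
  lact c @: sval A \subset 'N(lact (comp c a) @: sval X) -> normal_arrow a.
Proof.
move=> nc y x Ay Xx.
have cy : lact c y \in 'N(lact (comp c a) @: sval X) by apply: (subsetP nc); apply: imset_f.
have : (lact (comp c a) x) ^ (lact c y)^-1 \in lact (comp c a) @: sval X.
  by rewrite memJ_norm ?groupV // imset_f.
case/imsetP=> x' Xx'; rewrite conjgE invgK !lact_comp mulgA -lact_conj ?lact_in // => e.
apply/imsetP; exists x' => //; apply: (lact_inj (f := c)) => //; rewrite ?lact_in //.
by apply: groupM; [apply: groupM => //; apply: lact_in|rewrite groupV].
Qed.

(* Axiom (II) extends the underlying homomorphism; the extension is corrected by
   an element of C_S(X) acting on the target, which is possible because the image
   of n is X itself. *)
Lemma link_extension A (a : Mor Lq X A) (n : Mor Lq X (quasi_top F)) :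
  normal_arrow a -> lact n @: sval X = sval X ->
  (forall y, y \in sval A -> exists2 h, h \in 'N_S(sval X) &
     forall x x', x \in sval X -> x' \in sval X ->
       lact a x' = y * lact a x * y^-1 -> lact n x' = h * lact n x * h^-1) ->
  exists v : Mor Lq A (quasi_top F), comp v a = n.
Proof.
move=> na imn ext; have [K KE] := image_subgrp (pf a) (subxx (sval X)).
have [b [ba ab]] := finv_ex KE.
have bK k : k \in K -> fapp b k \in sval X by move=> _; apply: fapp_in.
have [n0 n0E] : exists n0 : M (sval X) (sval X), {in sval X, fapp n0 =1 lact n}.
  apply: (frestr (f := pf n)) => // x Xx.
  by have : lact n x \in lact n @: sval X := imset_f (lact n) Xx; rewrite imn.
have imK : sval X = fapp (comp n0 b) @: K :> {set gT}.
  apply/setP => x; apply/idP/imsetP => [|[k _ ->]]; last exact: fapp_in.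
  move=> Xx; have : x \in lact n @: sval X by rewrite imn.
  case/imsetP=> y Xy ->; exists (lact a y).
    by rewrite KE imset_f.
  by rewrite fapp_comp ba // n0E.
have KA : K \subset sval A.
  by apply/subsetP => k; rewrite KE => /imsetP[x _ ->]; apply: lact_in.
have AN : sval A \subset 'N_S(K).
  rewrite subsetI (valP (sval A)); apply/subsetP => y Ay; rewrite -groupV inE.
  apply/subsetP => z; rewrite mem_conjgV => Kz.
  have : z ^ y \in K by []; rewrite KE => /imsetP[x Xx zE].
  rewrite -(conjgK y z) zE conjgE invgK mulgA; exact: na.
have [|e eE] := extension satF imK cX KA AN.
  move=> y Ay; have [h Nh hE] := ext y Ay; exists h => // k Kk.
  have Kyk : y * k * y^-1 \in K by apply: mem_conjV => //; case/setIP: (subsetP AN y Ay).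
  have E k' : k' \in K -> fapp (comp n0 b) k' = lact n (fapp b k').
    by move=> Kk'; rewrite fapp_comp n0E // fapp_in.
  rewrite (E _ Kyk) (E _ Kk); apply: hE; rewrite ?fapp_in //.
  by rewrite -[lact a _]/(fapp (pf a) _) -[lact a (fapp b k)]/(fapp (pf a) _) !ab.
have [eh ehE] := @pf_surj _ _ _ Lq A (quasi_top F) e.
have pE : pf (comp eh a) = pf n.
  apply: fmor_eq => x Xx; rewrite pf_comp fapp_comp ehE eE; last first.
    by rewrite -[_ \in K]/(_ \in gval K) KE imset_f.
  by rewrite fapp_comp ba // n0E.
have [z Cz nE] := orbit_lift cX pE.
have [j [jE jD]] := qiota Lq X.
have [ga gaE] : exists g : Mor Lq X X, comp eh a = comp j g.
  apply: link_factor => // x Xx; have Xnx : lact n x \in sval X by have : lact n x \in lact n @: sval X := imset_f (lact n) Xx; rewrite imn.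
  apply/imsetP; exists (lact n x) => //.
  by rewrite [RHS]jE // /lact pE.
have actga x : x \in sval X -> lact ga x = lact n x.
  move=> Xx; have := congr1 (fun f => fapp (pf f) x) gaE.
  rewrite /= pE => e1; rewrite [RHS]e1 pf_comp fapp_comp.
  by rewrite [RHS]jE // fapp_in.
have [ka kaE] : exists k : Mor Lq X X, idm Lq X = comp ga k.
  apply: link_factor => // x Xx; rewrite /lact pf_id fapp_id //.
  by have : x \in lact n @: sval X; [rewrite imn|rewrite -(eq_in_imset actga)].
have kga : comp ka ga = idm Lq X.
  by apply: (link_mono (c := ga)) => //; rewrite comp_assoc -kaE comp_idl comp_idr.
(* Conjugation by the automorphism [ga] of X turns the correction by [z] into one by [z1], which
   [jD] moves from X to the target S. *)
have [|z1 Cz1 z1E] := orbit_lift (f := idm Lq X) (g := comp (comp ga (qdelta Lq X z)) ka) cX.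
  have dz : pf (comp ga (qdelta Lq X z)) = pf ga.
    by apply/esym; apply: (qproj_orbit ga _ cX).2; exists z.
  by rewrite pf_comp dz -pf_comp -kaE.
exists (comp (qdelta Lq _ z1) eh).
rewrite nE -comp_assoc gaE comp_assoc jD ?cent_mem // -comp_assoc -[RHS]comp_assoc; congr comp.
by rewrite comp_idl in z1E; rewrite -z1E -comp_assoc kga comp_idr.
Qed.

End Resolution.

Section Removal.
Variables (gT : finGroupType) (S : {group gT}) (F : fusion_system S) (p : nat).
Local Notation M := (Mor (fusion_cat F)).
Hypothesis satF : saturated F p.
Hypothesis pS : p.-group S.
Variable Lq : quasicentric_linking_system F.
Implicit Types X Y Z A : quasicentric_obj F.
Local Notation fc X := (fully_centralized F (sval X)).

Variable X : quasicentric_obj F.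
Hypothesis repX : is_rep X.
Let cX : fc X := is_rep_centralized satF repX.
Let nX := is_rep_normalized repX.
Let H : subgrp S := hat F p (sval X).
Implicit Types n : Mor Lq X (quasi_top F).

(* The g whose action on X, transported from n to n', is that of an element of T. *)
Definition compat n n' (T : {group gT}) : {set gT} :=
  [set g in 'N_S(sval X) | `[< exists2 h, h \in T & forall x x', x \in sval X -> x' \in sval X ->
     lact n x' = g * lact n x * g^-1 -> lact n' x' = h * lact n' x * h^-1 >]].

(** The group structure allows an inclusion of [tgrp] in [compat] to be tested on generators. *)
Lemma compat_group_set n n' T : lact n @: sval X = sval X -> group_set (compat n n' T).
Proof.
move=> imn; apply/group_setP; split=> [|g1 g2].
  rewrite inE group1; apply/asboolP; exists 1; rewrite ?group1 // => x x' Xx Xx'.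
  by rewrite !mul1g !invg1 !mulg1 => /(lact_inj Xx' Xx) ->.
case/setIdP=> N1 /asboolP[h1 T1 E1] /setIdP[N2 /asboolP[h2 T2 E2]].
rewrite inE groupM //; apply/asboolP; exists (h1 * h2); rewrite ?groupM // => x x' Xx Xx' e.
have /imsetP[y Xy yE] : g2 * lact n x * g2^-1 \in lact n @: sval X.
  rewrite imn mem_conjV //; first by case/setIP: N2.
  by have : lact n x \in lact n @: sval X := imset_f (lact n) Xx; rewrite imn.
rewrite (E1 y x') // -?yE; last by rewrite e invMg !mulgA.
by rewrite (E2 x y) // invMg !mulgA.
Qed.

(** Two embeddings with image X differ by an automorphism of X in F, and [hat_conj] keeps H stable
    under it. *)
Lemma hat_compat n n' (T : {group gT}) : lact n @: sval X = sval X ->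
  lact n' @: sval X = sval X -> H \subset T -> H \subset compat n n' T.
Proof.
move=> imn imn' HT; apply/subsetP => g Hg.
have restr (k : Mor Lq X (quasi_top F)) : lact k @: sval X = sval X ->
    exists k0 : M (sval X) (sval X), {in sval X, fapp k0 =1 lact k}.
  move=> imk; apply: (frestr (f := pf k)) => // x Xx.
  by have : lact k x \in lact k @: sval X := imset_f (lact k) Xx; rewrite imk.
have [n0 n0E] := restr n imn; have [n0' n0E'] := restr n' imn'.
have im0 : sval X = fapp n0 @: sval X :> {set gT} by rewrite (eq_in_imset n0E) imn.
have [b [bn nb]] := finv_ex im0.
have [g' Hg' g'E] := hat_conj satF nX (comp n0' b) Hg.
have Ng := subsetP (hat_norm F p (sval X)) _ Hg.
rewrite inE Ng; apply/asboolP; exists g'; first exact: (subsetP HT).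
have E k : k \in sval X -> lact n' k = fapp (comp n0' b) (lact n k).
  by move=> Xk; rewrite fapp_comp -n0E // bn // n0E'.
move=> x x' Xx Xx' e; rewrite !E // e g'E //.
by have : lact n x \in lact n @: sval X := imset_f (lact n) Xx; rewrite imn.
Qed.

(** Axiom (II), through [link_extension], extends [comp c' a'] to a morphism [v] from A to S. Each
    [v y] acts on X like some [h] in T', hence differs from it by an element of C_S(X), which lies
    in T'; so [v] factors through [c']. *)
Lemma cover_morphism A A' (a : Mor Lq X A) (c : Mor Lq A (quasi_top F))
    (a' : Mor Lq X A') (c' : Mor Lq A' (quasi_top F)) (T T' : {group gT}) :
  fc A -> lact c @: sval A = T -> lact c' @: sval A' = T' ->
  lact (comp c a) @: sval X = sval X -> lact (comp c' a') @: sval X = sval X ->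
  T' \subset 'N_S(sval X) -> 'C_S(sval X) \subset T' ->
  T \subset compat (comp c a) (comp c' a') T' -> exists w, comp w a = a'.
Proof.
move=> cA cT cT' imn imn' NT' CT' TT'.
have na : normal_arrow a.
  apply: (normal_arrow_image (c := c)); rewrite cT imn; apply/subsetP => g /(subsetP TT').
  by case/setIdP=> /setIP[].
have ext y : y \in sval A -> exists2 h, h \in T' & forall x x', x \in sval X -> x' \in sval X ->
     lact a x' = y * lact a x * y^-1 ->
     lact (comp c' a') x' = h * lact (comp c' a') x * h^-1.
  move=> Ay; have /(subsetP TT')/setIdP[_ /asboolP[h T'h hE]] : lact c y \in T.
    by rewrite -cT imset_f.
  exists h => // x x' Xx Xx' e; apply: hE => //.
  by rewrite !lact_comp e lact_conj ?lact_in.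
have [|v va] := link_extension satF repX na imn'.
  by move=> y Ay; have [h T'h hE] := ext y Ay; exists h => //; apply: (subsetP NT').
have [|w vE] := link_factor (u := v) (c := c') cA.
  move=> y Ay; rewrite cT'; have [h T'h hE] := ext y Ay.
  have /setIP[Sh _] := subsetP NT' _ T'h.
  rewrite -(mulKVg h (lact v y)) groupM //; apply: (subsetP CT').
  rewrite inE groupM ?groupV //=; last exact: lact_in.
  apply/centP => z Xz; have : z \in lact (comp c' a') @: sval X by rewrite imn'.
  case/imsetP=> x Xx ->; have /imsetP[x' Xx' e] := na y x Ay Xx.
  have := hE x x' Xx Xx' (esym e); rewrite -va !lact_comp -e lact_conj ?lact_in // => e'.
  rewrite /commute; apply: (mulgI h); rewrite !mulgA mulgV mul1g.
  by rewrite -e' mulgKV.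
exists w; apply: (link_mono (c := c')) => //.
by rewrite comp_assoc -vE va.
Qed.

End Removal.

(** * Removing a conjugacy class *)

Section Resolution.
Variables (gT : finGroupType) (S : {group gT}) (F : fusion_system S) (p : nat).
Hypothesis satF : saturated F p.
Hypothesis pS : p.-group S.
Variable Lq : quasicentric_linking_system F.
Implicit Types X Y Z A : quasicentric_obj F.
Local Notation fc X := (fully_centralized F (sval X)).

Variable X : quasicentric_obj F.
Hypothesis repX : is_rep X.
Hypothesis removable : ~ (radical F p (sval X) /\ centric F (sval X)).
Let cX : fc X := is_rep_centralized satF repX.
Let nX := is_rep_normalized repX.
Let H : subgrp S := hat F p (sval X).

(* The part Y <- N_Y(X) -> N_Y(X) H of the zigzag. The objects rob and tob are the
   chosen representatives of the two groups; rtop and ttop embed them in S so that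
   X is mapped onto itself. *)
Record resolution Y (m : Mor Lq X Y) := Resolution {
  rob : quasicentric_obj F; rarr : Mor Lq X rob;
  rmap : Mor Lq rob Y; rtop : Mor Lq rob (quasi_top F);
  tob : quasicentric_obj F; tarr : Mor Lq X tob; ttop : Mor Lq tob (quasi_top F);
  tgrp : subgrp S;
  rob_rep : is_rep rob;
  rob_card : (#|sval X| < #|sval rob|)%N;
  rmapE : comp rmap rarr = m;
  rmap_norm : lact rmap @: sval rob = 'N_(sval Y)(lact m @: sval X);
  rtop_image : lact (comp rtop rarr) @: sval X = sval X;
  tob_rep : is_rep tob;
  ttopE : comp ttop tarr = comp rtop rarr;
  ttop_image : lact ttop @: sval tob = tgrp;
  tgrp_hat : H \subset tgrp;
  tgrp_top : lact rtop @: sval rob \subset tgrp;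
  tgrp_gen : forall K : {group gT}, H \subset K -> lact rtop @: sval rob \subset K ->
    tgrp \subset K }.

Lemma lact_subgrp Y Z (f : Mor Lq Y Z) (B : subgrp S) : B \subset sval Y ->
  exists K : subgrp S, K = lact f @: B :> {set gT}.
Proof. exact: image_subgrp. Qed.

Lemma resolution_exists Y (m : Mor Lq X Y) : (#|sval X| < #|sval Y|)%N ->
  inhabited (resolution m).
Proof.
move=> XY; have [K KE] := lact_subgrp m (subxx (sval X)).
have KY : K \subset sval Y.
  by rewrite KE; apply/subsetP => _ /imsetP[x _ ->]; apply: lact_in.
have NS : 'N_(sval Y)(K) \subset S by apply: subset_trans (subsetIl _ _) (valP (sval Y)).
have KN : K \subset 'N_(sval Y)(K) by rewrite subsetI KY normG.
have [|R [n [c [rR cn cR]]]] := sub_arrow satF pS repX (m := m) (B := mk_subgrp NS) _ (subsetIl _ _).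
  by rewrite -KE.
have pKN : K \proper 'N_(sval Y)(K).
  apply: nilpotent_proper_norm; first exact: pgroup_nil (pgroupS (valP (sval Y)) pS).
  by rewrite properEcard KY /= KE card_lact.
have cardR : (#|sval X| < #|sval R|)%N.
  by rewrite -(card_lact c) cR -(card_lact m) -KE; apply: proper_card.
have [K' K'E] := lact_subgrp n (subxx (sval X)).
have K'R : K' \subset sval R.
  by rewrite K'E; apply/subsetP => _ /imsetP[x _ ->]; apply: lact_in.
have nn : normal_arrow n.
  apply: (normal_arrow_image (c := c)); rewrite cR cn -KE; exact: subsetIr.
have K'X : Fconj F K' (sval X).
  exact: Fconj_sym (Fconj_image (subxx (sval X)) K'E).
have K'N : sval R \subset 'N_S(K').
  rewrite subsetI (valP (sval R)); apply/subsetP => y Ry; rewrite -groupV inE.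
  apply/subsetP => z; rewrite mem_conjgV => Kz.
  have : z ^ y \in K' by []; rewrite K'E => /imsetP[x Xx zE].
  rewrite -(conjgK y z) zE conjgE invgK mulgA; exact: nn.
(* X is fully normalized, so the representative of N_Y(X) can be embedded in S in such a way that
   the copy of X becomes X itself, and the join with H makes sense. *)
have [f fE] := normalizer_extension satF pS nX K'X K'R K'N.
have [u uE] := @pf_surj _ _ _ Lq R (quasi_top F) f.
have imu : lact (comp u n) @: sval X = sval X.
  rewrite [RHS]fE K'E -imset_comp; apply: eq_in_imset => x Xx.
  by rewrite lact_comp /= /lact uE.
have [U UE] := lact_subgrp u (subxx (sval R)).
have TS : U <*> H \subset S by rewrite join_subG (valP U) (valP H).
have XH : sval X \subset H := sub_hat F pS _.
have [|A [a [d [rA da dA]]]] := sub_arrow satF pS repX (m := comp u n) (B := mk_subgrp TS) _ TS.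
  by rewrite imu (subset_trans XH) ?joing_subr.
constructor; refine (@Resolution Y m R n c u A a d (mk_subgrp TS) rR cardR cn _ imu rA da dA
  (joing_subr _ _) _ _) => /=.
- by rewrite cR /= KE.
- by rewrite -UE joing_subl.
- by move=> K0 HK UK; rewrite join_subG HK UE UK.
Qed.

Lemma hat_arrow_exists : exists B (b : Mor Lq X B) (c : Mor Lq B (quasi_top F)),
  [/\ is_rep B, lact (comp c b) @: sval X = sval X & lact c @: sval B = H].
Proof.
have [j [jE _]] := qiota Lq X.
have imj : lact j @: sval X = sval X.
  by rewrite (eq_in_imset (g := id)) ?imset_id // => x Xx; rewrite -[RHS](jE x).
have [|B [b [c [rB cb cB]]]] := sub_arrow satF pS repX (m := j) (B := H) _ (valP H).
  by rewrite imj (sub_hat F pS).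
by exists B, b, c; rewrite cb.
Qed.

Lemma hat_card B (c : Mor Lq B (quasi_top F)) : lact c @: sval B = H ->
  (#|sval X| < #|sval B|)%N.
Proof. by move=> cB; rewrite -(card_lact c) cB; apply/proper_card/(hat_proper satF pS nX). Qed.

Section ResolutionTheory.
Variables (Y : quasicentric_obj F) (m : Mor Lq X Y) (q : resolution m).

Lemma rarr_normal : normal_arrow (rarr q).
Proof.
by apply: (normal_arrow_image (c := rmap q)); rewrite rmap_norm rmapE subsetIr.
Qed.

Lemma tgrp_norm : tgrp q \subset 'N_S(sval X).
Proof.
have -> : 'N_S(sval X) = [group of 'N_S(sval X)] by [].
apply: (tgrp_gen (r := q)); first exact: hat_norm.
apply/subsetP => _ /imsetP[y Ry ->]; rewrite inE [_ \in S](lact_in (rtop q)) -groupV inE.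
apply/subsetP => z; rewrite mem_conjgV => Xz.
have : z ^ lact (rtop q) y \in lact (comp (rtop q) (rarr q)) @: sval X by rewrite rtop_image.
case/imsetP=> x Xx zE; rewrite -(conjgK (lact (rtop q) y) z) zE conjgE invgK mulgA.
rewrite lact_comp -lact_conj ?lact_in //.
have /imsetP[x' Xx' ->] := rarr_normal Ry Xx.
have : lact (comp (rtop q) (rarr q)) x' \in lact (comp (rtop q) (rarr q)) @: sval X.
  exact: imset_f.
by rewrite rtop_image lact_comp.
Qed.

Lemma tarr_image : lact (comp (ttop q) (tarr q)) @: sval X = sval X.
Proof. by rewrite ttopE rtop_image. Qed.

Lemma tarr_normal : normal_arrow (tarr q).
Proof.
apply: (normal_arrow_image (c := ttop q)); rewrite ttop_image tarr_image.
exact: subset_trans tgrp_norm (subsetIr _ _).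
Qed.

Lemma tob_card : (#|sval X| < #|sval (tob q)|)%N.
Proof.
rewrite -(card_lact (ttop q)) ttop_image.
apply: leq_trans (subset_leq_card (tgrp_hat q)).
exact/proper_card/(hat_proper satF pS nX).
Qed.

Lemma cent_tgrp : 'C_S(sval X) \subset tgrp q.
Proof.
apply: subset_trans (tgrp_hat q); apply/subsetP => z /setIP[Sz Cz].
apply: (@hat_acts _ _ _ _ _ z 1) => [||x Xx].
- by rewrite inE Sz (subsetP (cent_sub _)).
- exact: group1.
- by rewrite (centP Cz x Xx) mulgK mul1g invg1 mulg1.
Qed.

Lemma rarr_tarr : exists w, comp w (rarr q) = tarr q.
Proof.
have cR := is_rep_centralized satF (rob_rep q).
have [y Ry|w wE] := link_factor (u := rtop q) (c := ttop q) cR.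
  by rewrite ttop_image; apply: (subsetP (tgrp_top q)); apply: imset_f.
exists w; apply: (link_mono (c := ttop q)) => //.
by rewrite comp_assoc -wE ttopE.
Qed.

Lemma hat_tarr B (b : Mor Lq X B) (c : Mor Lq B (quasi_top F)) : is_rep B ->
  lact (comp c b) @: sval X = sval X -> lact c @: sval B = H ->
  exists w, comp w b = tarr q.
Proof.
move=> rB cb cB.
apply: (cover_morphism satF repX (is_rep_centralized satF rB) cB (ttop_image q) cb tarr_image
  tgrp_norm cent_tgrp).
exact: (hat_compat satF repX cb tarr_image (tgrp_hat q)).
Qed.

End ResolutionTheory.

Section ResolutionMaps.
Variables (Y Y' : quasicentric_obj F) (m : Mor Lq X Y) (m' : Mor Lq X Y').
Variables (q : resolution m) (q' : resolution m') (v : Mor Lq Y Y').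
Hypothesis vm : comp v m = m'.

(** Because [comp v m = m'], the morphism [v] carries the normalizer of the image of X in Y into
    that in Y'. *)
Lemma rarr_rarr : exists w, comp w (rarr q) = rarr q'.
Proof.
have cR := is_rep_centralized satF (rob_rep q).
have [y Ry|w wE] := link_factor (u := comp v (rmap q)) (c := rmap q') cR.
  rewrite rmap_norm inE lact_in -groupV inE; apply/subsetP => z; rewrite mem_conjgV.
  set g := lact _ y => /imsetP[x Xx zE].
  have E x1 : lact m' x1 = lact (comp v (rmap q)) (lact (rarr q) x1).
    by rewrite -lact_comp -comp_assoc rmapE vm.
  rewrite -(conjgK g z) zE conjgE invgK mulgA /g E -lact_conj ?lact_in //.
  have /imsetP[x' Xx' ->] := rarr_normal Ry Xx.
  by rewrite -E imset_f.
exists w; apply: (link_mono (c := rmap q')) => //.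
by rewrite comp_assoc -wE -comp_assoc !rmapE.
Qed.

(** The inclusion needed by [cover_morphism] is tested on the generators of [tgrp q]: on H it is
    [hat_compat], and on the image of [rob q] the morphism of [rarr_rarr] provides the required
    elements. *)
Lemma tarr_tarr : exists w, comp w (tarr q) = tarr q'.
Proof.
have [r rE] := rarr_rarr.
apply: (cover_morphism satF repX (is_rep_centralized satF (tob_rep q)) (ttop_image q)
  (ttop_image q') (tarr_image q) (tarr_image q') (tgrp_norm q') (cent_tgrp q')).
have grp := compat_group_set (comp (ttop q') (tarr q')) (tgrp q') (tarr_image q).
apply: (tgrp_gen (K := Group grp)) => /=.
  exact: (hat_compat satF repX (tarr_image q) (tarr_image q') (tgrp_hat q')).
apply/subsetP => _ /imsetP[y Ry ->].
have Ty : lact (rtop q) y \in tgrp q by apply: (subsetP (tgrp_top q)); apply: imset_f.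
rewrite inE (subsetP (tgrp_norm q)) //; apply/asboolP.
exists (lact (rtop q') (lact r y)).
  by apply: (subsetP (tgrp_top q')); apply: imset_f; apply: lact_in.
move=> x x' Xx Xx'; rewrite !ttopE !lact_comp -lact_conj ?lact_in // => e.
have {}e : lact (rarr q) x' = y * lact (rarr q) x * y^-1.
  apply: (lact_inj (f := rtop q)); rewrite ?lact_in //.
  by rewrite !groupM ?groupV // lact_in.
rewrite -rE !lact_comp e -lact_conj ?lact_in // -lact_conj ?lact_in //.
Qed.

End ResolutionMaps.
End Resolution.

(** * Induction on the order of the removed representatives *)

Section Retract.
Variables (R : realType) (Ob : Type) (C : category Ob) (A B : Ob -> Prop).
Variable AB : forall X, A X -> B X.

(** The object [f] is the apex of a cone, with components [comp (carr q) g]. Only one composite of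
    [f] and [g] is known to be an identity, so the apex need not be initial. *)
Lemma retract_contractible (X : {X : Ob | B X}) Y (AY : A Y) (f : Mor C (sval X) Y)
    (g : Mor C Y (sval X)) : comp g f = idm C (sval X) ->
  contractible R (comma_space R (sub_functor C AB) X).
Proof.
move=> gf; pose Fun := sub_functor C AB.
pose h (Z : {X | A X}) : {X | B X} := exist B (sval Z) (AB (svalP Z)).
pose apex : comma_ob (fullsub C B) h X := @CommaOb _ _ (fullsub C B) h X (exist A Y AY) f.
have cE (q : comma_ob (fullsub C B) h X) : comp (comp (carr q : Mor C (sval X) _) g) f = carr q.
  by rewrite -comp_assoc gf comp_idr.
pose c (q : comma_ob (fullsub C B) h X) : Mor (comma Fun X) apex q :=
  exist _ (comp (carr q : Mor C (sval X) _) g) (cE q).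
apply: (@cone_contractible R _ (comma Fun X) apex c).
move=> a b [u uE]; apply: comma_mor_eq; rewrite /= comp_assoc.
exact: (congr1 (fun w : Mor C (sval X) (sval (cob b)) => comp w g) uE).
Qed.

End Retract.

Section Levels.
Variables (R : realType) (gT : finGroupType) (S : {group gT}) (F : fusion_system S) (p : nat).
Hypothesis satF : saturated F p.
Hypothesis pS : p.-group S.
Variable Lq : quasicentric_linking_system F.
Implicit Types X Y Z A : quasicentric_obj F.
Local Notation fc X := (fully_centralized F (sval X)).
Variable D : quasicentric_obj F -> Prop.
Hypothesis radD : forall P, radical F p (sval P) -> centric F (sval P) -> D P.

(** [D] need not contain the representatives of its members; with them added, [rep_retract] gives a
    coreflection inside the class. *)
Definition rep_closure X := D X \/ exists2 X0, D X0 & X = rep X0.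

(** Level 0 consists of all representatives; beyond the order of S only those in [rep_closure]
    remain. *)
Definition level k X := is_rep X /\ (rep_closure X \/ (k <= #|sval X|)%N).

Lemma level_mono k X : level k.+1 X -> level k X.
Proof. by case=> rX [cX|kX]; split=> //; [left|right; apply: ltnW]. Qed.

Lemma rep_incl_equivalence : incl_equivalence R Lq (@level 0).
Proof.
have lr X : level 0 (rep X) by split; [apply: is_rep_rep|right].
pose ex X := cid (rep_retract satF Lq X).
have epE X Q (m : Mor Lq Q X) : fc Q -> exists v, comp (projT1 (ex X)) v = m.
  move=> cQ; have [g [_ _ gE]] := projT2 (ex X).
  by exists (comp g m); apply: gE.
apply: (@coreflective_equivalence R _ _ (fullsub Lq (level 0)) Lq sval (incl_functor Lq (level 0))
  (fun X => exist _ (rep X) (lr X)) (fun X => projT1 (ex X))).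
- by move=> X [Q lQ] m; apply: epE; exact (is_rep_centralized satF lQ.1).
- move=> X [Q lQ] v v' vv'; apply: link_mono vv'; exact (is_rep_centralized satF lQ.1).
Qed.

Section Step.
Variables (k : nat) (X : quasicentric_obj F) (lX : level k X).
Hypothesis nlX : ~ level k.+1 X.

Let Fun := sub_functor Lq (@level_mono k).
Let h (Z : {Z | level k.+1 Z}) : {Z | level k Z} := exist _ (sval Z) (level_mono (svalP Z)).
Let X' : {Z | level k Z} := exist _ X lX.
Let rX : is_rep X := lX.1.
Let cX : fc X := is_rep_centralized satF rX.

Let arr (q : comma_ob (fullsub Lq (level k)) h X') : Mor Lq X (sval (cob q)) := carr q.

Let cardX : #|sval X| = k.
Proof.
case: lX => _ [clX|kX]; first by case: nlX; split=> //; left.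
apply/eqP; rewrite eqn_leq kX andbT leqNgt; apply/negP => kX'.
by apply: nlX; split=> //; right.
Qed.

Let removable : ~ (radical F p (sval X) /\ centric F (sval X)).
Proof. by case=> radX cenX; apply: nlX; split=> //; left; left; apply: radD. Qed.

(** If the orders agreed, source and target would be conjugate; being chosen representatives, they
    would coincide, and X would be at level [k.+1]. *)
Let card_target (q : comma_ob (fullsub Lq (level k)) h X') : (#|sval X| < #|sval (sval (cob q))|)%N.
Proof.
rewrite ltnNge; apply/negP => YX; apply: nlX.
have [K KE] := image_subgrp (pf (arr q)) (subxx (sval X)).
have KY : K = sval (sval (cob q)) :> {set gT}.
  apply/eqP; rewrite eqEcard {2}KE card_fapp // YX andbT.
  by apply/subsetP => y; rewrite KE => /imsetP[x _ ->]; apply: fapp_in.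
have rY : is_rep (sval (cob q)) := (svalP (cob q)).1.
suff -> : X = sval (cob q) by exact: svalP.
apply: quasicentric_obj_eq; rewrite -rX -rY; apply: frep_Fconj.
by rewrite -(subgrp_inj KY); apply: Fconj_image (subxx _) KE.
Qed.

Let level_big A : is_rep A -> (#|sval X| < #|sval A|)%N -> level k.+1 A.
Proof. by rewrite cardX => rA kA; split=> //; right. Qed.

Lemma level_comma_contractible : contractible R (comma_space R Fun X').
Proof.
have res q : {r : resolution p (arr q) & True}.
  apply: cid; have [r] := resolution_exists satF pS rX (arr q) (card_target q).
  by exists r.
pose rs q := projT1 (res q).
have [B [b [cb [rB imb cB]]]] := hat_arrow_exists satF pS Lq rX.
pose obj A (rA : is_rep A) (XA : (#|sval X| < #|sval A|)%N) (a : Mor Lq X A) :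
    comma_ob (fullsub Lq (level k)) h X' := @CommaOb _ _ (fullsub Lq (level k)) h X'
    (exist _ A (level_big rA XA)) a.
pose r q := obj _ (rob_rep (rs q)) (rob_card (rs q)) (rarr (rs q)).
pose t q := obj _ (tob_rep (rs q)) (tob_card satF pS rX removable (rs q)) (tarr (rs q)).
pose b' := obj _ rB (hat_card satF pS rX removable cB) b.
have uniq A (rA : is_rep A) (XA : (#|sval X| < #|sval A|)%N) (a : Mor Lq X A) q
    (u v : Mor (comma Fun X') (obj A rA XA a) q) : normal_arrow a -> u = v.
  move=> na; apply: comma_mor_eq.
  apply: (normal_epi satF pS cX (is_rep_centralized satF rA) na).
  exact: etrans (svalP u) (esym (svalP v)).
have nr q := @rarr_normal _ _ _ _ _ _ _ _ (rs q).
have nt q := @tarr_normal _ _ _ _ _ _ _ _ (rs q).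
have nb : normal_arrow b.
  apply: (normal_arrow_image (c := cb)); rewrite cB imb.
  exact: subset_trans (hat_norm F p (sval X)) (subsetIr _ _).
apply: (@zigzag_contractible R _ (comma Fun X') r t b').
- by move=> q q' u v; apply: uniq.
- by move=> q q' u v; apply: uniq.
- by move=> q' u v; apply: uniq.
- by move=> q; constructor; exists (rmap (rs q)); apply: rmapE.
- by move=> q; have [w wE] := rarr_tarr satF rX (rs q); constructor; exists w.
- by move=> q; have [w wE] := hat_tarr satF rX (rs q) rB imb cB; constructor; exists w.
- move=> q q' u; have [w wE] := rarr_rarr satF rX (rs q) (rs q') (svalP u).
  by constructor; exists w.
- move=> q q' u; have [w wE] := tarr_tarr satF rX (rs q) (rs q') (svalP u).
  by constructor; exists w.
Qed.

End Step.

Lemma level_step k :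
  homotopy_equivalence R (nerve_realization_map R (sub_functor Lq (@level_mono k))).
Proof.
(* Only the objects lost between the two levels require the zigzag; any other is a retract of
   itself. *)
apply: quillen_A => -[X lX]; have [lX1|nlX] := pselect (level k.+1 X).
  exact: (@retract_contractible R _ Lq _ _ (@level_mono k) (exist _ X lX) X lX1 (idm Lq X) (idm Lq X)
    (comp_idl _)).
exact: level_comma_contractible.
Qed.

Lemma level_incl_equivalence k : incl_equivalence R Lq (@level k).
Proof.
elim: k => [|k IH]; first exact: rep_incl_equivalence.
rewrite /incl_equivalence (incl_sub_functor R Lq (@level_mono k)).
exact: homotopy_equivalence_comp (level_step k) IH.
Qed.

Lemma rep_closure_rep X : rep_closure X -> rep_closure (rep X).
Proof.
case=> [DX|[X0 DX0 ->]]; right; first by exists X.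
by exists X0 => //; apply: quasicentric_obj_eq; rewrite /= frep_idem.
Qed.

Lemma rep_closure_equivalence : incl_equivalence R Lq rep_closure.
Proof.
(* No subgroup of S has this order, so level [K] consists of the representatives in
   [rep_closure]. *)
pose K := #|S|.+1.
have KC X : level K X -> rep_closure X.
  case=> _ [//|]; rewrite /K ltnNge => /negP[]; exact: subset_leq_card (valP (sval X)).
have lr X : rep_closure X -> level K (rep X).
  by move=> clX; split; [apply: is_rep_rep|left; apply: rep_closure_rep].
apply: (homotopy_equivalence_cancel (f := nerve_realization_map R (sub_functor Lq KC))).
- exact: nerve_realization_map_continuous.
- pose ex X := cid (rep_retract satF Lq X).
  pose hh (Z : {X | level K X}) : {X | rep_closure X} := exist _ (sval Z) (KC _ (svalP Z)).
  pose c (Z : {X | rep_closure X}) : {X | level K X} := exist _ (rep (sval Z)) (lr _ (svalP Z)).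
  pose ep (Z : {X | rep_closure X}) : Mor (fullsub Lq rep_closure) (hh (c Z)) Z := projT1 (ex (sval Z)).
  apply: (@coreflective_equivalence R _ _ _ _ hh (sub_functor Lq KC) c ep).
  + move=> [X clX] [Q lQ] m; have [g [_ _ gE]] := projT2 (ex X).
    by exists (comp g m); apply: gE; exact (is_rep_centralized satF lQ.1).
  + by move=> [X clX] [Q lQ] v v' vv'; apply: link_mono vv'; exact (is_rep_centralized satF lQ.1).
- rewrite -(incl_sub_functor R Lq KC); exact: level_incl_equivalence.
Qed.

(** Each object added in [rep_closure] is a retract in L^q of a member of [D], so all fibers of the
    inclusion of [D] in the closure are contractible. *)
Theorem radical_centric_incl_equivalence : incl_equivalence R Lq D.
Proof.
have DC X : D X -> rep_closure X by left.
rewrite /incl_equivalence (incl_sub_functor R Lq DC).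
apply: homotopy_equivalence_comp rep_closure_equivalence.
apply: quillen_A => -[X [DX|[X0 DX0 XE]]].
  exact: (@retract_contractible R _ Lq _ _ DC (exist _ X _) X DX (idm Lq X) (idm Lq X) (comp_idl _)).
have [f [g [gf _ _]]] := rep_retract satF Lq X0.
move: f g gf; rewrite -XE.
move=> f g gf; exact: (@retract_contractible R _ Lq _ _ DC (exist _ X _) X0 DX0 f g gf).
Qed.

End Levels.

(** * Comparison with the centric linking system *)

Section Centric.
Variables (R : realType) (gT : finGroupType) (S : {group gT}) (F : fusion_system S).
Variables (L : centric_linking_system F) (Lq : quasicentric_linking_system F) (e : extends L Lq).

Let D (X : quasicentric_obj F) := centric F (sval X).
Let h (P : centric_obj F) : {X | D X} := exist D (centric_quasi P) (svalP P).

Let corestr : functor L (fullsub Lq D) h :=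
  @Functor _ _ L (fullsub Lq D) h (fun P Q f => fmap e f) (fmap_id e) (@fmap_comp _ _ _ _ _ e).

(** The centric subgroup underlying an object gives the object back only up to its proof of
    quasicentricity, so the counit of the coreflection is a transported identity. *)
Let cast P Y (E : centric_quasi P = Y) : Mor Lq (centric_quasi P) Y :=
  match E in _ = Y return Mor Lq (centric_quasi P) Y with erefl => idm Lq _ end.

Let cast_lift P Y (E : centric_quasi P = Y) Q (m : Mor Lq (centric_quasi Q) Y) :
  exists v : Mor L Q P, comp (cast E) (fmap e v) = m.
Proof.
case: _ / E m => m /=; have [k _ kE] := emb_bij e Q P.
by exists (k m); rewrite comp_idl kE.
Qed.

Let cast_mono P Y (E : centric_quasi P = Y) Q (v v' : Mor L Q P) :
  comp (cast E) (fmap e v) = comp (cast E) (fmap e v') -> v = v'.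
Proof.
case: _ / E => /=; have [k ke _] := emb_bij e Q P.
by rewrite !comp_idl => /(congr1 k); rewrite !ke.
Qed.

Lemma emb_equivalence : incl_equivalence R Lq D ->
  homotopy_equivalence R (nerve_realization_map R e).
Proof.
move=> eqD.
have -> : nerve_realization_map R e =
    nerve_realization_map R (incl_functor Lq D) \o nerve_realization_map R corestr.
  rewrite -nerve_realization_map_comp; apply/funext => z.
  have [n [x [t ->]]] := rpt_surj z; rewrite !nerve_realization_mapE; congr rpt.
  by case: x => k G; apply: nerve_eq.
apply: homotopy_equivalence_comp eqD.
have E (X : {X | D X}) : centric_quasi (exist _ (sval (sval X)) (svalP X)) = sval X.
  exact: quasicentric_obj_eq.
apply: (@coreflective_equivalence R _ _ L (fullsub Lq D) h corestr
  (fun X => exist _ (sval (sval X)) (svalP X)) (fun X => cast (E X))).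
- by move=> X Q m; apply: cast_lift.
- by move=> X Q v v'; apply: cast_mono.
Qed.

End Centric.

Theorem theorem3p5 (R : realType) (p : nat) (p_prime : prime p)
    (gT : finGroupType) (S : {group gT}) (pS : (p.-group S)%g)
    (F : fusion_system S) (satF : saturated F p)
    (L : centric_linking_system F) (Lq : quasicentric_linking_system F)
    (e : extends L Lq)
    (D : quasicentric_obj F -> Prop)
    (radD : forall P : quasicentric_obj F,
       radical F p (sval P) -> centric F (sval P) -> D P) :
  homotopy_equivalence R (nerve_realization_map R (incl_functor Lq D)) /\
  homotopy_equivalence R (nerve_realization_map R e).
Proof.
split; first exact (radical_centric_incl_equivalence R satF pS Lq radD).
(* The centric subgroups themselves are an admissible choice of [D]. *)
apply: emb_equivalence; apply: (radical_centric_incl_equivalence R satF pS) => //.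
Qed.
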